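(* Let $G$ be a locally compact, compactly generated group and let $K$ be a centered probability density on $G$ such that $K$ is compactly supported, bounded, and $\inf\{K(g):g\in W\}>0$ for some relatively compact, open and symmetric neighborhood $W$ of the identity $e$ of $G$ which generates $G$. Let $Tf=K*f$. Then there exists $c>0$ such that $$|((I-T)f_1,f_2)|\le c\,\Gamma_2(f_1)\Gamma_2(f_2)\quad\text{for all } f_1,f_2\in L^2.$$ Moreover, $T$ is analytic in $L^p$ for each $p\in(1,\infty)$; that is, for each $p\in(1,\infty)$ there is $c>0$ with $\|(I-T)T^n\|_{p\to p}\le c\,n^{-1}$ for all $n\in\mathbb{N}$.
   Context: $\mathbb{N}=\{1,2,3,\dots\}$; $dg$ is a left Haar measure on $G$; $L^p=L^p(G;dg)$ (complex-valued); $(f_1,f_2)=\int_G dg\,f_1\overline{f_2}$; $\|\cdot\|_{p\to q}$ is the norm of bounded operators $L^p\to L^q$. Convolution: $(f_1*f_2)(g)=\int_G dh\,f_1(h)f_2(h^{-1}g)$. A probability density on $G$ is a Borel measurable $K:G\to[0,\infty)$ with $\int_G dg\,K(g)=1$. Fix a relatively compact, open, symmetric ($U=U^{-1}$) neighborhood $U$ of $e$ which generates $G$. $(L(g)f)(h)=f(g^{-1}h)$, $\partial_g=L(g)-I$, $\Gamma_p(f)=\sup_{u\in U}\|\partial_uf\|_p$. Centered: let $G_0=\overline{[G,G]}$ be the closure of the commutator subgroup, $\pi_0:G\to G/G_0$ the canonical homomorphism. $G/G_0$ is a compactly generated locally compact abelian group, so $G/G_0\cong\mathbb{R}^q\times\mathbb{Z}^r\times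 M$ with integers $q,r\ge0$ and $M$ a compact abelian group. Put $G_1=\pi_0^{-1}(\{0\}\times M)$, and let $\pi_1:G\to G/G_1\cong\mathbb{R}^q\times\mathbb{Z}^r$ have components $\pi_1^{(i)}$, $i\in\{1,\dots,q+r\}$ (real-valued for $i\le q$, integer-valued for $i>q$). $K$ is centered if $\int_G dg\,K(g)\pi_1^{(i)}(g)=0$ for all $i\in\{1,\dots,q+r\}$. *)

(* Defs.v *)
From HB Require Import structures.
From mathcomp Require Import all_boot all_order all_algebra.
From mathcomp Require Import complex.
From mathcomp Require Import all_classical all_reals all_analysis.

Set Implicit Arguments.
Unset Strict Implicit.
Unset Printing Implicit Defensive.

Import Order.TTheory GRing.Theory Num.Theory.
Import numFieldNormedType.Exports.

Local Open Scope classical_set_scope.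
Local Open Scope ring_scope.
Local Open Scope quotient_scope.

(* The point carried by [Pointed] plays no role; [g_sigma_algebraType] needs
   it. *)
HB.mixin Record isTopologicalGroup G & Topological G & Group G := {
  mulg_continuous : continuous (fun x : G * G => (x.1 * x.2)%g) ;
  invg_continuous : continuous (fun x : G => x^-1%g)
}.

#[short(type="topologicalGroupType")]
HB.structure Definition TopologicalGroup :=
  {G of PointedTopological G & Group G & isTopologicalGroup G}.

HB.instance Definition _ := hasNbhs.Build int principal_filter.
HB.instance Definition _ := Discrete_ofNbhs.Build int erefl.

Section Groups.
Context (G : topologicalGroupType).

Definition is_subgroup (H : set G) :=
  [/\ H 1%g, (forall x y, H x -> H y -> H (x * y)%g) &
     forall x, H x -> H x^-1%g].

Definition generated (A : set G) : set G := smallest is_subgroup A.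

Definition compactly_generated :=
  exists2 C : set G, compact C & generated C = setT.

Definition generating_nbhd (U : set G) :=
  [/\ open U, U 1%g, precompact U, [set x^-1%g | x in U] = U &
     generated U = setT].

Definition commutator_subgroup : set G :=
  generated [set commg x y | x in setT & y in setT].

Definition G0 : set G := closure commutator_subgroup.

Definition coset_G0 (g : G) : set G := [set (g * x)%g | x in G0].

Definition eq_coset_G0 (g h : G) : bool := `[< coset_G0 g = coset_G0 h >].

Lemma eq_coset_G0_refl : reflexive eq_coset_G0.
Proof. by move=> g; exact/asboolP. Qed.

Lemma eq_coset_G0_sym : symmetric eq_coset_G0.
Proof. by move=> g h; apply/asboolP/asboolP => ->. Qed.

Lemma eq_coset_G0_trans : transitive eq_coset_G0.
Proof. by move=> h g k /asboolP gh /asboolP hk; apply/asboolP; rewrite gh. Qed.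

Canonical eq_coset_G0_equiv :=
  EquivRel eq_coset_G0 eq_coset_G0_refl eq_coset_G0_sym eq_coset_G0_trans.

Definition abelianization := quotient_topology {eq_quot eq_coset_G0}.

Definition pi0 (g : G) : abelianization := \pi_{eq_quot eq_coset_G0} g.

End Groups.

(* An isomorphism of topological groups G / G0 ~ R^q x Z^r x M with M compact
   abelian. The group law of G / G0 is pi0 g * pi0 h = pi0 (g * h), whence the
   form of [split_morph]. *)
Record splitting (R : realType) (G : topologicalGroupType) := Splitting {
  split_q : nat ;
  split_r : nat ;
  split_M : topologicalZmodType ;
  split_M_hausdorff : hausdorff_space split_M ;
  split_M_compact : compact [set: split_M] ;
  split_iso : abelianization G -> 'rV[R]_split_q * 'rV[int]_split_r * split_M ;
  split_inv : 'rV[R]_split_q * 'rV[int]_split_r * split_M -> abelianization G ;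
  split_isoK : cancel split_iso split_inv ;
  split_invK : cancel split_inv split_iso ;
  split_iso_continuous : continuous split_iso ;
  split_inv_continuous : continuous split_inv ;
  split_morph : forall g h : G,
    split_iso (pi0 (g * h)%g) = split_iso (pi0 g) + split_iso (pi0 h)
}.

(* The kernel of [pi1] is G1 = pi0^-1({0} x M), so that [pi1] is the canonical
   map G -> G / G1 ~ R^q x Z^r. *)
Definition pi1 (R : realType) (G : topologicalGroupType) (D : splitting R G)
    (g : G) : 'rV[R]_(split_q D) * 'rV[int]_(split_r D) :=
  (split_iso D (pi0 g)).1.

Notation borel G := (g_sigma_algebraType (@open G)).

Section Analysis.
Context (R : realType) (G : topologicalGroupType).
Variable mu : {measure set (borel G) -> \bar R}.
Local Notation C := R[i].

(* Left Haar measure as a Radon measure: outer regular on Borel sets, inner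
   regular on open sets. *)
Definition left_haar_measure :=
  [/\ (forall (g : G) (A : set (borel G)), measurable A ->
         mu [set (g * x)%g | x in A] = mu A),
      (forall A : set G, compact A -> (mu A < +oo)%E),
      mu setT != 0%E,
      (forall A : set (borel G), measurable A ->
         mu A = ereal_inf [set mu O | O in [set O : set G | open O /\ A `<=` O]]) &
      (forall O : set G, open O ->
         mu O = ereal_sup [set mu A | A in [set A : set G | compact A /\ A `<=` O]])].

Definition measurableC (f : G -> C) :=
  measurable_fun [set: borel G] (fun g : borel G => complex.Re (f g)) /\
  measurable_fun [set: borel G] (fun g : borel G => complex.Im (f g)).

Definition integralC (f : G -> C) : C :=
  Complex (\int[mu]_g complex.Re (f g)) (\int[mu]_g complex.Im (f g)).

Definition normLp (p : R) (f : G -> C) : \bar R :=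
  'N[mu]_p%:E[EFin \o (@Normc.normc R \o f)]%E.

(* Functions, not classes modulo a.e. equality. *)
Definition Lp (p : R) : set (G -> C) :=
  [set f | measurableC f /\ (normLp p f < +oo)%E].

Definition inner (f1 f2 : G -> C) : C :=
  integralC (fun g => f1 g * conjc (f2 g)).

Definition conv (f1 f2 : G -> C) : G -> C :=
  fun g => integralC (fun h => f1 h * f2 (h^-1 * g)%g).

Definition Ltrans (g : G) (f : G -> C) : G -> C := fun h => f (g^-1 * h)%g.

Definition partial (g : G) (f : G -> C) : G -> C := Ltrans g f \- f.

Definition Gamma (U : set G) (p : R) (f : G -> C) : \bar R :=
  ereal_sup [set normLp p (partial u f) | u in U].

(* +oo unless S maps L^p boundedly to L^q. *)
Definition opnorm (p q : R) (S : (G -> C) -> (G -> C)) : \bar R :=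
  ereal_inf [set c%:E | c in [set c : R | 0 <= c /\
    forall f, Lp p f -> Lp q (S f) /\ (normLp q (S f) <= c%:E * normLp p f)%E]].

Definition analytic (p : R) (T : (G -> C) -> (G -> C)) :=
  exists2 c : R, 0 < c & forall n : nat, (0 < n)%N ->
    (opnorm p p (fun f => iter n T f \- T (iter n T f))%R <= (c / n%:R)%:E)%E.

Definition probability_density (K : G -> R) :=
  [/\ measurable_fun [set: borel G] (K : borel G -> R),
      (forall g, 0 <= K g) & (\int[mu]_g (K g)%:E = 1)%E].

Definition centered (D : splitting R G) (K : G -> R) :=
  (forall i, \int[mu]_g (K g * (pi1 D g).1 0 i) = 0) /\
  (forall j, \int[mu]_g (K g * ((pi1 D g).2 0 j)%:~R) = 0).

Definition conv_op (K : G -> R) (f : G -> C) : G -> C :=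
  conv (fun g => (K g)%:C%C) f.

End Analysis.

Definition compactly_supported (R : realType) (G : topologicalGroupType)
    (K : G -> R) :=
  compact (closure [set g | K g != 0]).

(* Main.v *)
(* The function phi(h) = Re ((L_h - I) f1, f2) is almost additive: its defect
   phi(gh) - phi(g) - phi(h) = Re (d_h f1, d_(g^-1) f2) is O(Gamma_2(f1)
   Gamma_2(f2)) on compact sets. Such a phi is within O(Gamma_2(f1)
   Gamma_2(f2)), on compact sets, of a linear combination of the coordinates
   of pi1: it is small on commutators, hence on G_0, and halving repeatedly
   makes it small on compact sets once its values on generators of
   R^q x Z^r have been subtracted. As K is centered, the linear part
   integrates to zero, whence the bound on ((I - T) f1, f2).

   For f in L^p put F = |f|^(p/2-1) f, J f = |f|^(p-2) f, X = <T f, J f> and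
   n = |f|_p^p. The same argument gives |n - X| <= c Q(F), with Q(F) the integral
   of K(h) |z L_h F - F|_2^2 for any unimodular z, while the uniform
   convexity of t |-> t^p gives n - Re (z X) >= c' Q(F). Choosing z with
   z X = |X| puts X/n in a Stolz domain, hence |n - w X| >= c'' |1 - w| n and
   |(I - w T) f|_p >= c'' |1 - w| |f|_p for all |w| < 1. This
   resolvent estimate implies |T^n - T^(n+1)| = O(1/n). *)

Require Import Defs.
From HB Require Import structures.
From mathcomp Require Import all_boot all_order all_algebra.
From mathcomp Require cyclic separable cyclotomic.
From mathcomp Require Import complex ring lra zify.
From mathcomp Require Import all_classical all_reals all_analysis.
From mathcomp Require Import measurable_realfun.

Import Order.TTheory GRing.Theory Num.Theory.
Import numFieldNormedType.Exports.

Set Implicit Arguments.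
Unset Strict Implicit.

Local Open Scope classical_set_scope.
Local Open Scope ring_scope.

(** Constants must not depend on the functions, so smallness is stated for a whole family of phi,
    each with its own scale d. Each commutator is small, but an element of the commutator subgroup
    may need arbitrarily many of them and the family need not be equicontinuous, so the closure is
    not reached by a limit. Instead, finitely many elements of the commutator subgroup move a
    compact piece of [G0] close to the identity, and there doubling turns the qualitative bound on
    each phi into a uniform one.

    For |n - X| the differences of f and J f cannot be estimated separately by those of F, since one
    of the two power maps is in general only Hoelder at the origin; only their product is quadratic.
    Q(F) controls |L_g F - F|_2^2 for g in a compact set because K is bounded below on W and W
    generates.

    The last step uses (I - wT)^-3: its coefficients grow like n^2, while (I - T)(I - wT)^-3 is O(|1
    - w|^-2), whose mean over |w| = r is of order 1 / (1 - r). Taking 1 - r = 1 / (n + 1) leaves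
    O(1/n). *)

Local Notation nrm := Normc.normc.

(** * The power maps of the complex plane *)

Section Pointwise.
Context {R : realType}.
Implicit Types (x y s t : R) (a b c : R[i]).

Definition dot a b : R := complex.Re a * complex.Re b + complex.Im a * complex.Im b.

(* [f = psi (2 / p) F] and [J f = psi (2 - 2 / p) F] when [F = psi (p / 2) f];
   the exponents of [f] and [J f] add up to [2]. *)
Definition psi s a : R[i] := (nrm a `^ (s - 1))%:C%C * a.

Lemma nrm_ge0 a : 0 <= nrm a.
Proof. by case: a => u v; exact: sqrtr_ge0. Qed.

Lemma sqr_nrm a : nrm a ^+ 2 = complex.Re a ^+ 2 + complex.Im a ^+ 2.
Proof. by case: a => u v /=; rewrite sqr_sqrtr ?addr_ge0 ?sqr_ge0. Qed.

Lemma nrmD a b : nrm (a + b) <= nrm a + nrm b.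
Proof. exact: le_normcD. Qed.

Lemma nrmN a : nrm (- a) = nrm a.
Proof. exact: normcN. Qed.

Lemma nrmB a b : nrm (a - b) = nrm (b - a).
Proof. by rewrite -nrmN opprB. Qed.

Lemma nrmM a b : nrm (a * b) = nrm a * nrm b.
Proof. exact: Normc.normcM. Qed.

Lemma nrm0 : nrm (0 : R[i]) = 0.
Proof. exact: Normc.normc0. Qed.

Lemma nrm1 : nrm (1 : R[i]) = 1.
Proof. exact: Normc.normc1. Qed.

Lemma nrm_eq0 a : (nrm a == 0) = (a == 0).
Proof.
apply/eqP/eqP => [|->]; last exact: nrm0.
exact: Normc.eq0_normc.
Qed.

Lemma nrmC x : nrm x%:C%C = `|x|.
Proof. by rewrite /= expr0n addr0 sqrtr_sqr. Qed.

Lemma nrm_dist a b c : nrm (a - c) <= nrm (a - b) + nrm (b - c).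
Proof. by rewrite (_ : a - c = (a - b) + (b - c)) ?nrmD // addrA subrK. Qed.

Lemma ler_nrmB a b : `|nrm a - nrm b| <= nrm (a - b).
Proof.
rewrite ler_norml lerBlDr; apply/andP; split.
  rewrite lerNl opprB lerBlDr nrmB (le_trans _ (nrmD _ _)) //.
  by rewrite subrK.
by rewrite (le_trans _ (nrmD _ _)) // subrK.
Qed.

Lemma sqr_nrm_dist a b c :
  nrm (a - c) ^+ 2 <= 2 * nrm (a - b) ^+ 2 + 2 * nrm (b - c) ^+ 2.
Proof.
have := nrm_dist a b c; have := nrm_ge0 (a - c).
move: (nrm (a - c)) (nrm (a - b)) (nrm (b - c)) => w u v w0 h.
have : w ^+ 2 <= (u + v) ^+ 2.
  by rewrite ler_pXn2r // nnegrE // (le_trans w0).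
by have := sqr_ge0 (u - v); rewrite !expr2; nra.
Qed.

Lemma dotE a : dot a a = nrm a ^+ 2.
Proof. by rewrite sqr_nrm /dot !expr2. Qed.

Lemma dotC a b : dot a b = dot b a.
Proof. by rewrite /dot mulrC [X in _ + X]mulrC. Qed.

Lemma dotDl a b c : dot (a + b) c = dot a c + dot b c.
Proof. by case: a b c => [? ?] [? ?] [? ?]; rewrite /dot /=; ring. Qed.

Lemma dotNl a b : dot (- a) b = - dot a b.
Proof. by case: a b => [? ?] [? ?]; rewrite /dot /=; ring. Qed.

Lemma dotBl a b c : dot (a - b) c = dot a c - dot b c.
Proof. by rewrite dotDl dotNl. Qed.

Lemma dotZl x a b : dot (x%:C%C * a) b = x * dot a b.
Proof. by case: a b => [? ?] [? ?]; rewrite /dot /=; ring. Qed.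

Lemma dotBr a b c : dot c (a - b) = dot c a - dot c b.
Proof. by rewrite dotC dotBl dotC [dot b c]dotC. Qed.

Lemma dotZr x a b : dot a (x%:C%C * b) = x * dot a b.
Proof. by rewrite dotC dotZl dotC. Qed.

Lemma sqr_nrmB a b :
  nrm (a - b) ^+ 2 = nrm a ^+ 2 + nrm b ^+ 2 - 2 * dot a b.
Proof.
by rewrite !sqr_nrm; case: a b => [? ?] [? ?]; rewrite /dot /=; ring.
Qed.

Lemma dot_le a b : `|dot a b| <= nrm a * nrm b.
Proof.
rewrite -(@ler_pXn2r _ 2%N) ?nnegrE ?mulr_ge0 ?nrm_ge0 ?normr_ge0 //.
rewrite exprMn !sqr_nrm real_normK ?num_real //.
case: a b => [u v] [z w]; rewrite /dot /= -subr_ge0.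
rewrite (_ : _ - _ = (u * w - v * z) ^+ 2) ?sqr_ge0 //; ring.
Qed.

Lemma nrm_psi s a : 0 < s -> nrm (psi s a) = nrm a `^ s.
Proof.
move=> s0; rewrite /psi nrmM nrmC ger0_norm ?powR_ge0 // mulrC.
by rewrite mulr_powRB1 ?nrm_ge0.
Qed.

Lemma psi0 s : psi s 0 = 0 :> R[i].
Proof. by rewrite /psi mulr0. Qed.

Lemma psiM s a b : nrm a = 1 -> psi s (a * b) = a * psi s b.
Proof. by move=> a1; rewrite /psi nrmM a1 mul1r mulrCA. Qed.

Lemma psi_psi s t a : 0 < s -> 0 < t -> psi s (psi t a) = psi (s * t) a.
Proof.
move=> s0 t0; have [->|a0] := eqVneq a 0; first by rewrite !psi0.
rewrite {1}/psi nrm_psi // /psi mulrA -rmorphM /=; congr (_%:C%C * _).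
rewrite -powRrM -powRD; last by rewrite nrm_eq0 a0 implybT.
by congr (_ `^ _); ring.
Qed.

Lemma psi1 a : psi 1 a = a.
Proof. by rewrite /psi subrr powRr0 mul1r. Qed.

(** Weighted AM-GM for [(x y)^s (y^2)^(1 - s)]: once the product is replaced by
    [s x y + (1 - s) y^2], the two sides are equal. *)
Lemma young_rem x y s : 0 <= x -> 0 <= y -> 0 < s -> s <= 1 ->
  s / 2 * (x - y) ^+ 2 <= s / 2 * x ^+ 2 + (2 - s) / 2 * y ^+ 2 - x `^ s * y `^ (2 - s).
Proof.
move=> x0 y0 s0 s1.
suff : x `^ s * y `^ (2 - s) <= s * (x * y) + (1 - s) * y ^+ 2 by nra.
move: s1; rewrite le_eqVlt => /orP[/eqP ->|s1].
  by rewrite (_ : 2 - 1 = 1 :> R) ?powRr1 //; [nra|ring].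
have -> : x `^ s * y `^ (2 - s) = (x * y) `^ s * (y ^+ 2) `^ (1 - s).
  rewrite powRM // -powR_mulrn // -powRrM -mulrA -powRD; last first.
    by apply/implyP => /eqP; lra.
  by congr (_ * y `^ _); ring.
have s1' : 0 < 1 - s by rewrite subr_gt0.
have := @conjugate_powR R ((x * y) `^ s) ((y ^+ 2) `^ (1 - s)) s^-1 (1 - s)^-1.
rewrite !powR_ge0 !invr_gt0 s0 s1' !invrK subrKC -!powRrM !divff ?gt_eqF //.
rewrite !powRr1 ?mulr_ge0 ?exprn_ge0 //.
by move=> /(_ isT isT isT isT erefl); rewrite mulrC [_ * s]mulrC [_ * (1 - s)]mulrC; lra.
Qed.

Lemma young_rem2 x y s : 0 <= x -> 0 <= y -> 0 < s -> s < 2 ->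
  Num.min s (2 - s) / 2 * (x - y) ^+ 2 <=
  s / 2 * x ^+ 2 + (2 - s) / 2 * y ^+ 2 - x `^ s * y `^ (2 - s).
Proof.
move=> x0 y0 s0 s2; have [s1|s1] := leP s 1.
  by rewrite min_l ?young_rem //; lra.
rewrite min_r; last lra.
have := @young_rem y x (2 - s) y0 x0; rewrite subKr.
by move=> /(_ ltac:(lra) ltac:(lra)); rewrite [y `^ _ * _]mulrC; nra.
Qed.

(** Half of the constant in [young_rem2]; the other half absorbs the change of phase in
    [dot_psi_le]. *)
Definition psi_mod s : R := Num.min s (2 - s) / 4.

Lemma psi_mod_gt0 s : 0 < s -> s < 2 -> 0 < psi_mod s.
Proof. by move=> s0 s2; rewrite divr_gt0 // lt_min s0 subr_gt0. Qed.

(** Put [AB = |b|^(s-1) |a|^(1-s)]. The right side is the remainder of [young_rem2] for the moduli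
    plus [AB (|a| |b| - dot b a)], which measures the angle. If [AB >= m / 2] this second part pays
    for the angle on the left; if [AB < m / 2] the product term is so small that the quadratic terms
    suffice alone. *)
Lemma dot_psi_le s a b : 0 < s -> s < 2 ->
  psi_mod s * nrm (b - a) ^+ 2 <=
  s / 2 * nrm b ^+ 2 + (2 - s) / 2 * nrm a ^+ 2 - dot (psi s b) (psi (2 - s) a).
Proof.
move=> s0 s2; have := @young_rem2 _ _ s (nrm_ge0 b) (nrm_ge0 a) s0 s2.
have := psi_mod_gt0 s0 s2; rewrite /psi_mod; set m := Num.min _ _.
have ms : m <= s by rewrite ge_min lexx.
have ms' : m <= 2 - s by rewrite ge_min lexx orbT.
have eb := @mulr_powRB1 R _ s (nrm_ge0 b) s0.
have ea := @mulr_powRB1 R _ (2 - s) (nrm_ge0 a) ltac:(lra).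
rewrite sqr_nrmB /psi dotZl dotZr -eb -ea.
have := dot_le b a; rewrite ler_norml => /andP[].
have := nrm_ge0 a; have := nrm_ge0 b.
have := powR_ge0 (nrm b) (s - 1); have := powR_ge0 (nrm a) (2 - s - 1).
move: (nrm a) (nrm b) (dot b a) (nrm a `^ _) (nrm b `^ _).
move=> u v d A B A0 B0 v0 u0 d1 d2 m0.
set AB := B * A; have AB0 : 0 <= AB by rewrite mulr_ge0.
rewrite (_ : v * B * (u * A) = AB * (v * u)); last by rewrite /AB; ring.
rewrite (mulrA B) -/AB => h.
have uv0 : 0 <= v * u by rewrite mulr_ge0.
have q0 : 0 <= m / 4 * (u - v) ^+ 2 by rewrite mulr_ge0 ?sqr_ge0 // ltW.
have [le|le] := leP (m / 2) AB.
  have : 0 <= (AB - m / 2) * (v * u - d) by rewrite mulr_ge0 ?subr_ge0.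
  by move: h q0; rewrite !expr2; lra.
have q1 : 0 <= (m / 2 - AB) * (v * u + d).
  by rewrite mulr_ge0 ?subr_ge0 ?(ltW le) //; lra.
have q2 : 0 <= (s - m) * v ^+ 2 by rewrite mulr_ge0 ?subr_ge0 ?sqr_ge0.
have q3 : 0 <= (2 - s - m) * u ^+ 2 by rewrite mulr_ge0 ?subr_ge0 ?sqr_ge0.
have q4 : 0 <= AB * (v * u) by rewrite mulr_ge0.
by move: q0 q1 q2 q3 q4; rewrite !expr2; lra.
Qed.

(** Dividing [x] by [y] reduces the claim to [|u^s - 1| <= |u - 1|], true because [u^s] lies between
    [1] and [u]. The factor [y] on the left keeps the inequality meaningful at [y = 0]. *)
Lemma powR_lip x y s : 0 <= s -> s <= 1 -> 0 <= x -> 0 <= y ->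
  `|x `^ s - y `^ s| * y <= y `^ s * `|x - y|.
Proof.
move=> s0 s1 x0 y0; have [->|yn0] := eqVneq y 0.
  by rewrite mulr0 mulr_ge0 ?powR_ge0.
have yp : 0 < y by rewrite lt_neqAle eq_sym yn0.
have -> : x = (x / y) * y by rewrite divfK.
have := divr_ge0 x0 y0; move: (x / y) => u u0.
rewrite powRM // -[X in _ - X]mul1r -mulrBl -[X in u * y - X]mul1r -mulrBl.
rewrite !normrM (ger0_norm (powR_ge0 _ _)) (ger0_norm y0).
rewrite -[leLHS]mulrA mulrCA ler_wpM2l ?powR_ge0 //.
apply: ler_wpM2r => //.
have [u1|u1] := leP 1 u.
  have h1 := ler1_powR u1 s1; have := ler_powR u1 s0; rewrite powRr0 => h2.
  by rewrite !ger0_norm ?subr_ge0 // lerB.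
have [->|un0] := eqVneq u 0.
  have [->|s00] := eqVneq s 0; first by rewrite powRr0 subrr normr0.
  by rewrite powR0.
have u01 : 0 < u <= 1 by rewrite lt_neqAle eq_sym un0 u0 ltW.
have h1 := ger1_powR u01 s1; have := ger_powR u01 s0; rewrite powRr0 => h2.
rewrite !ler0_norm ?subr_le0 //; last exact: ltW.
by rewrite lerN2 lerB.
Qed.

Lemma powR_subadd x y s : 0 <= s -> s <= 1 -> 0 <= x -> 0 <= y ->
  (x + y) `^ s <= x `^ s + y `^ s.
Proof.
move=> s0 s1 x0 y0; have [xy0|xyn0] := eqVneq (x + y) 0.
  have [-> ->] : x = 0 /\ y = 0 by lra.
  by rewrite addr0 lerDl powR_ge0.
have xyp : 0 < x + y by rewrite lt_neqAle eq_sym xyn0 addr_ge0.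
have fr u : 0 <= u -> u <= x + y -> u / (x + y) * (x + y) `^ s <= u `^ s.
  move=> u0 uxy; have [->|un0] := eqVneq u 0; first by rewrite !mul0r powR_ge0.
  rewrite -[in leRHS](divfK xyn0 u) powRM ?divr_ge0 ?addr_ge0 //.
  apply: ler_wpM2r; first exact: powR_ge0.
  apply: ger1_powR => //.
  rewrite divr_gt0 ?ler_pdivrMr ?mul1r //.
  by rewrite lt_neqAle eq_sym un0.
have := fr x x0 ltac:(lra); have := fr y y0 ltac:(lra).
have : x / (x + y) + y / (x + y) = 1 by rewrite -mulrDl divff.
move: ((x + y) `^ s) (x / _) (y / _) => A u v uv; nra.
Qed.

(** For [s < 1] the map [psi s] is not Lipschitz at the origin, and the weight compensates for this:
    it turns [psi s a] into [a] and [psi s b] into a rescaled [b], and [powR_lip] shows that the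
    rescaling moves [b] by at most [|b - a|]. *)
Lemma psi_le1 s a b : 0 < s -> s <= 1 ->
  nrm a `^ (1 - s) * nrm (psi s b - psi s a) <= 2 * nrm (b - a).
Proof.
move=> s0 s1; have [->|an0] := eqVneq a 0.
  rewrite nrm0 psi0 !subr0; have [->|s1'] := eqVneq s 1.
    by rewrite subrr powRr0 psi1; have := nrm_ge0 b; lra.
  by rewrite powR0 ?mul0r ?mulr_ge0 ?nrm_ge0 // subr_eq0 eq_sym.
have [->|bn0] := eqVneq b 0.
  rewrite psi0 !sub0r !nrmN nrm_psi // -powRD; last by rewrite nrm_eq0 an0 implybT.
  by rewrite subrK powRr1 ?nrm_ge0 //; have := nrm_ge0 a; lra.
have ap : 0 < nrm a by rewrite lt_neqAle eq_sym nrm_eq0 an0 nrm_ge0.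
have bp : 0 < nrm b by rewrite lt_neqAle eq_sym nrm_eq0 bn0 nrm_ge0.
set A := nrm a `^ (1 - s); set B := nrm b `^ (1 - s).
have B0 : 0 < B by exact: powR_gt0.
have AE : A * nrm (psi s b - psi s a) = nrm ((A / B)%:C%C * b - a).
  rewrite -[A in LHS](ger0_norm (powR_ge0 _ _)) -nrmC -nrmM mulrBr /psi.
  rewrite !mulrA -!rmorphM /= -(opprB 1 s) powRN -/B.
  by rewrite powRN -/A divff ?gt_eqF ?powR_gt0 // mul1r.
rewrite AE (_ : _ - a = (A / B - 1)%:C%C * b + (b - a)); last first.
  by rewrite rmorphB /= mulrBl mul1r addrA subrK.
rewrite (le_trans (nrmD _ _)) // mulrDl mul1r lerD2r nrmM nrmC.
rewrite (le_trans _ (ler_nrmB _ _)) // [leRHS]distrC.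
have := @powR_lip (nrm a) (nrm b) (1 - s) ltac:(lra) ltac:(lra) (nrm_ge0 _) (nrm_ge0 _).
rewrite -/A -/B => h.
rewrite -(ler_pM2l B0) (le_trans _ h) // mulrA -[X in X * `|_|](gtr0_norm B0).
by rewrite -normrM mulrBr mulr1 mulrCA divff ?gt_eqF // mulr1.
Qed.

(** If [|b - a| <= |a|], the weight in [psi_le1] may be lowered to [|b - a|^(1-s)]; otherwise
    [psi s a] and [psi s b] are themselves of size [|b - a|^s]. *)
Lemma psi_hoelder s a b : 0 < s -> s <= 1 ->
  nrm (psi s b - psi s a) <= 3 * nrm (b - a) `^ s.
Proof.
move=> s0 s1; have [ab|ab] := leP (nrm (b - a)) (nrm a).
  have [ba0|ban0] := eqVneq (nrm (b - a)) 0.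
    move/eqP: ba0; rewrite nrm_eq0 subr_eq0 => /eqP ->.
    by rewrite subrr nrm0 mulr_ge0 ?powR_ge0.
  have bap : 0 < nrm (b - a) by rewrite lt_neqAle eq_sym ban0 nrm_ge0.
  have h := psi_le1 a b s0 s1.
  have X0 : 0 < nrm (b - a) `^ (1 - s) by exact: powR_gt0.
  rewrite -(ler_pM2l X0) mulrCA -powRD ?ban0 ?implybT // subrK powRr1 ?nrm_ge0 //.
  apply: (@le_trans _ _ (nrm a `^ (1 - s) * nrm (psi s b - psi s a))).
    apply: ler_wpM2r; first exact: nrm_ge0.
    by rewrite ge0_ler_powR ?nnegrE ?nrm_ge0 // subr_ge0.
  by rewrite (le_trans h) // ler_wpM2r ?nrm_ge0 //; lra.
have nb : nrm b <= nrm (b - a) + nrm a by rewrite (le_trans _ (nrmD _ _)) // subrK.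
rewrite (le_trans (nrmD _ _)) // nrmN !nrm_psi //.
have h1 : nrm a `^ s <= nrm (b - a) `^ s.
  by rewrite ge0_ler_powR ?nnegrE ?nrm_ge0 // ltW.
have h2 : nrm b `^ s <= (nrm (b - a) + nrm a) `^ s.
  by rewrite ge0_ler_powR ?nnegrE ?addr_ge0 ?nrm_ge0 // ltW.
have := @powR_subadd _ _ s (ltW s0) s1 (nrm_ge0 (b - a)) (nrm_ge0 a); lra.
Qed.

Lemma psi_ge1 t a c : 1 <= t -> t < 2 ->
  nrm (psi t c - psi t a) <=
  2 * (nrm a `^ (t - 1) * nrm (c - a)) + nrm (c - a) `^ t.
Proof.
move=> t1 t2; set A := nrm a `^ (t - 1); set C := nrm c `^ (t - 1).
have -> : psi t c - psi t a = C%:C%C * (c - a) + (C - A)%:C%C * a.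
  by rewrite /psi -/A -/C rmorphB /= mulrBr mulrBl addrA subrK.
rewrite (le_trans (nrmD _ _)) // !nrmM !nrmC (ger0_norm (powR_ge0 _ _)).
have h1 : C <= nrm (c - a) `^ (t - 1) + A.
  have t1' : 0 <= t - 1 by lra.
  have t2' : t - 1 <= 1 by lra.
  apply: le_trans (powR_subadd t1' t2' (nrm_ge0 _) (nrm_ge0 _)).
  apply: ge0_ler_powR; rewrite ?nnegrE ?nrm_ge0 //.
    by rewrite addr_ge0 ?nrm_ge0.
  by rewrite (le_trans _ (nrmD _ _)) // subrK.
have h2 : `|C - A| * nrm a <= A * `|nrm c - nrm a|.
  by apply: powR_lip; rewrite ?nrm_ge0 //; lra.
have h3 := ler_nrmB c a.
have A0 : 0 <= A by exact: powR_ge0.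
rewrite -(@mulr_powRB1 _ (nrm (c - a)) t) ?nrm_ge0 //; last lra.
have := nrm_ge0 (c - a); move: (nrm (c - a)) (_ `^ (t - 1)) h1 h3 => u v h1 h3 u0.
have h4 : C * u <= (v + A) * u by rewrite ler_wpM2r.
have h5 : A * `|nrm c - nrm a| <= A * u by rewrite ler_wpM2l.
by rewrite (le_trans (lerD h4 (le_trans h2 h5))) //; lra.
Qed.

(** The weight [|a|^(1-s)] that [psi_ge1] produces for the exponent [2 - s] is the one [psi_le1]
    asks for the exponent [s]. The leftover [|c - a|^(2-s)] is paired with the Hoelder bound and
    Young's inequality. The two parts contribute [2] and [3] to the constant. *)
Lemma psi_cross_le1 s a b c : 0 < s -> s <= 1 ->
  nrm (psi s b - psi s a) * nrm (psi (2 - s) c - psi (2 - s) a) <=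
  5 * (nrm (b - a) ^+ 2 + nrm (c - a) ^+ 2).
Proof.
move=> s0 s1.
have h1 := @psi_ge1 (2 - s) a c ltac:(lra) ltac:(lra).
have h2 := psi_le1 a b s0 s1; have h3 := psi_hoelder a b s0 s1.
rewrite (le_trans (ler_wpM2l (nrm_ge0 _) h1)) //.
rewrite (_ : 2 - s - 1 = 1 - s); last by ring.
have h4 : nrm (b - a) `^ s * nrm (c - a) `^ (2 - s) <=
    nrm (b - a) ^+ 2 + nrm (c - a) ^+ 2.
  have := @young_rem _ _ s (nrm_ge0 (b - a)) (nrm_ge0 (c - a)) s0 s1.
  set w := _ * _ `^ _; move: (nrm (b - a)) (nrm (c - a)) w => u v w.
  have : 0 <= s / 2 * (u - v) ^+ 2 by rewrite mulr_ge0 ?sqr_ge0 //; lra.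
  have : 0 <= (1 - s / 2) * u ^+ 2 by rewrite mulr_ge0 ?sqr_ge0 //; lra.
  have : 0 <= s / 2 * v ^+ 2 by rewrite mulr_ge0 ?sqr_ge0 //; lra.
  by rewrite !expr2; lra.
have p1 := ler_wpM2r (powR_ge0 (nrm (c - a)) (2 - s)) h3.
have p2 := ler_wpM2r (nrm_ge0 (c - a)) h2.
have := nrm_ge0 (b - a); have := nrm_ge0 (c - a).
move: h4 p1 p2; move: (nrm (psi s b - psi s a)) => w.
move: (nrm a `^ _) (nrm (b - a) `^ _) (nrm (c - a) `^ _) => A B C.
move: (nrm (b - a)) (nrm (c - a)) => u v.
move=> h4 p1 p2 v0 u0; have := sqr_ge0 (u - v); rewrite mulrDr.
by move: h4; rewrite !expr2; lra.
Qed.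

Lemma psi_cross_le s a b c : 0 < s -> s < 2 ->
  nrm (psi s b - psi s a) * nrm (psi (2 - s) c - psi (2 - s) a) <=
  5 * (nrm (b - a) ^+ 2 + nrm (c - a) ^+ 2).
Proof.
move=> s0 s2; have [s1|s1] := leP s 1; first exact: psi_cross_le1.
have := @psi_cross_le1 (2 - s) a c b ltac:(lra) ltac:(lra).
by rewrite subKr; lra.
Qed.

End Pointwise.

(** * Ritt's estimate *)

Section RootsOfUnity.
Context {R : realType}.
Implicit Types (w u : R[i]) (M : nat).

Lemma prim_root_exists M : (0 < M)%N -> exists w : R[i], M.-primitive_root w.
Proof.
move=> M0; pose p : {poly R[i]} := 'X^M - 1.
have [r Dp] := closed_field_poly_normal p.
rewrite (monicP _) ?monicXnsubC // scale1r in Dp.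
have rM1 : all M.-unity_root r by apply/allP=> z; rewrite -root_prod_XsubC -Dp.
have sz_r : (M < (size r).+1)%N.
  by rewrite -(size_prod_XsubC r id) -Dp size_XnsubC.
have [|z] := hasP (cyclic.has_prim_root M0 rM1 _ sz_r); last by exists z.
by rewrite -separable.separable_prod_XsubC -Dp cyclotomic.separable_Xn_sub_1 // pnatr_eq0 -lt0n.
Qed.

Lemma nrmX u n : nrm (u ^+ n) = nrm u ^+ n.
Proof.
by elim: n => [|n IH]; rewrite ?expr0 ?nrm1 // !exprS nrmM IH.
Qed.

Lemma nrmV u : nrm u^-1 = (nrm u)^-1.
Proof. exact: Normc.normcV. Qed.

Lemma nrm_prim_root M w : M.-primitive_root w -> nrm w = 1.
Proof.
move=> wM; have M0 := prim_order_gt0 wM.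
have := congr1 (@Normc.normc R) (prim_expr_order wM); rewrite nrmX nrm1 => /eqP.
by rewrite pexpr_eq1 ?nrm_ge0 // => /eqP.
Qed.

Lemma conj_nrm1 w : nrm w = 1 -> conjc w = w^-1.
Proof.
move=> w1; have w0 : w != 0 by rewrite -nrm_eq0 w1 oner_eq0.
apply: (mulfI w0); rewrite divff //; have := sqr_nrm w; rewrite w1 expr1n.
case: w {w1 w0} => a b /= ab; apply/eqP; rewrite eq_complex /=.
by apply/andP; split; apply/eqP; [rewrite ab|]; ring.
Qed.

Lemma nrm2_conj u : u * conjc u = (nrm u ^+ 2)%:C%C.
Proof.
rewrite sqr_nrm; case: u => a b /=; apply/eqP; rewrite eq_complex /=.
by apply/andP; split; apply/eqP; ring.
Qed.

Lemma sum_unity M u : u ^+ M = 1 -> u != 1 -> \sum_(j < M) u ^+ j = 0.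
Proof.
move=> uM u1; apply: (@mulfI _ (u - 1)); first by rewrite subr_eq0.
by rewrite mulr0 -subrX1 uM subrr.
Qed.

Lemma sum_prim_root M w m n : M.-primitive_root w ->
  \sum_(j < M) (w ^+ j) ^+ m * (w ^+ j)^-1 ^+ n =
  if (m == n %[mod M])%N then M%:R else 0.
Proof.
move=> wM; have w0 : w != 0 by rewrite -nrm_eq0 (nrm_prim_root wM) oner_eq0.
pose u := w ^+ m * w^-1 ^+ n.
rewrite (eq_bigr (fun j : 'I_M => u ^+ j)); last first.
  by move=> j _; rewrite /u exprMn -[w ^- j]exprVn -!exprM ![(j * _)%N]mulnC.
have uE : (u == 1) = (m == n %[mod M])%N.
  rewrite -(eq_prim_root_expr wM) /u exprVn.
  by rewrite (can2_eq (divfK (expf_neq0 n w0)) (mulfK (expf_neq0 n w0))) mul1r.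
case: ifPn => [mn|mn].
  move: mn; rewrite -uE => /eqP ->.
  by rewrite (eq_bigr (fun=> 1)) ?sumr_const ?card_ord // => j _; rewrite expr1n.
apply: sum_unity; last by rewrite uE.
by rewrite /u exprMn !exprVn exprAC [w ^+ n ^+ M]exprAC (prim_expr_order wM)
   !expr1n invr1 mulr1.
Qed.

(** Orthogonality of the characters of Z/M; all exponents stay below [M], so distinct ones are never
    congruent. *)
Lemma parseval_geometric M w (r : R) : M.-primitive_root w ->
  \sum_(j < M) nrm (\sum_(m < M) (r%:C%C * w ^+ j) ^+ m) ^+ 2 =
  M%:R * \sum_(m < M) r ^+ (m + m).
Proof.
move=> wM; apply: (@complexI R); rewrite rmorph_sum /=.
pose a := fun (j : 'I_M) => \sum_(m < M) \sum_(l < M)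
  (r ^+ (m + l))%:C%C * ((w ^+ j) ^+ m * (w ^+ j)^-1 ^+ l).
rewrite (eq_bigr a); last first.
  move=> j _; rewrite -nrm2_conj rmorph_sum /= mulr_suml; apply: eq_bigr => m _.
  rewrite mulr_sumr; apply: eq_bigr => l _.
  have -> : conjc ((r%:C%C * w ^+ j) ^+ l) = (r%:C%C * (w ^+ j)^-1) ^+ l.
    rewrite rmorphXn; congr (_ ^+ l); rewrite rmorphM; congr (_ * _).
      exact: conjc_real.
    by apply: conj_nrm1; rewrite nrmX (nrm_prim_root wM) expr1n.
  by rewrite !exprMn exprD rmorphM !rmorphXn /=; ring.
rewrite /a exchange_big /= rmorphM rmorph_sum mulr_sumr /=; apply: eq_bigr => m _.
rewrite exchange_big /= (bigD1 m) //= [X in _ + X]big1 ?addr0.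
  by rewrite -mulr_sumr sum_prim_root // eqxx mulrC rmorph_nat.
move=> l lm; rewrite -mulr_sumr sum_prim_root // !modn_small //.
have -> : (m == l :> nat) = false by rewrite eq_sym; exact/negbTE.
by rewrite mulr0.
Qed.

End RootsOfUnity.

(** * Polynomials acting through an operator *)

Section PolynomialAction.
Context {R : realType} (V : lmodType R[i]) (E : set V) (T : V -> V).
Hypothesis E0 : E 0.
Hypothesis ED : forall u v, E u -> E v -> E (u + v).
Hypothesis EZ : forall a u, E u -> E (a *: u).
Hypothesis ET : forall u, E u -> E (T u).
Hypothesis TD : forall u v, E u -> E v -> T (u + v) = T u + T v.
Hypothesis TZ : forall a u, E u -> T (a *: u) = a *: T u.
Implicit Types (p q : {poly R[i]}) (f : V).

(** [T] is linear on [E] only, as convolution is linear only where its integrals converge. The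
    action is therefore additive in the polynomial without restriction, but multiplicative only on
    vectors of [E]. *)
Definition act p f : V := \sum_(i < size p) p`_i *: iter i T f.

Lemma act_wide n p f : (size p <= n)%N ->
  act p f = \sum_(i < n) p`_i *: iter i T f.
Proof.
move=> pn; rewrite /act -!(big_mkord xpredT (fun i => p`_i *: iter i T f)).
rewrite (big_cat_nat _ pn) //= [X in _ + X]big1_seq ?addr0 // => i.
by rewrite mem_index_iota => /andP[_ /andP[pi _]]; rewrite nth_default ?scale0r.
Qed.

Lemma actD p q f : act (p + q) f = act p f + act q f.
Proof.
rewrite (act_wide f (size_polyD p q)) (act_wide f (leq_maxl (size p) (size q))).
rewrite (act_wide f (leq_maxr (size p) (size q))) -big_split /=.
by apply: eq_bigr => i _; rewrite coefD scalerDl.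
Qed.

Lemma actZ a p f : act (a *: p) f = a *: act p f.
Proof.
rewrite (act_wide f (size_scale_leq a p)) /act scaler_sumr.
by apply: eq_bigr => i _; rewrite coefZ scalerA.
Qed.

Lemma act0 f : act 0 f = 0.
Proof. by rewrite /act size_poly0 big_ord0. Qed.

Lemma act_sum I (r : seq I) (P : pred I) (F : I -> {poly R[i]}) f :
  act (\sum_(i <- r | P i) F i) f = \sum_(i <- r | P i) act (F i) f.
Proof. by apply: (big_morph (act^~ f)) => [p q|]; rewrite ?actD ?act0. Qed.

Lemma act1 f : act 1 f = f.
Proof. by rewrite /act size_poly1 big_ord1 /= coef1 scale1r. Qed.

Lemma iter_E n f : E f -> E (iter n T f).
Proof. by move=> Ef; elim: n => //= n; exact: ET. Qed.

Lemma sum_E n (F : 'I_n -> V) : (forall i, E (F i)) -> E (\sum_(i < n) F i).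
Proof. by move=> EF; apply: (big_ind E) => // i _. Qed.

Lemma act_E p f : E f -> E (act p f).
Proof. by move=> Ef; apply: sum_E => i; apply: EZ; exact: iter_E. Qed.

Lemma T0 : T 0 = 0.
Proof. by rewrite -[X in T X](scale0r 0) TZ // scale0r. Qed.

Lemma T_sum n (F : 'I_n -> V) : (forall i, E (F i)) ->
  T (\sum_(i < n) F i) = \sum_(i < n) T (F i).
Proof.
elim: n F => [|n IH] F EF; first by rewrite !big_ord0 T0.
by rewrite !big_ord_recr /= TD ?IH //; apply: sum_E.
Qed.

Lemma actMX p f : E f -> act (p * 'X) f = T (act p f).
Proof.
move=> Ef; have sz : (size (p * 'X)%R <= (size p).+1)%N.
  by have [->|p0] := eqVneq p 0; rewrite ?mul0r ?size_poly0 // size_mulX.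
rewrite (act_wide f sz) big_ord_recl coefMX eqxx scale0r add0r.
rewrite T_sum => [|i]; last by apply: EZ; exact: iter_E.
by apply: eq_bigr => i _; rewrite coefMX /= TZ //; exact: iter_E.
Qed.

Lemma actM p q f : E f -> act (p * q) f = act p (act q f).
Proof.
move=> Ef; elim/poly_ind: p => [|p c IH]; first by rewrite mul0r !act0.
rewrite mulrDl !actD mulrAC !actMX ?IH //; last exact: act_E.
by rewrite mul_polyC actZ -[c%:P in RHS]alg_polyC actZ act1.
Qed.

Lemma actXn n f : E f -> act 'X^n f = iter n T f.
Proof.
move=> Ef; elim: n => [|n IH]; first by rewrite expr0 act1.
by rewrite exprSr actMX // IH.
Qed.

End PolynomialAction.

Section RittBound.
Context {R : realType}.
Implicit Types (r x : R) (M n : nat).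

Lemma geometric_mul_le r n : 0 <= r -> r < 1 -> n%:R * r ^+ n <= (1 - r)^-1.
Proof.
move=> r0 r1; have r1' : 0 < 1 - r by rewrite subr_gt0.
rewrite -[leRHS]mul1r ler_pdivlMr // -mulrA.
have -> : r ^+ n * (1 - r) = (1 - r) * r ^+ n by rewrite mulrC.
have : (1 - r) * (n%:R * r ^+ n) <= 1.
  apply: (@le_trans _ _ (1 - r ^+ n)); last by rewrite lerBlDr lerDl exprn_ge0.
  rewrite -[leRHS]opprB subrX1 -mulNr opprB ler_pM2l //.
  have -> : n%:R * r ^+ n = \sum_(i < n) r ^+ n.
    by rewrite sumr_const card_ord mulr_natl.
  rewrite ler_sum // => i _.
  exact: (ler_wiXn2l r0 (ltW r1) (ltnW (ltn_ord i))).
by rewrite mulrCA.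
Qed.

(** At multiples of four the expression is the fourth power of [4 k r^k]. With [t = sqrt r] this is
    [4 (k t^k) t^k], a bounded factor times a vanishing one. *)
Lemma poly_mul_geometric_small r e : 0 < r -> r < 1 -> 0 < e ->
  exists M0, forall k, (M0 <= k)%N -> (4 * k)%:R ^+ 4 * r ^+ (4 * k) <= e.
Proof.
move=> r0 r1 e0; pose t := Num.sqrt r.
have t0 : 0 <= t by rewrite sqrtr_ge0.
have t1 : t < 1 by rewrite -sqrtr1 ltr_sqrt.
have [d d0 de] : exists2 d, 0 < d & d ^+ 4 <= e.
  exists (Num.min 1 e); first by rewrite lt_min ltr01.
  have : Num.min 1 e <= 1 by rewrite ge_min lexx.
  have : Num.min 1 e <= e by rewrite ge_min lexx orbT.
  have : 0 < Num.min 1 e by rewrite lt_min ltr01.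
  move: (Num.min 1 e) => m m0 me m1; rewrite (le_trans _ me) // exprS.
  by rewrite -[leRHS]mulr1 ler_wpM2l ?exprn_ile1 // ltW.
pose d' := d * (1 - t) / 4.
have d'0 : 0 < d' by rewrite divr_gt0 // mulr_gt0 // subr_gt0.
have tcv : (fun n => t ^+ n) @ \oo --> (0 : R).
  by apply: cvg_expr; rewrite ger0_norm.
have [M0 _ hM0] := (@cvgrPdist_lt _ _ _ _ _ _ _).1 tcv _ d'0.
exists M0 => k /hM0 /=; rewrite sub0r normrN ger0_norm ?exprn_ge0 // => tk.
have rk : r ^+ k = t ^+ k * t ^+ k by rewrite -exprMn -expr2 sqr_sqrtr // ltW.
rewrite (mulnC 4%N) exprM -exprMn (le_trans _ de) //.
rewrite ler_pXn2r ?nnegrE ?mulr_ge0 ?exprn_ge0 ?(ltW d0) ?(ltW r0) //.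
have h := geometric_mul_le k t0 t1.
have t1' : 0 < 1 - t by rewrite subr_gt0.
have tk0 : 0 <= t ^+ k by rewrite exprn_ge0.
rewrite natrM rk [leLHS](_ : _ = 4 * (k%:R * t ^+ k) * t ^+ k); last by ring.
apply: (@le_trans _ _ (4 * (1 - t)^-1 * d')).
  apply: ler_pM; rewrite ?mulr_ge0 ?ler_pM2l //; last exact: ltW.
rewrite /d' le_eqVlt; apply/orP; left; apply/eqP; field.
by rewrite gt_eqF.
Qed.

(** Eliminates the number [M] of nodes from the averaged estimate: both [r^M] and the aliasing error
    [M^4 r^M] vanish as [M] grows along multiples of four. *)
Lemma le_of_vanishing_error (A B D r : R) n : 0 < r -> r < 1 -> 0 <= B -> 0 <= D ->
  (forall M, (n < M)%N -> A * (1 - r ^+ M) ^+ 2 <= B + D * (M%:R ^+ 4 * r ^+ M)) ->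
  A <= B.
Proof.
move=> r0 r1 B0 D0 h; apply/ler_addgt0Pr => e e0.
have [A0|A0] := leP A 0; first by rewrite (le_trans A0) // addr_ge0 // ltW.
(* The first bound keeps the aliasing term below [e / 2]; the second keeps the loss [2 A r^M] from
   expanding the square below [e / 2]. *)
pose e' := Num.min (e / (2 * (D + 1))) (e / (4 * A)).
have e'0 : 0 < e' by rewrite lt_min !divr_gt0 ?mulr_gt0 ?addr_ge0 // ltr_wpDl.
have [M0 hM0] := poly_mul_geometric_small r0 r1 e'0.
pose k := (maxn M0 n).+1; pose M := (4 * k)%N.
have nM : (n < M)%N.
  by rewrite /M (leq_trans _ (leq_pmull _ _)) // ltnS leq_maxr.
have k0 : (M0 <= k)%N by rewrite /k (leq_trans (leq_maxl M0 n)).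
have M1 : 1 <= M%:R ^+ 4 :> R by rewrite exprn_ege1 // ler1n /M /k mulnS.
have small := hM0 _ k0; have := h _ nM; rewrite -/M in small *.
have rM0 : 0 <= r ^+ M by rewrite exprn_ge0 // ltW.
have rMe : r ^+ M <= e'.
  by rewrite (le_trans _ small) // -[leLHS]mul1r ler_wpM2r.
have De : D * (M%:R ^+ 4 * r ^+ M) <= e / 2.
  apply: (@le_trans _ _ (D * e')); first by rewrite ler_wpM2l.
  apply: (@le_trans _ _ (D * (e / (2 * (D + 1))))).
    by rewrite ler_wpM2l // ge_min lexx.
  rewrite (_ : _ * _ = (D / (D + 1)) * (e / 2)); last first.
    by field; rewrite gt_eqF // ltr_wpDl.
  rewrite -[leRHS]mul1r ler_wpM2r ?divr_ge0 ?ltW // ltr_pdivrMr ?ltr_wpDl //.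
  by rewrite mul1r ltrDl.
have Ae : A * r ^+ M <= e / 4.
  apply: (@le_trans _ _ (A * (e / (4 * A)))).
    rewrite ler_pM2l // (le_trans rMe) // ge_min lexx orbT //.
  rewrite le_eqVlt; apply/orP; left; apply/eqP; field; rewrite gt_eqF //.
move: De Ae rM0; move: (r ^+ M) (D * _) => x y De Ae x0.
have : 0 <= A * x ^+ 2 by rewrite mulr_ge0 ?sqr_ge0 // ltW.
rewrite !expr2; lra.
Qed.

End RittBound.

(** * Cubes of truncated geometric series *)

Section GeometricCube.
Context {R : realType}.
Implicit Types (M n i : nat).

Definition geom M : {poly R[i]} := \sum_(m < M) 'X^m.

(** Numbers of ways to write [i] as an ordered sum of two, and below of three, numbers less than
    [M]. As natural numbers they are visibly nonnegative, and [lia] applies to them. *)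
Definition geom2_coef M i := (\sum_(j < i.+1) (j < M) * (i - j < M))%N.

Definition geom3_coef M i := (\sum_(j < i.+1) (j < M) * geom2_coef M (i - j))%N.

Lemma coef_geom M i : (geom M)`_i = (i < M)%N%:R.
Proof.
rewrite /geom coef_sum; have [iM|Mi] := ltnP i M.
  rewrite (bigD1 (Ordinal iM)) //= coefXn eqxx big1 ?addr0 // => j ji.
  by rewrite coefXn eq_sym -(inj_eq val_inj) /= in ji *; rewrite (negbTE ji).
rewrite big1 // => j _; rewrite coefXn gtn_eqF //.
exact: leq_trans (ltn_ord j) Mi.
Qed.

Lemma coef_geom2 M i : (geom M * geom M)`_i = (geom2_coef M i)%:R.
Proof.
rewrite coefM natr_sum; apply: eq_bigr => j _.
by rewrite !coef_geom natrM.
Qed.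

Lemma coef_geom3 M i : (geom M * (geom M * geom M))`_i = (geom3_coef M i)%:R.
Proof.
rewrite coefM natr_sum; apply: eq_bigr => j _.
by rewrite coef_geom coef_geom2 natrM.
Qed.

Lemma geom2_coef_le M i : (geom2_coef M i <= i.+1)%N.
Proof.
rewrite -[leqRHS]muln1 -[X in (X * _)%N](card_ord i.+1) -sum_nat_const.
by apply: leq_sum => j _; case: (_ < M)%N; case: (_ < M)%N.
Qed.

Lemma geom3_coef_le M i : (geom3_coef M i <= i.+1 * i.+1)%N.
Proof.
rewrite -[X in (_ <= X * _)%N](card_ord i.+1) -sum_nat_const.
apply: leq_sum => j _; rewrite (leq_trans (leq_mul (leq_b1 _) (leqnn _))) //.
by rewrite mul1n (leq_trans (geom2_coef_le _ _)) // ltnS leq_subr.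
Qed.

Lemma geom2_coefE M i : (i < M)%N -> geom2_coef M i = i.+1.
Proof.
move=> iM; rewrite /geom2_coef (eq_bigr (fun=> 1%N)).
  by rewrite sum_nat_const card_ord muln1.
move=> j _; rewrite (leq_ltn_trans (leq_subr _ _) iM).
by rewrite (leq_ltn_trans _ iM) // -ltnS.
Qed.

(** Below [M] the truncation is not felt and the coefficient is [(n + 1)(n + 2) / 2], as for
    [(1 - X)^-3]. *)
Lemma geom3_coef_ge M n : (n < M)%N -> (n * n <= 2 * geom3_coef M n)%N.
Proof.
move=> nM; have -> : geom3_coef M n = (\sum_(j < n.+1) j.+1)%N.
  rewrite (reindex_inj rev_ord_inj) /=; apply: eq_bigr => j _ /=.
  have jn : (j <= n)%N by rewrite -ltnS.
  by rewrite subSS (leq_ltn_trans jn nM) mul1n geom2_coefE // (leq_ltn_trans (leq_subr _ _) nM).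
elim: n {nM} => [//|n IH]; rewrite big_ord_recr /=.
move: (bigop _ _ _) IH => s; lia.
Qed.

Lemma size_geom3 M : (0 < M)%N -> (size (geom M * (geom M * geom M))%R <= 3 * M)%N.
Proof.
move=> M0; have sz : (size (geom M) <= M)%N.
  by apply/leq_sizeP => i Mi; rewrite coef_geom ltnNge Mi.
have := size_polyMleq (geom M) (geom M * geom M).
have := size_polyMleq (geom M) (geom M).
by lia.
Qed.

End GeometricCube.

(** * From the resolvent bound to powers of the operator *)

Section Ritt.
Context {R : realType} (V : lmodType R[i]) (E : set V) (T : V -> V) (N : V -> R).
Hypothesis E0 : E 0.
Hypothesis ED : forall u v, E u -> E v -> E (u + v).
Hypothesis EZ : forall a u, E u -> E (a *: u).
Hypothesis ET : forall u, E u -> E (T u).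
Hypothesis TD : forall u v, E u -> E v -> T (u + v) = T u + T v.
Hypothesis TZ : forall a u, E u -> T (a *: u) = a *: T u.
Hypothesis N0 : forall u, 0 <= N u.
Hypothesis ND : forall u v, E u -> E v -> N (u + v) <= N u + N v.
Hypothesis NZ : forall a u, E u -> N (a *: u) = nrm a * N u.
Hypothesis NT : forall u, E u -> N (T u) <= N u.
Implicit Types (p q : {poly R[i]}) (f u : V) (z w : R[i]).

Lemma E_sub u v : E u -> E v -> E (u - v).
Proof. by move=> Eu Ev; rewrite -scaleN1r; apply: ED => //; exact: EZ. Qed.

Lemma T_sub u v : E u -> E v -> T (u - v) = T u - T v.
Proof.
move=> Eu Ev; rewrite -[- v]scaleN1r TD ?TZ ?scaleN1r //.
by rewrite -scaleN1r; exact: EZ.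
Qed.

Lemma N_zero : N 0 = 0.
Proof. by rewrite -(scale0r (0 : V)) NZ // nrm0 mul0r. Qed.

Lemma N_opp u : E u -> N (- u) = N u.
Proof. by move=> Eu; rewrite -scaleN1r NZ // nrmN nrm1 mul1r. Qed.

Lemma N_sub u v : E u -> E v -> N (u - v) <= N u + N v.
Proof.
move=> Eu Ev; rewrite -[N v in leRHS]N_opp // ND //.
by rewrite -scaleN1r; exact: EZ.
Qed.

Lemma N_sum I (r : seq I) (P : pred I) (F : I -> V) : (forall i, E (F i)) ->
  N (\sum_(i <- r | P i) F i) <= \sum_(i <- r | P i) N (F i).
Proof.
move=> EF; suff [] : E (\sum_(i <- r | P i) F i) /\
  N (\sum_(i <- r | P i) F i) <= \sum_(i <- r | P i) N (F i) by [].
elim/big_rec2 : _ => [|i x y _ [Ex Nx]]; first by rewrite N_zero.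
by split; [exact: ED|rewrite (le_trans (ND _ _)) // lerD2l].
Qed.

Lemma N_iter n f : E f -> N (iter n T f) <= N f.
Proof.
move=> Ef; elim: n => //= n IH; apply: le_trans IH; apply: NT.
by elim: n => //= n; exact: ET.
Qed.

Variable c : R.
Hypothesis c0 : 0 < c.
Hypothesis lower_bound : forall z u, nrm z < 1 -> E u ->
  c * nrm (1 - z) * N u <= N (u - z *: T u).

Let Eact := act_E E0 ED EZ ET.
Let actM' := actM E0 ED EZ ET TD TZ.

Lemma act_X u : E u -> act T 'X u = T u.
Proof. by move=> Eu; rewrite -[X in act T X u]mul1r (actMX E0 ED EZ ET TD TZ) // act1. Qed.

Lemma act_1sub z u : E u -> act T (1 - z *: 'X) u = u - z *: T u.
Proof. by move=> Eu; rewrite actD act1 -[- (z *: 'X)]scaleNr actZ act_X // scaleNr. Qed.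

Lemma lower_bound_act z q f : nrm z < 1 -> E f ->
  c * nrm (1 - z) * N (act T q f) <= N (act T ((1 - z *: 'X) * q) f).
Proof.
move=> z1 Ef; by rewrite (le_trans (lower_bound z1 (Eact q Ef))) // actM' // act_1sub //; exact: Eact.
Qed.

Section Node.
Variables (M : nat) (r : R) (z : R[i]) (f : V).
Hypothesis r0 : 0 < r.
Hypothesis r1 : r < 1.
Hypothesis zr : nrm z = r.
Hypothesis zM : z ^+ M = (r ^+ M)%:C%C.
Hypothesis Ef : E f.

(** Truncated Neumann series in place of the inverse of [1 - z T]. At a node [z^M] is the real
    number [r^M], so that [(1 - z X) P] is the same polynomial [Q] for all nodes. *)
Let P := \sum_(m < M) (z *: 'X) ^+ m : {poly R[i]}.

Let Q := 1 - (r ^+ M)%:C%C *: 'X^M : {poly R[i]}.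

Let mulP : (1 - z *: 'X) * P = Q.
Proof. by rewrite -opprB mulNr -subrX1 opprB exprZn zM. Qed.

Let N_actQ g : E g -> N (act T Q g) <= 2 * N g.
Proof.
move=> Eg; rewrite /Q -[- (_ *: _)]scaleNr actD act1 actZ.
rewrite (actXn E0 ED EZ ET TD TZ) //.
have EM : E (iter M T g) by exact: iter_E.
apply: (le_trans (ND Eg (EZ _ EM))); rewrite NZ // nrmN nrmC ger0_norm ?exprn_ge0 ?(ltW r0) //.
rewrite mulr2n mulrDl mul1r lerD2l -[leRHS]mul1r ler_pM ?exprn_ge0 ?N_iter ?(ltW r0) //.
by rewrite exprn_ile1 // ltW.
Qed.

(** From [z (1 - T) = (1 - z T) - (1 - z)]: the first term cancels one of the three factors [P] up
    to [Q], the second gains a factor [|1 - z|], so both cost only [|1 - z|^-2]. This is traded for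
    the squared geometric sum, as [|1 - z|] times that sum is [1 - r^M]. The [8] is the cube of the
    bound [2] for [Q]. *)
Lemma resolvent_cube_bound :
  (1 - r ^+ M) ^+ 2 * N (act T (P * (P * P)) (f - T f)) <=
  r^-1 * (8 / c ^+ 2 + 8 / c ^+ 3) * N f * nrm (\sum_(m < M) z ^+ m) ^+ 2.
Proof.
have z1 : nrm z < 1 by rewrite zr.
pose d := nrm (1 - z); have d0 : 0 < d.
  rewrite lt_neqAle nrm_ge0 andbT eq_sym nrm_eq0 subr_eq0.
  by apply/eqP => /(congr1 (@Normc.normc R)); rewrite nrm1 zr => rr; move: r1; rewrite -rr ltxx.
set s := nrm (\sum_(m < M) _).
have ds : d * s = 1 - r ^+ M.
  rewrite /d /s -nrmM -opprB mulNr -subrX1 opprB zM.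
  by rewrite -(rmorph1 (real_complex R)) -rmorphB nrmC ger0_norm // subr_ge0 exprn_ile1 // ltW.
set g := f - T f; set p3 := P * (P * P).
have Q3 : N (act T (Q * (Q * Q)) f) <= 8 * N f.
  have EQ h : E h -> E (act T Q h) by exact: Eact.
  rewrite !actM' //; try exact: Eact.
  have := N_actQ Ef; have := N_actQ (EQ _ Ef); have := N_actQ (EQ _ (EQ _ Ef)); lra.
have cube (a b : {poly R[i]}) : a * b * (a * b * (a * b)) = a * (a * (a * (b * (b * b)))).
  by ring.
have cd : 0 < c * d by rewrite mulr_gt0.
have h3 : (c * d) ^+ 3 * N (act T p3 f) <= 8 * N f.
  apply: le_trans Q3; rewrite -mulP.
  rewrite cube -/p3.
  rewrite exprS -mulrA; apply: le_trans (lower_bound_act _ z1 Ef).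
  rewrite ler_pM2l // exprS -mulrA; apply: le_trans (lower_bound_act _ z1 Ef).
  by rewrite ler_pM2l // expr1; exact: lower_bound_act.
have h2 : (c * d) ^+ 2 * N (act T ((1 - z *: 'X) * p3) f) <= 8 * N f.
  apply: le_trans Q3; rewrite -mulP.
  rewrite cube -/p3.
  rewrite exprS -mulrA; apply: le_trans (lower_bound_act _ z1 Ef).
  by rewrite ler_pM2l // expr1; exact: lower_bound_act.
have Ng : r * N (act T p3 g) <= N (act T ((1 - z *: 'X) * p3) f) + d * N (act T p3 f).
  have Eg : E g by apply: E_sub => //; exact: ET.
  rewrite -zr -NZ; last exact: Eact.
  have -> : z *: act T p3 g = act T ((1 - z *: 'X) * p3) f - (1 - z) *: act T p3 f.
    have -> : act T p3 g = act T (p3 * (1 - 'X)) f.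
      by rewrite actM' // -[X in 1 - X]scale1r act_1sub // scale1r.
    rewrite -!actZ -[- act _ _ _]scaleN1r -actZ -actD; congr (act T _ f).
    by rewrite -!mul_polyC !polyCN !polyCB !polyC1; ring.
  rewrite /d -NZ; last exact: Eact.
  by apply: N_sub; [exact: Eact|apply: EZ; exact: Eact].
rewrite -ds -(ler_pM2l r0).
have -> : r * (r^-1 * (8 / c ^+ 2 + 8 / c ^+ 3) * N f * s ^+ 2) =
    s ^+ 2 * ((8 * N f) / c ^+ 2 + (8 * N f) / c ^+ 3).
  by field; rewrite !gt_eqF.
have -> : r * ((d * s) ^+ 2 * N (act T p3 g)) = s ^+ 2 * (d ^+ 2 * (r * N (act T p3 g))) by ring.
rewrite ler_wpM2l ?sqr_ge0 //.
apply: le_trans (ler_wpM2l (sqr_ge0 d) Ng) _; rewrite mulrDr lerD //.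
  by rewrite ler_pdivlMr ?exprn_gt0 //; move: h2; rewrite exprMn; lra.
by rewrite ler_pdivlMr ?exprn_gt0 //; move: h3; rewrite exprMn; lra.
Qed.

End Node.

Lemma geom_scale M (z : R[i]) :
  \sum_(m < M) (z *: 'X) ^+ m = geom M \Po (z *: 'X).
Proof.
rewrite /geom rmorph_sum /=; apply: eq_bigr => m _.
by rewrite rmorphXn /= comp_polyX.
Qed.

(* An average over the [M]-th roots of unity replaces Cauchy's formula on the
   circle of radius [r]; the last term is the aliasing error. *)
Lemma ritt_coef_bound (M n : nat) r f : 0 < r -> r < 1 -> E f -> (n < M)%N ->
  (n%:R ^+ 2 * N (iter n T f - iter n.+1 T f)) * (1 - r ^+ M) ^+ 2 <=
  2 * (r^-1 ^+ n.+1 * (8 / c ^+ 2 + 8 / c ^+ 3) * N f / (1 - r)) +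
  (108 * r^-1 ^+ n * N f) * (M%:R ^+ 4 * r ^+ M).
Proof.
move=> r0 r1 Ef nM; have M0 : (0 < M)%N by exact: leq_ltn_trans nM.
have [w wM] := @prim_root_exists R M M0.
pose z (j : 'I_M) := r%:C%C * w ^+ j.
have w1 := nrm_prim_root wM.
have zr j : nrm (z j) = r.
  by rewrite /z nrmM nrmX w1 expr1n mulr1 nrmC gtr0_norm.
have zM j : z j ^+ M = (r ^+ M)%:C%C.
  by rewrite /z exprMn -exprM mulnC exprM (prim_expr_order wM) expr1n mulr1 rmorphXn.
set K := 8 / c ^+ 2 + 8 / c ^+ 3.
have K0 : 0 <= K by rewrite addr_ge0 // divr_ge0 // exprn_ge0 // ltW.
pose g := f - T f; have Eg : E g by apply: E_sub => //; exact: ET.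
have gE m : iter m T g = iter m T f - iter m.+1 T f.
  by elim: m => [//|m IH]; rewrite iterS IH T_sub //; exact: iter_E.
have Ng m : N (iter m T g) <= 2 * N f.
  rewrite (le_trans (N_iter _ Eg)) // (le_trans (N_sub Ef (ET Ef))) //.
  by have := NT Ef; lra.
pose G := geom M * (geom M * geom M) : {poly R[i]}.
pose P3 j := let P := \sum_(m < M) (z j *: 'X) ^+ m in P * (P * P).
have P3E j : P3 j = \sum_(i < size G) (G`_i * z j ^+ i) *: 'X^i.
  rewrite /P3 geom_scale -!rmorphM /= -/G comp_polyE; apply: eq_bigr => i _.
  by rewrite exprZn scalerA.
pose S := \sum_(j < M) (z j)^-1 ^+ n *: act T (P3 j) g.
(* What the average over the nodes leaves of the coefficient of [T^i g]: only indices congruent to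
   [n] modulo [M] survive, and their coefficients are nonnegative. *)
pose a (i : nat) := if (i == n %[mod M])%N then
  (M%:R * (geom3_coef M i)%:R * r ^+ i * r^-1 ^+ n) else 0.
have a0 i : 0 <= a i.
  rewrite /a; case: ifP => // _.
  by rewrite !mulr_ge0 // exprn_ge0 ?invr_ge0 // ltW.
have SE : S = \sum_(i < size G) (a i)%:C%C *: iter i T g.
  rewrite /S (eq_bigr (fun j : 'I_M => \sum_(i < size G)
      ((z j)^-1 ^+ n * (G`_i * z j ^+ i)) *: iter i T g)); last first.
    move=> j _; rewrite P3E act_sum scaler_sumr; apply: eq_bigr => i _.
    by rewrite actZ (actXn E0 ED EZ ET TD TZ) // scalerA.
  rewrite exchange_big /=; apply: eq_bigr => i _; rewrite -scaler_suml; congr (_ *: _).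
  rewrite (eq_bigr (fun j : 'I_M => (G`_i * (r ^+ i * r^-1 ^+ n)%:C%C) *
      ((w ^+ j) ^+ i * (w ^+ j)^-1 ^+ n))); last first.
    by move=> j _; rewrite /z rmorphM !rmorphXn /= fmorphV invfM !exprMn; ring.
  rewrite -mulr_sumr sum_prim_root // /G coef_geom3 /a; case: ifP => _.
    by rewrite !rmorphM !rmorph_nat /=; ring.
  by rewrite mulr0.
have nG : (n < size G)%N.
  rewrite ltnNge; apply/negP => Gn.
  have := coef_geom3 (R := R) M n; rewrite -/G nth_default // => /esym/eqP.
  rewrite pnatr_eq0 => /eqP g0; have := geom3_coef_ge nM; rewrite g0.
  rewrite muln0 leqn0 muln_eq0 orbb => /eqP n0; move: g0; rewrite n0.
  by rewrite /geom3_coef big_ord1 /= subn0 geom2_coefE // M0.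
have sG := size_geom3 (R := R) M0.
(* As [n < M], every other surviving index is at least [M] and so carries a factor [r^M]. The
   [9 M^2] bounds [(i + 1)^2] with [i + 1 <= 3 M]. *)
have tail i : (i < size G)%N -> i != n -> a i <= M%:R * (9 * M%:R ^+ 2) * r ^+ M * r^-1 ^+ n.
  move=> iG iN; rewrite /a; case: ifPn => [iM|_]; last first.
    by rewrite !mulr_ge0 // ?exprn_ge0 ?invr_ge0 // ltW.
  have Mi : (M <= i)%N.
    rewrite leqNgt; apply/negP => iM'; move: iM; rewrite !modn_small // => /eqP iE.
    by rewrite iE eqxx in iN.
  have i3 : (i.+1 <= 3 * M)%N by exact: leq_trans sG.
  have c9 : (geom3_coef M i)%:R <= 9 * M%:R ^+ 2 :> R.
    rewrite -natrX -natrM ler_nat (leq_trans (geom3_coef_le _ _)) //.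
    by rewrite (leq_trans (leq_mul i3 i3)) //; lia.
  rewrite ler_pM2r ?exprn_gt0 ?invr_gt0 //.
  rewrite ler_pM ?mulr_ge0 ?exprn_ge0 ?(ltW r0) //; first by rewrite ler_wpM2l.
  exact: ler_wiXn2l (ltW r0) (ltW r1) _ _ Mi.
(* Parseval sums the squared geometric sums over the nodes to at most [M / (1 - r)]; bounding each
   node separately would give [M / (1 - r)^2] and lose the result. *)
have NS : (1 - r ^+ M) ^+ 2 * N S <= M%:R * (r^-1 ^+ n.+1 * K * N f / (1 - r)).
  have ES j : E ((z j)^-1 ^+ n *: act T (P3 j) g) by apply: EZ; exact: Eact.
  apply: le_trans (ler_wpM2l (sqr_ge0 _) (N_sum _ _ ES)) _; rewrite mulr_sumr.
  apply: (@le_trans _ _ (\sum_(j < M) (r^-1 ^+ n.+1 * K * N f) *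
     nrm (\sum_(m < M) (r%:C%C * w ^+ j) ^+ m) ^+ 2)).
    apply: ler_sum => j _; rewrite NZ; last exact: Eact.
    rewrite nrmX nrmV zr mulrCA.
    have rn0 : 0 <= r^-1 ^+ n by rewrite exprn_ge0 // invr_ge0 ltW.
    have := ler_wpM2l rn0 (resolvent_cube_bound r0 r1 (zr j) (zM j) Ef).
    move=> h; apply: le_trans h _; rewrite le_eqVlt; apply/orP; left; apply/eqP.
    by rewrite [in RHS]exprSr -/K /z; ring.

  rewrite -mulr_sumr parseval_geometric // mulrCA ler_wpM2l // -mulrA ler_wpM2l //.
    by rewrite !mulr_ge0 // exprn_ge0 // invr_ge0 ltW.
  rewrite -[leRHS]mul1r ler_pdivlMr ?subr_gt0 //.
  apply: (@le_trans _ _ (1 - r ^+ M)); last by rewrite lerBlDr lerDl exprn_ge0 // ltW.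
  rewrite -[leRHS]opprB subrX1 -mulNr opprB mulrC ler_pM2l ?subr_gt0 //.
  by apply: ler_sum => m _; exact: ler_wiXn2l (ltW r0) (ltW r1) _ _ (leq_addr _ _).
have Nn : a n * N (iter n T g) <= N S +
    3 * M%:R * (M%:R * (9 * M%:R ^+ 2) * r ^+ M * r^-1 ^+ n) * (2 * N f).
  have EF (i : 'I_(size G)) : E ((a i)%:C%C *: iter i T g) by apply: EZ; exact: iter_E.
  have -> : a n * N (iter n T g) = N ((a n)%:C%C *: iter n T g).
    by rewrite NZ ?nrmC ?ger0_norm //; exact: iter_E.
  have -> : (a n)%:C%C *: iter n T g = S -
      \sum_(i < size G | i != Ordinal nG) (a i)%:C%C *: iter i T g.
    by rewrite SE (bigD1 (Ordinal nG)) //= addrK.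
  have EB : E (\sum_(i < size G | i != Ordinal nG) (a i)%:C%C *: iter i T g).
    by apply: (big_ind E) => // i _.
  have ES : E S by rewrite SE; apply: (big_ind E) => // i _.
  rewrite (le_trans (N_sub ES EB)) // lerD2l (le_trans (N_sum _ _ EF)) //.
  set b := M%:R * _ * _ * _; have b0 : 0 <= b.
    by rewrite !mulr_ge0 // ?exprn_ge0 ?invr_ge0 // ltW.
  apply: (@le_trans _ _ (\sum_(i < size G) b * (2 * N f))).
    rewrite big_mkcond /=; apply: ler_sum => i _; case: ifPn => [iN|_]; last first.
      by apply: mulr_ge0 => //; exact: mulr_ge0.
    rewrite NZ; last exact: iter_E.
    rewrite nrmC ger0_norm // ler_pM //; apply: tail => //.
  rewrite sumr_const card_ord -[leLHS]mulr_natl [leLHS]mulrA; apply: ler_wpM2r.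
    by rewrite mulr_ge0.
  by apply: ler_wpM2r => //; rewrite -natrM ler_nat.
have an : a n = M%:R * (geom3_coef M n)%:R.
  by rewrite /a eqxx -mulrA -exprMn divff ?gt_eqF // expr1n mulr1.
have dn : n%:R ^+ 2 <= 2 * (geom3_coef M n)%:R :> R.
  by rewrite -natrX -natrM ler_nat -mulnn geom3_coef_ge.
have q1 : (1 - r ^+ M) ^+ 2 <= 1.
  rewrite exprn_ile1 ?subr_ge0 ?exprn_ile1 ?(ltW r0) ?(ltW r1) //.
  by rewrite lerBlDr lerDl exprn_ge0 // ltW.
have Mp : 0 < M%:R :> R by rewrite ltr0n.
rewrite -gE -(ler_pM2l Mp); move: Nn; rewrite an.
set X := N (iter n T g); set q := (1 - r ^+ M) ^+ 2 in q1 NS *; set d := (geom3_coef M n)%:R in dn *.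
move=> Nn.
apply: (@le_trans _ _ (2 * (q * (M%:R * d * X)))).
  rewrite (_ : 2 * _ = M%:R * ((2 * d) * X * q)); last by ring.
  rewrite ler_pM2l // ler_wpM2r ?sqr_ge0 // ler_wpM2r //; exact: N0.
apply: le_trans (ler_wpM2l _ (ler_wpM2l (sqr_ge0 _) Nn)) _ => //.
rewrite mulrDr mulrDr [leRHS]mulrDr lerD //.
  by rewrite [leRHS]mulrCA ler_pM2l.
set t := 3 * _ * _ * _.
have t0 : 0 <= t.
  by rewrite !mulr_ge0 // ?exprn_ge0 ?invr_ge0 // ltW.
apply: (@le_trans _ _ (2 * t)); first by rewrite ler_pM2l // ler_piMl.
have -> : 2 * t = 108 * r^-1 ^+ n * N f * (M%:R ^+ 4 * r ^+ M) by rewrite /t; ring.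
rewrite ler_peMl ?ler1n // !mulr_ge0 // ?exprn_ge0 ?invr_ge0 // ltW //.
Qed.

Theorem ritt : exists2 C : R, 0 < C & forall n f, (0 < n)%N -> E f ->
  N (iter n T f - iter n.+1 T f) <= C / n%:R * N f.
Proof.
pose K := 8 / c ^+ 2 + 8 / c ^+ 3.
have K0 : 0 < K by rewrite addr_gt0 // divr_gt0 // exprn_gt0.
exists (4 * K * expR 2); first by rewrite !mulr_gt0 // expR_gt0.
move=> n f n0 Ef; have np : 0 < n%:R :> R by rewrite ltr0n.
(* For this radius [1 / (1 - r) = n + 1], while [r^-(n+1) = (1 + 1/n)^(n+1)] is at most [e^2]. The
   bound [O(n)] for [n^2] times the norm follows, with [n + 1 <= 2 n] accounting for the [4]. *)
pose r : R := n%:R / n.+1%:R.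
have r0 : 0 < r by rewrite divr_gt0.
have r1 : r < 1 by rewrite ltr_pdivrMr // mul1r ltr_nat.
have r1E : (1 - r)^-1 = n.+1%:R.
  have -> : 1 - r = n.+1%:R^-1; last exact: invrK.
  have nz : n.+1%:R != 0 :> R by rewrite pnatr_eq0.
  by apply: (mulIf nz); rewrite mulVf // mulrBl mul1r divfK // -natrB // subSnn.
have h : n%:R ^+ 2 * N (iter n T f - iter n.+1 T f) <=
    2 * (r^-1 ^+ n.+1 * K * N f / (1 - r)).
  apply: (@le_of_vanishing_error _ _ _ (108 * r^-1 ^+ n * N f) r n) => //.
  - rewrite r1E !mulr_ge0 // ?exprn_ge0 ?invr_ge0 // ltW //.
  - by rewrite !mulr_ge0 // ?exprn_ge0 ?invr_ge0 // ltW.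
  - by move=> M nM; exact: ritt_coef_bound.
have rn : r^-1 ^+ n.+1 <= expR 2.
  have -> : r^-1 = 1 + n%:R^-1 by rewrite /r invf_div -natr1 mulrDl divff ?gt_eqF // mul1r.
  apply: (@le_trans _ _ (expR n%:R^-1 ^+ n.+1)).
    by rewrite ler_pXn2r ?nnegrE ?expR_ge0 ?addr_ge0 // expR_ge1Dx.
  rewrite -expRM_natl ler_expR ler_pdivrMr // -natrM ler_nat; lia.
rewrite r1E in h.
have n1 : n.+1%:R <= 2 * n%:R :> R by rewrite -natrM ler_nat; lia.
rewrite -(ler_pM2l (exprn_gt0 2 np)) (le_trans h) //.
have -> : n%:R ^+ 2 * (4 * K * expR 2 / n%:R * N f) = 2 * (expR 2 * K * N f * (2 * n%:R)).
  by field; rewrite gt_eqF.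
rewrite ler_pM2l // ler_pM ?mulr_ge0 ?exprn_ge0 ?invr_ge0 ?(ltW r0) ?(ltW K0) //.
by rewrite ler_wpM2r // ler_pM2r.
Qed.

End Ritt.

(** Compactness as an induction principle. If [Q C] failed, the sets [S] with [Q (C \ S)] would form
    a proper filter containing [C], and no neighbourhood of a cluster point could satisfy [Q]. *)
Lemma compact_local (T : topologicalType) (Q : set T -> Prop) (C : set T) :
  Q set0 -> (forall A B, Q A -> Q B -> Q (A `|` B)) ->
  (forall A B, A `<=` B -> Q B -> Q A) ->
  compact C -> (forall x, C x -> exists2 O, nbhs x O & Q O) -> Q C.
Proof.
move=> Q0 QU QS Cc Cloc; apply: contrapT => nQC.
pose F : set_system T := [set S | Q (C `\` S)].
have FF : ProperFilter F.
  apply: Build_ProperFilter.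
    move=> FS; apply: nQC; move: FS; rewrite /F /= setD0 //.
  split=> [|P P' FP FP'|P P' PP' FP].
  - by rewrite /F /= setDT.
  - by rewrite /F /= setDIr; exact: QU.
  - by apply: QS FP => x [Cx nP']; split => // Px; apply: nP'; exact: PP'.
have FC : F C by rewrite /F /= setDv.
have [p [Cp clp]] := Cc F FF FC.
have [W pW QW] := Cloc p Cp.
have FW : F (~` W) by rewrite /F /= setDE setCK; apply: QS QW => x [].
by have [x [nWx Wx]] := clp _ _ FW pW.
Qed.

(** * Topological groups *)

Section TopologicalGroups.
Context {G : topologicalGroupType}.
Implicit Types (x y z : G) (A B C V : set G).

Lemma lmul_continuous x : continuous (fun y : G => (x * y)%g).
Proof.
move=> y; apply: (@continuous2_cvg _ _ _ _ _ _ (cst x) id (fun a b : G => (a * b)%g) x y).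
- exact: (@mulg_continuous G (x, y)).
- exact: cvg_cst.
- exact: cvg_id.
Qed.

Lemma rmul_continuous x : continuous (fun y : G => (y * x)%g).
Proof.
move=> y; apply: (@continuous2_cvg _ _ _ _ _ _ id (cst x) (fun a b : G => (a * b)%g) y x).
- exact: (@mulg_continuous G (y, x)).
- exact: cvg_id.
- exact: cvg_cst.
Qed.

Lemma invg_cont : continuous (fun y : G => y^-1%g).
Proof. exact: invg_continuous. Qed.

Definition mulS A B : set G := [set (x * y)%g | x in A & y in B].

Definition invS A : set G := [set x^-1%g | x in A].

Lemma lmul_imageE x A : [set (x * y)%g | y in A] = (fun y => x^-1 * y)%g @^-1` A.
Proof.
apply/seteqP; split=> [_ [y Ay <-]|y Ay] /=; first by rewrite mulKg.
by exists (x^-1 * y)%g => //; rewrite mulVKg.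
Qed.

Lemma invSE A : invS A = (fun y => y^-1)%g @^-1` A.
Proof.
apply/seteqP; split=> [_ [y Ay <-]|y Ay] /=; first by rewrite invgK.
by exists y^-1%g => //; rewrite invgK.
Qed.

Lemma open_lmul x A : open A -> open [set (x * y)%g | y in A].
Proof.
by move=> oA; rewrite lmul_imageE; apply: open_comp => // y _; exact: lmul_continuous.
Qed.

Lemma nbhs_lmul x A : nbhs (1%g : G) A -> nbhs x [set (x * y)%g | y in A].
Proof.
move=> A1; rewrite lmul_imageE.
have := @lmul_continuous x^-1%g x A; rewrite mulVg; exact.
Qed.

Lemma nbhs_lmulV x A : nbhs x A -> nbhs (1%g : G) [set y | A (x * y)%g].
Proof. by move=> Ax; have := @lmul_continuous x 1%g A; rewrite mulg1; exact. Qed.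

Lemma nbhs_inv A : nbhs (1%g : G) A -> nbhs (1%g : G) [set y | A y^-1%g].
Proof. by move=> A1; have := @invg_cont 1%g A; rewrite invg1; exact. Qed.

Lemma open_mulSl A B : open A -> open (mulS B A).
Proof.
move=> oA; have -> : mulS B A = \bigcup_(b in B) [set (b * y)%g | y in A].
  apply/seteqP; split=> [_ [b Bb [a Aa <-]]|_ [b Bb [a Aa <-]]].
    by exists b => //; exists a.
  by exists b => //; exists a.
by apply: bigcup_open => b _; exact: open_lmul.
Qed.

Lemma compact_mulS A B : compact A -> compact B -> compact (mulS A B).
Proof.
move=> cA cB; have -> : mulS A B = (fun p : G * G => (p.1 * p.2)%g) @` (A `*` B).
  apply/seteqP; split=> [_ [a Aa [b Bb <-]]|_ [[a b] [/= Aa Bb] <-]].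
    by exists (a, b).
  by exists a => //; exists b.
apply: continuous_compact; last exact: compact_setX.
by apply: continuous_subspaceT; exact: mulg_continuous.
Qed.

Lemma compact_invS A : compact A -> compact (invS A).
Proof.
move=> cA; apply: continuous_compact => //.
by apply: continuous_subspaceT; exact: invg_cont.
Qed.

Lemma compact_lmul x A : compact A -> compact [set (x * y)%g | y in A].
Proof.
move=> cA; apply: continuous_compact => //.
by apply: continuous_subspaceT; exact: lmul_continuous.
Qed.

Lemma nbhs1_square A : nbhs (1%g : G) A ->
  exists V, [/\ open V, V 1%g & mulS V V `<=` A].
Proof.
move=> A1; have := @mulg_continuous G (1%g, 1%g).
rewrite /continuous_at /= mulg1 => /(_ A A1) [[P Q] /= [P1 Q1] PQ].
move: P1 Q1; rewrite !nbhsE => -[P' [oP P1] PP'] [Q' [oQ Q1] QQ'].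
exists (P' `&` Q'); split; [exact: openI|by split|].
move=> _ [a [Pa Qa] [b [Pb Qb] <-]]; apply: (PQ (a, b)); split => /=.
  exact: PP'.
exact: QQ'.
Qed.

Lemma generated_subgroup A : is_subgroup (generated A).
Proof.
split; first by move=> H [[]].
  by move=> x y Ax Ay H HA; have [[_ HM _] _] := HA; apply: HM; [exact: Ax|exact: Ay].
by move=> x Ax H HA; have [[_ _ HV] _] := HA; apply: HV; exact: Ax.
Qed.

Lemma generated_ind A (H : set G) : generated A = setT ->
  is_subgroup H -> A `<=` H -> forall x, H x.
Proof.
move=> AT sH AH x; have : [set: G] x by [].
by rewrite -AT; apply: smallest_sub.
Qed.

Lemma closure_subgroup (H : set G) : is_subgroup H -> is_subgroup (closure H).
Proof.
move=> [H1 HM HV]; split; first exact: subset_closure.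
- move=> x y cx cy A xyA.
  have := @mulg_continuous G (x, y); rewrite /continuous_at /=.
  move=> /(_ A xyA) [[P Q] /= [Px Qy] PQ].
  have [a [Ha Pa]] := cx _ Px; have [b [Hb Qb]] := cy _ Qy.
  by exists (a * b)%g; split; [exact: HM|exact: (PQ (a, b))].
- move=> x cx A xA; have [a [Ha Aa]] := cx _ (@invg_cont x A xA).
  by exists a^-1%g; split; [exact: HV|].
Qed.

Fixpoint powS (U : set G) n : set G := if n is n.+1 then mulS (powS U n) U else [set 1%g].

Section Powers.
Variable U : set G.
Hypothesis U_nbhd : generating_nbhd U.

Let U1 : U 1%g. Proof. by case: U_nbhd. Qed.
Let oU : open U. Proof. by case: U_nbhd. Qed.

Lemma gen_inv x : U x -> U x^-1%g.
Proof. by move=> Ux; case: U_nbhd => _ _ _ <- _; exists x. Qed.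

Lemma powS_le n m : (n <= m)%N -> powS U n `<=` powS U m.
Proof.
move=> /subnK <-; elim: (m - n)%N => [//|k IH] x /IH xk.
by rewrite addSn; exists x => //; exists 1%g => //; rewrite mulg1.
Qed.

Lemma powS_mul n m x y : powS U n x -> powS U m y -> powS U (n + m) (x * y)%g.
Proof.
move=> Ux; elim: m y => [y ->|m IH y [a Ua [b Ub <-]]]; first by rewrite addn0 mulg1.
by rewrite addnS mulgA; exists (x * a)%g; [exact: IH|exists b].
Qed.

Lemma powS_inv n x : powS U n x -> powS U n x^-1%g.
Proof.
elim: n x => [x ->|n IH x [a Ua [b Ub <-]]]; first by rewrite invg1.
rewrite invgM -add1n; apply: powS_mul; last exact: IH.
by exists 1%g => //; exists b^-1%g; rewrite ?mul1g //; exact: gen_inv.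
Qed.

Lemma powS_cover x : exists n, powS U n x.
Proof.
case: U_nbhd => _ _ _ _ gU.
apply: (generated_ind (H := [set y | exists n, powS U n y]) gU).
  split; first by exists 0%N.
  - by move=> a b [n na] [m mb]; exists (n + m)%N; exact: powS_mul.
  - by move=> a [n na]; exists n; exact: powS_inv.
by move=> a Ua; exists 1%N; exists 1%g => //; exists a; rewrite ?mul1g.
Qed.

Lemma compact_sub_powS C : compact C -> exists n, C `<=` powS U n.
Proof.
move=> cC; apply: (compact_local (Q := fun A => exists n, A `<=` powS U n)) cC _.
- by exists 0%N.
- move=> A B [n An] [m Bm]; exists (maxn n m) => x [/An|/Bm].
    by apply: powS_le; exact: leq_maxl.
  by apply: powS_le; exact: leq_maxr.
- by move=> A B AB [n Bn]; exists n; exact: subset_trans Bn.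
- move=> x _; have [n xn] := powS_cover x.
  exists [set (x * y)%g | y in U].
    by apply: nbhs_lmul; exact: open_nbhs_nbhs.
  by exists n.+1 => _ [y Uy <-]; exists x => //; exists y.
Qed.

Lemma compact_closure_gen : compact (closure U).
Proof. by case: U_nbhd => _ _; rewrite precompactE. Qed.

Lemma sigma_compact : exists F : nat -> set G,
  (forall n, compact (F n)) /\ (forall x, exists n, F n x).
Proof.
exists (fun n => iter n (fun A => mulS A (closure U)) [set 1%g]); split.
  by elim=> [|n IH]; [exact: compact_set1|exact: compact_mulS compact_closure_gen].
move=> x; have [n] := powS_cover x; exists n.
elim: n x p => //= n IH x [a /IH Fa [b Ub <-]].
by exists a => //; exists b => //; exact: subset_closure.
Qed.

End Powers.
End TopologicalGroups.

(** The supremum [s] satisfies [2 s <= s + a]. The bound [b] serves only to make [s] finite and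
    disappears from the conclusion, which is how a qualitative bound becomes a uniform one. *)
Lemma sup_halving (R : realType) (I : Type) (Z : set I) (f : I -> R) (b a : R) : 0 <= a ->
  (forall x, Z x -> `|f x| <= b) ->
  (forall x, Z x -> exists2 y, Z y & 2 * `|f x| <= `|f y| + a) ->
  forall x, Z x -> `|f x| <= a.
Proof.
move=> a0 fb half x Zx.
have Zs : has_sup [set `|f x| | x in Z].
  by split; [exists `|f x|; exists x | exists b => _ [y Zy <-]; exact: fb].
have lesup y : Z y -> `|f y| <= sup [set `|f x| | x in Z].
  by move=> Zy; apply: sup_ubound; [case: Zs|exists y].
suff : sup [set `|f x| | x in Z] <= a by exact: le_trans (lesup x Zx).
set s := sup _ in lesup *.
suff : s <= (s + a) / 2 by lra.
apply: ge_sup; first by case: Zs.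
move=> _ [y Zy <-]; have [z Zz h] := half y Zy; have := lesup z Zz; lra.
Qed.

(** * Families of quasi-additive functions *)

Section QuasiAdditive.
Context {R : realType} {G : topologicalGroupType}.
Implicit Types (phi : G -> R) (d : R) (x y z : G) (A B C : set G).

(* The constant [c] depends on the compact set but not on the member of the
   family, which may range over functions on all of [L^2] or [L^p]. *)
Definition quasi_additive (Phi : (G -> R) -> R -> Prop) :=
  [/\ forall phi d, Phi phi d -> 0 <= d,
      forall phi d C, Phi phi d -> compact C ->
        exists b, forall x, C x -> `|phi x| <= b &
      forall C, compact C -> exists2 c : R, 0 <= c & forall phi d, Phi phi d ->
        forall x y, C x -> C y -> `|phi (x * y)%g - phi x - phi y| <= c * d].

Definition small (Phi : (G -> R) -> R -> Prop) A :=
  exists2 c : R, 0 <= c & forall phi d, Phi phi d -> forall x, A x -> `|phi x| <= c * d.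

Section Family.
Variable Phi : (G -> R) -> R -> Prop.
Hypothesis qaPhi : quasi_additive Phi.

Let Phi0 phi d : Phi phi d -> 0 <= d.
Proof. by case: qaPhi => + _ _; apply. Qed.

Lemma small_set0 : small Phi set0.
Proof. by exists 0. Qed.

Lemma smallS A B : A `<=` B -> small Phi B -> small Phi A.
Proof. by move=> AB [c c0 h]; exists c => // phi d /h {}h x /AB; exact: h. Qed.

Lemma smallU A B : small Phi A -> small Phi B -> small Phi (A `|` B).
Proof.
move=> [c c0 h] [c' c'0 h']; exists (c + c'); first exact: addr_ge0.
move=> phi d pd x; rewrite mulrDl => -[Ax|Bx].
  by rewrite (le_trans (h _ _ pd x Ax)) // lerDl mulr_ge0 // (Phi0 pd).
by rewrite (le_trans (h' _ _ pd x Bx)) // lerDr mulr_ge0 // (Phi0 pd).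
Qed.

Lemma small_mul K A B : compact K -> A `<=` K -> B `<=` K ->
  small Phi A -> small Phi B -> small Phi (mulS A B).
Proof.
move=> cK AK BK [a a0 hA] [b b0 hB]; have [_ _ /(_ K cK) [c c0 hc]] := qaPhi.
exists (a + b + c); first by rewrite !addr_ge0.
move=> phi d pd _ [x Ax [y By <-]].
have := hc _ _ pd x y (AK _ Ax) (BK _ By).
have := hA _ _ pd x Ax; have := hB _ _ pd y By.
rewrite !ler_norml !mulrDl; lra.
Qed.

Lemma small_one : small Phi [set 1%g].
Proof.
have [_ _ /(_ [set 1%g] (@compact_set1 _ _)) [c c0 hc]] := qaPhi.
exists c => // phi d pd _ ->; have := hc _ _ pd 1%g 1%g erefl erefl.
by rewrite mulg1 subrr sub0r normrN.
Qed.

Lemma small_inv K A : compact K -> A `<=` K -> small Phi A -> small Phi (invS A).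
Proof.
move=> cK AK [a a0 hA]; have [e e0 he] := small_one.
have [_ _ /(_ (K `|` invS K) (compactU cK (compact_invS cK))) [c c0 hc]] := qaPhi.
exists (a + e + c); first by rewrite !addr_ge0.
move=> phi d pd _ [x Ax <-].
have := hc _ _ pd x x^-1%g (or_introl (AK _ Ax)).
have Kx : (K `|` invS K) x^-1%g by right; exists x => //; exact: AK.
rewrite mulgV => /(_ Kx); have := hA _ _ pd x Ax; have := he _ _ pd 1%g erefl.
rewrite !ler_norml !mulrDl; lra.
Qed.

Lemma small_mul1 x y : small Phi [set x] -> small Phi [set y] -> small Phi [set (x * y)%g].
Proof.
move=> sx sy; have cK : compact ([set x] `|` [set y]).
  by apply: compactU; exact: compact_set1.
apply: smallS (small_mul cK _ _ sx sy); last by right.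
  by move=> _ ->; exists x => //; exists y.
by left.
Qed.

Lemma small_inv1 x : small Phi [set x] -> small Phi [set x^-1%g].
Proof.
move=> sx; apply: smallS (small_inv (@compact_set1 _ x) (@subset_refl _ _) sx).
by move=> _ ->; exists x.
Qed.

Lemma small_subgroup : is_subgroup [set x | small Phi [set x]].
Proof.
split; first exact: small_one.
  by move=> x y; exact: small_mul1.
by move=> x; exact: small_inv1.
Qed.

(** Three defects suffice: [phi (x y)] is compared with [phi x + phi y] directly, and also through
    [x y = y x [x, y]]; the sums [phi x + phi y] cancel. *)
Lemma small_commg x y : small Phi [set (commg x y)].
Proof.
pose K := [set x; y] `|` [set (y * x)%g; commg x y] : set G.
have cK : compact K by apply: finite_compact; rewrite /K !finite_setU.
have [_ _ /(_ K cK) [c c0 hc]] := qaPhi.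
exists (3 * c); first by rewrite mulr_ge0.
move=> phi d pd _ ->.
have Kx : K x by left; left.
have Ky : K y by left; right.
have Kyx : K (y * x)%g by right; left.
have Kc : K (commg x y) by right; right.
have := hc _ _ pd _ _ Kx Ky; have := hc _ _ pd _ _ Ky Kx; have := hc _ _ pd _ _ Kyx Kc.
rewrite -commgC -!mulrA !ler_norml; lra.
Qed.

Lemma small_commutator_subgroup x : commutator_subgroup x -> small Phi [set x].
Proof.
apply: (smallest_sub (X := [set x | small Phi [set x]])); first exact: small_subgroup.
by move=> _ [u _ [v _ <-]]; exact: small_commg.
Qed.

Lemma small_halving K Z : compact K -> Z `<=` K ->
  (exists2 c : R, 0 <= c & forall phi d, Phi phi d -> forall x, Z x ->
     exists2 y, Z y & 2 * `|phi x| <= `|phi y| + c * d) ->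
  small Phi Z.
Proof.
move=> cK ZK [c c0 h]; exists c => // phi d pd.
have [_ /(_ _ _ K pd cK) [b hb] _] := qaPhi.
apply: (sup_halving (b := b)); first by rewrite mulr_ge0 // (Phi0 pd).
  by move=> x /ZK; exact: hb.
exact: h pd.
Qed.

Hypothesis lc : exists2 U : set G, open U /\ U 1%g & compact (closure U).

Lemma G0_subgroup : is_subgroup (@G0 G).
Proof. by apply: closure_subgroup; exact: generated_subgroup. Qed.

Lemma G0_approx V z : nbhs (1%g : G) V -> G0 z ->
  exists2 y, commutator_subgroup y & V (y^-1 * z)%g.
Proof.
move=> V1 z0; have [y [Dy [w Vw e]]] := z0 _ (nbhs_lmul z (nbhs_inv V1)).
by exists y => //; rewrite -e invgM mulgVK.
Qed.

(** A single [y] of the commutator subgroup serves a whole neighbourhood: if [y] is close to one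
    point of [G0] near [x], then [y^-1 x'] lies in [V] for all [x'] near [x]. By compactness only
    finitely many [y], each with its own constant, are involved. *)
Lemma small_G0_local C V : compact C -> nbhs (1%g : G) V -> (exists2 K, compact K & V `<=` K) ->
  exists2 c : R, 0 <= c & forall phi d, Phi phi d -> forall x, G0 x -> C x ->
   exists2 v, G0 v /\ V v & `|phi x - phi v| <= c * d.
Proof.
move=> cC V1 [K cK VK].
pose Q (A : set G) := exists2 c : R, 0 <= c & forall phi d, Phi phi d -> forall x, G0 x -> A x ->
   exists2 v, G0 v /\ V v & `|phi x - phi v| <= c * d.
apply: (compact_local (Q := Q)) cC _.
- by exists 0.
- move=> A B [a a0 hA] [b b0 hB]; exists (a + b); first exact: addr_ge0.
  move=> phi d pd x x0 [Ax|Bx]; rewrite mulrDl.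
    have [v Vv h] := hA _ _ pd x x0 Ax; exists v => //.
    by rewrite (le_trans h) // lerDl mulr_ge0 // (Phi0 pd).
  have [v Vv h] := hB _ _ pd x x0 Bx; exists v => //.
  by rewrite (le_trans h) // lerDr mulr_ge0 // (Phi0 pd).
- by move=> A B AB [b b0 hB]; exists b => // phi d pd x x0 /AB; exact: hB.
- move=> x _.
  have [W [oW W1 WV]] := nbhs1_square V1.
  (* A neighbourhood that misses [G0] imposes no condition. Otherwise it is replaced by one centred
     at a point [z] of [G0], which the commutator subgroup approximates. *)
  have [xG0|nxG0] := pselect (exists2 z, G0 z & [set (x * w)%g | w in W `&` [set w | W w^-1%g]] z); last first.
    exists [set (x * w)%g | w in W `&` [set w | W w^-1%g]].
      by apply: nbhs_lmul; apply: filterI; [|apply: nbhs_inv]; exact: open_nbhs_nbhs.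
    exists 0 => // phi d pd y y0 Ay; exfalso; apply: nxG0; by exists y.
  case: xG0 => z z0 [w [Ww Wwi] e].
  have W'1 : nbhs (1%g : G) W by exact: open_nbhs_nbhs.
  have zW : nbhs x [set (z * w)%g | w in W].
    rewrite lmul_imageE -e; have := @lmul_continuous G (x * w)^-1%g x W.
    by rewrite invgM mulgVK; apply; apply: open_nbhs_nbhs.
  have [y Dy Vy] := G0_approx W'1 z0.
  exists [set (z * w)%g | w in W] => //.
  have [e1 e10 he1] := small_commutator_subgroup Dy.
  have cK' : compact (K `|` [set y]) by apply: compactU => //; exact: compact_set1.
  have [_ _ /(_ _ cK') [c c0 hc]] := qaPhi.
  exists (e1 + c); first exact: addr_ge0.
  move=> phi d pd x' x'0 [w' Ww' e'].
  pose v := (y^-1 * x')%g.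
  have Vv : V v.
    by apply: WV; exists (y^-1 * z)%g => //; exists w' => //; rewrite /v -e' mulgA.
  have [_ GM GV] := G0_subgroup.
  exists v.
    split => //; apply: GM => //; apply: GV; exact: subset_closure.
  have := hc _ _ pd y v (or_intror erefl) (or_introl (VK _ Vv)).
  rewrite /v mulVKg -/v; have := he1 _ _ pd y erefl.
  by rewrite !ler_norml mulrDl; lra.
Qed.

(** On [closure U] a point [x] of [G0] is first exchanged for [v] in [V]; then [2 phi v] is close to
    [phi (v v)], and [v v] is again in [G0] and in [closure U] because [V V] lies in [U]. Halving
    applies, and [small_G0_local] carries the bound to any [C]. *)
Lemma small_G0_compact C : compact C -> small Phi (@G0 G `&` C).
Proof.
move=> cC; have [U [oU U1] cU] := lc.
have [V [oV V1 VVU]] := nbhs1_square (open_nbhs_nbhs (conj oU U1)).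
have VU : V `<=` closure U.
  move=> v Vv; apply: subset_closure; apply: VVU; exists v => //; exists 1%g => //.
  by rewrite mulg1.
have nV : nbhs (1%g : G) V by exact: open_nbhs_nbhs.
have loc K cK := @small_G0_local K V cK nV (ex_intro2 _ _ _ cU VU).
have [_ GM _] := G0_subgroup.
have sU : small Phi (@G0 G `&` closure U).
  apply: (small_halving cU); first by move=> x [].
  have [a a0 ha] := loc _ cU; have [_ _ /(_ _ cU) [c c0 hc]] := qaPhi.
  exists (2 * a + c); first by rewrite addr_ge0 // mulr_ge0.
  move=> phi d pd x [x0 Ux]; have [v [v0 Vv] h] := ha _ _ pd x x0 Ux.
  exists (v * v)%g.
    by split; [exact: GM|apply: subset_closure; apply: VVU; exists v => //; exists v].
  move: h (hc _ _ pd v v (VU _ Vv) (VU _ Vv)).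
  rewrite !ler_norml => /andP[h1 h2] /andP[h3 h4].
  have := ler_norm (phi (v * v)%g); have := ler_norm (- phi (v * v)%g).
  by rewrite normrN => h5 h6; case: (ger0P (phi x)) => _; lra.
have [a a0 ha] := loc _ cC; have [b b0 hb] := sU.
exists (a + b); first exact: addr_ge0.
move=> phi d pd x [x0 Cx]; have [v [v0 Vv] h] := ha _ _ pd x x0 Cx.
have := hb _ _ pd v (conj v0 (VU _ Vv)); move: h.
by rewrite !ler_norml mulrDl; lra.
Qed.

End Family.
End QuasiAdditive.

Lemma open_mulSr (G : topologicalGroupType) (A B : set G) : open A -> open (mulS A B).
Proof.
move=> oA; have -> : mulS A B = \bigcup_(b in B) ((fun x => x * b^-1)%g @^-1` A).
  apply/seteqP; split=> [_ [a Aa [b Bb <-]]|x [b Bb Aa]].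
    by exists b; rewrite //= mulgK.
  by exists (x * b^-1)%g => //; exists b; rewrite ?mulgVK.
by apply: bigcup_open => b _; apply: open_comp => // y _; exact: rmul_continuous.
Qed.

Lemma pair_mulrz (U V W : zmodType) (u : U) (v : V) (w : W) (n : int) :
  (u, v, w) *~ n = (u *~ n, v *~ n, w *~ n).
Proof.
have pM k : (u, v, w) *+ k = (u *+ k, v *+ k, w *+ k).
  by elim: k => [//|k IH]; rewrite !mulrS IH.
by case: n => k; [exact: pM|rewrite NegzE !mulrNz -!pmulrn pM].
Qed.

(** * Coordinates on the abelianization *)

Section Coordinates.
Local Open Scope quotient_scope.
Context {R : realType} {G : topologicalGroupType} (D : splitting R G).
Implicit Types (x y z g h : G) (A B C : set G).

Local Notation T := ('rV[R]_(split_q D) * 'rV[int]_(split_r D) * split_M D)%type.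

Definition coord g : 'rV[R]_(split_q D) * 'rV[int]_(split_r D) * split_M D :=
  split_iso D (pi0 g).

Definition rcoord (i : 'I_(split_q D)) g : R := (pi1 D g).1 0 i.

Definition zcoord (j : 'I_(split_r D)) g : int := (pi1 D g).2 0 j.

Lemma coordM g h : coord (g * h)%g = coord g + coord h.
Proof. exact: split_morph. Qed.

Lemma coord1 : coord 1%g = 0.
Proof. by apply: (addrI (coord 1%g)); rewrite -coordM mulg1 addr0. Qed.

Lemma coordV g : coord g^-1%g = - coord g.
Proof. by apply: (addrI (coord g)); rewrite -coordM mulgV coord1 subrr. Qed.

Lemma coord_surj v : exists g, coord g = v.
Proof.
have [g e] : exists g, pi0 g = @split_inv R G D v.
  by exists (repr (@split_inv R G D v)); rewrite /pi0 reprK.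
by exists g; rewrite /coord e split_invK.
Qed.

Lemma pi0_eq g h : pi0 g = pi0 h -> G0 (g^-1 * h)%g.
Proof.
move=> /eqmodP /asboolP e; have G1 : @G0 G 1%g by case: (@G0_subgroup G).
have : coset_G0 h h by exists 1%g; rewrite ?mulg1.
by rewrite -e => -[z z0 <-]; rewrite mulKg.
Qed.

Lemma pi0_G0 g z : G0 z -> pi0 (g * z)%g = pi0 g.
Proof.
have [G1 GM GV] := @G0_subgroup G.
move=> z0; apply/eqmodP/asboolP; apply/seteqP; split=> _ [w w0 <-].
  by exists (z * w)%g; rewrite ?mulgA //; exact: GM.
exists (z^-1 * w)%g; first by apply: GM => //; exact: GV.
by rewrite -mulgA mulVKg.
Qed.

Lemma coord_eq g h : coord g = coord h -> G0 (g^-1 * h)%g.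
Proof. by move=> /(can_inj (@split_isoK R G D)); exact: pi0_eq. Qed.

Lemma rcoordM i g h : rcoord i (g * h)%g = rcoord i g + rcoord i h.
Proof. by rewrite /rcoord /pi1 -!/(coord _) coordM mxE. Qed.

Lemma zcoordM j g h : zcoord j (g * h)%g = zcoord j g + zcoord j h.
Proof. by rewrite /zcoord /pi1 -!/(coord _) coordM mxE. Qed.

Lemma pi0_continuous : continuous (@pi0 G).
Proof. exact: pi_continuous. Qed.

Lemma coord_continuous : continuous coord.
Proof.
move=> x; apply: continuous_comp; first exact: pi0_continuous.
exact: split_iso_continuous.
Qed.

Lemma mx_coord_continuous (S : topologicalType) m n (i : 'I_m) (j : 'I_n) :
  continuous (fun A : 'M[S]_(m, n) => A i j).
Proof.
move=> A B nB; exists (fun k l => if (k == i) && (l == j) then B else setT).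
  move=> k l; case: ifP => [/andP[/eqP -> /eqP ->] //|_]; exact: filterT.
by move=> A' /(_ i j); rewrite !eqxx.
Qed.

Lemma rcoord_continuous i : continuous (rcoord i).
Proof.
move=> x; apply: (@continuous_comp _ _ _ coord (fun v : T => v.1.1 0 i)).
  exact: coord_continuous.
apply: (@continuous_comp _ _ _ (fun v : T => v.1.1) (fun v : 'rV[R]_(split_q D) => v 0 i)).
  by apply: (@continuous_comp _ _ _ (fun v : T => v.1) fst); exact: cvg_fst.
exact: mx_coord_continuous.
Qed.

Lemma zcoord_continuous j : continuous (zcoord j).
Proof.
move=> x; apply: (@continuous_comp _ _ _ coord (fun v : T => v.1.2 0 j)).
  exact: coord_continuous.
apply: (@continuous_comp _ _ _ (fun v : T => v.1.2) (fun v : 'rV[int]_(split_r D) => v 0 j)).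
  apply: (@continuous_comp _ _ _ (fun v : T => v.1) snd); [exact: cvg_fst|exact: cvg_snd].
exact: mx_coord_continuous.
Qed.

Lemma zcoord_near j x : \forall y \near x, zcoord j y = zcoord j x.
Proof. exact: (@zcoord_continuous j x [set zcoord j x]). Qed.

Definition lin (a : 'I_(split_q D) -> R) (b : 'I_(split_r D) -> R) g : R :=
  \sum_i a i * rcoord i g + \sum_j b j * (zcoord j g)%:~R.

Lemma linM a b g h : lin a b (g * h)%g = lin a b g + lin a b h.
Proof.
rewrite /lin addrACA -!big_split /=; congr (_ + _); apply: eq_bigr => i _.
  by rewrite rcoordM mulrDr.
by rewrite zcoordM intrD mulrDr.
Qed.

Lemma pi0_open A : open A -> open ((@pi0 G) @` A).
Proof.
move=> oA; rewrite /open /= /quotient_open.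
have -> : \pi_{eq_quot (@eq_coset_G0 G)} @^-1` ((@pi0 G) @` A) = mulS A (@G0 G).
  apply/seteqP; split=> [h [g Ag e]|_ [g Ag [z z0 <-]]] /=.
    by exists g => //; exists (g^-1 * h)%g; [exact: pi0_eq|rewrite mulVKg].
  by exists g => //; exact/esym/pi0_G0.
exact: open_mulSr.
Qed.

Lemma zcoordR_continuous j : continuous (fun g => (zcoord j g)%:~R : R).
Proof.
move=> x A Ax; have := zcoord_near j x; apply: filterS => y e /=.
by rewrite /= e; exact: nbhs_singleton.
Qed.

Lemma lin_continuous a b : continuous (lin a b).
Proof.
have addc : continuous (fun v : R * R => v.1 + v.2) by move=> v; apply: cvgD; [exact: cvg_fst|exact: cvg_snd].
move=> x; apply: cvgD; (apply: cvg_big; first exact: addc) => i _.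
  by apply: cvgM; [exact: cvg_cst|exact: rcoord_continuous].
by apply: cvgM; [exact: cvg_cst|exact: zcoordR_continuous].
Qed.

Lemma continuous_bounded (f : G -> R) C : continuous f -> compact C ->
  exists b, forall x, C x -> `|f x| <= b.
Proof.
move=> fc cC; apply: (compact_local (Q := fun A => exists b, forall x, A x -> `|f x| <= b)) cC _.
- by exists 0.
- move=> A B [a ha] [b hb]; exists (Num.max a b) => x [/ha|/hb] h.
    by rewrite le_max h.
  by rewrite le_max h orbT.
- by move=> A B AB [b hb]; exists b => x /AB; exact: hb.
- move=> x _; exists [set y | `|f x - f y| < 1].
    by have /cvgrPdist_lt := fc x; apply.
  exists (`|f x| + 1) => y /= xy; rewrite (_ : f y = f x - (f x - f y)); last by ring.
  by rewrite (le_trans (ler_normB _ _)) // lerD2l ltW.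
Qed.

(** The lattice Z^q x Z^r x {0}. Together with the fundamental domain [0,1]^q x {0} x M, called
    [box], it fills R^q x Z^r x M; the compact factor M is put into the box, so that it is treated
    by halving. *)
Definition integral_coord g :=
  (forall i, exists n : int, rcoord i g = n%:~R) /\ (coord g).2 = 0.

Definition box g := (forall i, 0 <= rcoord i g <= 1) /\ (forall j, zcoord j g = 0).

Section Compactness.
Hypothesis lc : exists2 U : set G, open U /\ U 1%g & compact (closure U).

(** The box is compact in the quotient by [G0], but its preimage need not be compact. Since [pi0] is
    open, finitely many translates of [closure U] contain representatives of all its points. *)
Lemma box_section : exists2 Q : set G, compact Q &
  forall g, box g -> exists2 y, Q y & coord y = coord g.
Proof.
have [U [oU U1] cU] := lc.
pose B : set T := [set v : 'rV[R]_(split_q D) | forall i, `[0, 1]%classic (v 0 i)] `*` [set 0] `*` setT.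
have cB : compact B.
  apply: compact_setX; last exact: split_M_compact.
  apply: compact_setX; last exact: compact_set1.
  apply: (@rV_compact R (split_q D) (fun=> `[0%R, 1%R]%classic)) => i.
  exact: segment_compact.
have cB' : compact (@split_inv R G D @` B).
  by apply: continuous_compact => //; apply: continuous_subspaceT; exact: split_inv_continuous.
pose P (A : set (abelianization G)) := exists2 Q : set G, compact Q &
  forall g, A (pi0 g) -> exists2 y, Q y & pi0 y = pi0 g.
have [Q cQ hQ] : P (@split_inv R G D @` B).
  apply: (compact_local (Q := P)) cB' _.
  - by exists set0 => //; exact: compact0.
  - move=> A A' [Q cQ hQ] [Q' cQ' hQ']; exists (Q `|` Q'); first exact: compactU.
    move=> g [/hQ|/hQ'] [y Qy e]; exists y => //; [by left|by right].
  - by move=> A A' AA' [Q cQ hQ]; exists Q => // g /AA'; exact: hQ.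
  - move=> t _; have -> : t = pi0 (repr t) by rewrite /pi0 reprK.
    exists ((@pi0 G) @` [set (repr t * u)%g | u in U]).
      apply: open_nbhs_nbhs; split; first by apply: pi0_open; exact: open_lmul.
      by exists (repr t) => //; exists 1%g; rewrite ?mulg1.
    exists [set (repr t * u)%g | u in closure U]; first exact: compact_lmul.
    move=> g [_ [u Uu <-] e]; exists (repr t * u)%g => //; exists u => //.
    exact: subset_closure.
exists Q => // g [bg zg]; have [|y Qy e] := hQ g; last by exists y; rewrite // /coord e.
exists (coord g); last by rewrite /coord split_isoK.
split=> //; split=> /=.
  by move=> i; have := bg i; rewrite /rcoord /pi1 -/(coord g) in_itv.
by apply/rowP => j; rewrite mxE; exact: zg.
Qed.

Lemma box_integral_decomposition : exists2 Q : set G, compact Q &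
  forall g, exists2 y, Q y /\ box y & integral_coord (y^-1 * g)%g.
Proof.
have [Q cQ hQ] := box_section; exists Q => // g.
have [k kE] := coord_surj (\row_i (Num.floor (rcoord i g))%:~R, (coord g).1.2, 0).
have kr i : rcoord i k = (Num.floor (rcoord i g))%:~R.
  by rewrite {1}/rcoord /pi1 -/(coord k) kE /= mxE.
have kz j : zcoord j k = zcoord j g by rewrite /zcoord /pi1 -!/(coord _) kE.
have rV i x : rcoord i x^-1%g = - rcoord i x.
  by rewrite /rcoord /pi1 -!/(coord _) coordV mxE.
have zV j x : zcoord j x^-1%g = - zcoord j x.
  by rewrite /zcoord /pi1 -!/(coord _) coordV mxE.
have bx : box (g * k^-1)%g.
  split=> [i|j]; last by rewrite zcoordM zV kz subrr.
  rewrite rcoordM rV kr; have := floor_le (rcoord i g); have := floorD1_gt (rcoord i g).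
  by rewrite intrD => h1 h2; apply/andP; split; lra.
have [y Qy e] := hQ _ bx; exists y.
  split=> //; case: bx => b1 b2; split=> [i|j].
    by have := b1 i; rewrite /rcoord /pi1 -!/(coord _) e.
  by have := b2 j; rewrite /zcoord /pi1 -!/(coord _) e.
have e2 : coord (y^-1 * g)%g = coord k.
  by rewrite coordM coordV e coordM coordV opprD opprK addrAC addNr add0r.
split=> [i|]; last by rewrite e2 kE.
by exists (Num.floor (rcoord i g)); rewrite -kr /rcoord /pi1 -!/(coord _) e2.
Qed.

End Compactness.

Section Family.
Variable Phi : (G -> R) -> R -> Prop.
Hypothesis qaPhi : quasi_additive Phi.
Variables (e : 'I_(split_q D) -> G) (f : 'I_(split_r D) -> G).
Hypothesis eE : forall i, coord (e i) = (delta_mx 0 i, 0, 0).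
Hypothesis fE : forall j, coord (f j) = (0, delta_mx 0 j, 0).

(** The coefficients are the values of [phi] at lifts of the basis vectors, so the corrected
    function vanishes exactly at these lifts, while the additive correction leaves every defect
    unchanged. *)
Definition corrected (psi : G -> R) d := exists2 phi, Phi phi d &
  psi = fun g => phi g - lin (phi \o e) (phi \o f) g.

Lemma quasi_additive_corrected : quasi_additive corrected.
Proof.
have [H1 H2 H3] := qaPhi; split.
- by move=> psi d [phi /H1].
- move=> psi d C [phi pd ->] cC; have [b hb] := H2 _ _ C pd cC.
  have [b' hb'] := continuous_bounded (@lin_continuous (phi \o e) (phi \o f)) cC.
  exists (b + b') => x Cx; rewrite (le_trans (ler_normB _ _)) // lerD //.
    exact: hb.
  exact: hb'.
- move=> C cC; have [c c0 hc] := H3 C cC; exists c => // psi d [phi pd ->] x y Cx Cy.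
  rewrite linM; have := hc _ _ pd x y Cx Cy.
  set u := lin _ _ x; set v := lin _ _ y.
  by rewrite (_ : phi (x * y)%g - (u + v) - _ - _ = phi (x * y)%g - phi x - phi y) //; ring.
Qed.

Let qaP := quasi_additive_corrected.

Lemma lin_e a b i : lin a b (e i) = a i.
Proof.
rewrite /lin (bigD1 i) //= big1 ?addr0 => [|k ki].
  rewrite big1 ?addr0 => [|j _]; last first.
    by rewrite /zcoord /pi1 -/(coord _) eE /= mxE mulr0.
  by rewrite /rcoord /pi1 -/(coord _) eE /= mxE !eqxx mulr1.
by rewrite /rcoord /pi1 -/(coord _) eE /= mxE (negbTE ki) andbF mulr0.
Qed.

Lemma lin_f a b j : lin a b (f j) = b j.
Proof.
rewrite /lin big1 ?add0r => [|i _]; last first.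
  by rewrite /rcoord /pi1 -/(coord _) fE /= mxE mulr0.
rewrite (bigD1 j) //= big1 ?addr0 => [|k kj].
  by rewrite /zcoord /pi1 -/(coord _) fE /= mxE !eqxx mulr1.
by rewrite /zcoord /pi1 -/(coord _) fE /= mxE (negbTE kj) andbF mulr0.
Qed.

Lemma small_e i : small corrected [set e i].
Proof.
by exists 0 => // psi d [phi pd ->] _ ->; rewrite lin_e /= subrr normr0 mul0r.
Qed.

Lemma small_f j : small corrected [set f j].
Proof.
by exists 0 => // psi d [phi pd ->] _ ->; rewrite lin_f /= subrr normr0 mul0r.
Qed.

Hypothesis lc : exists2 U : set G, open U /\ U 1%g & compact (closure U).

(** Points with equal coordinates differ by an element of [G0], where smallness is already known.
    Smallness at a point thus becomes a property of a vector, which can be checked on generators of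
    the lattice. *)
Lemma small_pi0 x y : small corrected [set x] -> coord x = coord y -> small corrected [set y].
Proof.
move=> sx /coord_eq z0; rewrite -(mulVKg x y); apply: small_mul1 => //.
apply: smallS (small_G0_compact qaP lc (@compact_set1 _ (x^-1 * y)%g)) => _ ->.
by split.
Qed.

Definition small_vec (v : 'rV[R]_(split_q D) * 'rV[int]_(split_r D) * split_M D) :=
  forall g, coord g = v -> small corrected [set g].

Lemma small_vec_coord g : small corrected [set g] -> small_vec (coord g).
Proof. by move=> sg h /esym; exact: small_pi0. Qed.

Lemma small_vec0 : small_vec 0.
Proof. by rewrite -coord1; apply: small_vec_coord; exact: small_one. Qed.

Lemma small_vecD v w : small_vec v -> small_vec w -> small_vec (v + w).
Proof.
have [g <-] := coord_surj v; have [h <-] := coord_surj w => sv sw.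
by rewrite -coordM; apply: small_vec_coord; apply: small_mul1 => //; [exact: sv|exact: sw].
Qed.

Lemma small_vecN v : small_vec v -> small_vec (- v).
Proof.
have [g <-] := coord_surj v => sv.
by rewrite -coordV; apply: small_vec_coord; apply: small_inv1 => //; exact: sv.
Qed.

Lemma small_vecMz v (n : int) : small_vec v -> small_vec (v *~ n).
Proof.
move=> sv; have sn k : small_vec (v *+ k).
  by elim: k => [|k IH]; [exact: small_vec0|rewrite mulrS; exact: small_vecD].
case: n => k; first exact: sn.
by rewrite NegzE mulrNz; apply: small_vecN; exact: sn.
Qed.

Lemma small_integral g : integral_coord g -> small corrected [set g].
Proof.
move=> [gi gM]; suff : small_vec (coord g) by exact.
case E : (coord g) => [[x y] m]; move: gM; rewrite E /= => ->.
have -> : (x, y, 0) = (x, 0, 0) + (0, y, 0) :> T.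
  by congr (_, _, _); rewrite ?addr0 ?add0r.
apply: small_vecD.
  have sD u v : small_vec (u, 0, 0) -> small_vec (v, 0, 0) -> small_vec (u + v, 0, 0).
    move=> su sv; have -> : (u + v, 0, 0) = (u, 0, 0) + (v, 0, 0) :> T.
      by congr (_, _, _); rewrite addr0.
    exact: small_vecD.
  rewrite (row_sum_delta x); apply: (big_ind (fun u => small_vec (u, 0, 0))) => //.
    exact: small_vec0.
  move=> i _; have [n nE] := gi i.
  have -> : x 0 i = n%:~R by rewrite -nE /rcoord /pi1 -/(coord g) E.
  rewrite scaler_int; have -> : (delta_mx 0 i *~ n, 0, 0) = coord (e i) *~ n.
    by rewrite eE pair_mulrz !mul0rz.
  by apply: small_vecMz; apply: small_vec_coord; exact: small_e.
have sD u v : small_vec (0, u, 0) -> small_vec (0, v, 0) -> small_vec (0, u + v, 0).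
  move=> su sv; have -> : (0, u + v, 0) = (0, u, 0) + (0, v, 0) :> T.
    by congr (_, _, _); rewrite addr0.
  exact: small_vecD.
rewrite (row_sum_delta y); apply: (big_ind (fun u => small_vec (0, u, 0))) => //.
  exact: small_vec0.
move=> j _; set n := y 0 j; rewrite -[n]intz scaler_int.
have -> : (0, delta_mx 0 j *~ n, 0) = coord (f j) *~ n.
  by rewrite fE pair_mulrz !mul0rz.
by apply: small_vecMz; apply: small_vec_coord; exact: small_f.
Qed.

(** Smallness at single lattice elements, each with its own constant, becomes uniform: lattice
    elements close to a given point all lie in one coset [k G0], so one [k] and a compact piece of
    [G0] account for them. *)
Lemma small_integral_compact C : compact C -> small corrected (integral_coord `&` C).
Proof.
move=> cC; pose Q (A : set G) := small corrected (integral_coord `&` C `&` A).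
suff : Q C by rewrite /Q -setIA setIid.
apply: (compact_local (Q := Q) _ _ _ cC); rewrite /Q.
- by rewrite setI0; exact: small_set0.
- by move=> A B sA sB; rewrite setIUr; exact: smallU.
- by move=> A B AB; apply: smallS; exact: setIS.
(* The radius [1/2] forces the integral real coordinates of two lattice elements in [N] to differ by
   less than [1], hence to agree. *)
move=> x _; pose N := [set y : G | (forall i, `|rcoord i x - rcoord i y| < 2^-1) /\
   (forall j, zcoord j y = zcoord j x)].
exists N.
  apply: filterI; apply: filter_forall => i; last exact: zcoord_near.
  by have /cvgrPdist_lt := @rcoord_continuous i x; apply; rewrite invr_gt0 ltr0n.
have [[k [[[kr km] Ck] [Nr Nz]]]|nk] := pselect (exists k, (integral_coord `&` C `&` N) k); last first.
  by apply: smallS (small_set0 _) => y Sy; apply: nk; exists y.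
pose K := [set k] `|` [set (k^-1 * y)%g | y in C].
have cK : compact K.
  by apply: compactU; [exact: compact_set1|exact: compact_lmul].
have sk : small corrected [set k] by apply: small_integral.
have sG := small_G0_compact qaP lc cK.
apply: smallS (small_mul qaP cK _ _ sk sG) => [y [[[yr ym] Cy] [Nyr Nyz]]|_ ->|z [] //]; last by left.
exists k => //; exists (k^-1 * y)%g; last by rewrite mulVKg.
split; last by right; exists y.
apply: coord_eq; case Ek : (coord k) km => [[kx ky] kM] /= ->.
case Ey : (coord y) ym => [[yx yy] yM] /= ->; congr (_, _, _); apply/rowP => i.
  have eqk : kx 0 i = rcoord i k by rewrite /rcoord /pi1 -/(coord k) Ek.
  have eqy : yx 0 i = rcoord i y by rewrite /rcoord /pi1 -/(coord y) Ey.
  rewrite eqk eqy; have := Nr i; have := Nyr i.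
  have [n ->] := kr i; have [m ->] := yr i.
  rewrite !ltr_norml => h1 h2; have : `|(n - m)%:~R| < 1 :> R.
    by rewrite intrD mulrNz ltr_norml; move: h1 h2; lra.
  by rewrite -intr_norm -[1]/(1%:~R) ltr_int => h; congr (_%:~R); lia.
have -> : ky 0 i = zcoord i k by rewrite /zcoord /pi1 -/(coord k) Ek.
have -> : yy 0 i = zcoord i y by rewrite /zcoord /pi1 -/(coord y) Ey.
by rewrite Nz Nyz.
Qed.

(** Halving on representatives of the box: [x x = y k] with [y] again a representative and [k] a
    lattice element from a fixed compact set, so [2 psi x] equals [psi y] up to small terms. *)
Lemma small_corrected_compact C : compact C -> small corrected C.
Proof.
move=> cC; have [Q cQ hQ] := box_integral_decomposition lc.
have cI A : compact A -> compact (mulS (invS Q) A).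
  by move=> cA; apply: compact_mulS => //; exact: compact_invS.
have sQ : small corrected (Q `&` box).
  apply: (small_halving qaP cQ); first by move=> x [].
  pose K := mulS (invS Q) (mulS Q Q) `|` Q.
  have cK : compact K by apply: compactU => //; apply: cI; exact: compact_mulS.
  have [a a0 ha] := small_integral_compact cK.
  have [_ _ /(_ _ cK) [c c0 hc]] := qaP.
  exists (a + 2 * c); first by rewrite addr_ge0 // mulr_ge0.
  move=> psi d pd x [Qx bx]; have [y [Qy by_] ik] := hQ (x * x)%g.
  exists y => //; pose k := (y^-1 * (x * x))%g.
  have Kk : K k by left; exists y^-1%g; [exists y|exists (x * x)%g => //; exists x => //; exists x].
  have := hc _ _ pd x x (or_intror Qx) (or_intror Qx).
  have := hc _ _ pd y k (or_intror Qy) Kk; rewrite /k mulVKg -/k.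
  have := ha _ _ pd k (conj ik Kk).
  rewrite !ler_norml => /andP[h1 h2] /andP[h3 h4] /andP[h5 h6].
  have := ler_norm (psi y); have := ler_norm (- psi y).
  by rewrite normrN => h7 h8; case: (ger0P (psi x)) => _; lra.
pose K := mulS (invS Q) C `|` Q.
have cK : compact K by apply: compactU => //; exact: cI.
have sI := small_integral_compact cK.
apply: smallS (small_mul qaP cK _ _ sQ sI) => [x Cx|x [Qx _]|x [] //]; last by right.
have [y [Qy by_] ik] := hQ x; exists y => //; exists (y^-1 * x)%g; last by rewrite mulVKg.
by split=> //; left; exists y^-1%g; [exists y|exists x].
Qed.

End Family.

Theorem quasi_additive_near_lin (Phi : (G -> R) -> R -> Prop) C :
  (exists2 U : set G, open U /\ U 1%g & compact (closure U)) ->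
  quasi_additive Phi -> compact C ->
  exists2 c : R, 0 <= c & forall phi d, Phi phi d ->
    exists a b, forall g, C g -> `|phi g - lin a b g| <= c * d.
Proof.
move=> lc qaPhi cC.
have [e eE] := choice (fun i => coord_surj (delta_mx 0 i, 0, 0)).
have [f fE] := choice (fun j => coord_surj (0, delta_mx 0 j, 0)).
have [c c0 hc] := small_corrected_compact qaPhi eE fE lc cC.
exists c => // phi d pd; exists (phi \o e), (phi \o f) => g Cg.
by apply: (hc (fun g => phi g - lin (phi \o e) (phi \o f) g) d _ g Cg); exists phi.
Qed.

End Coordinates.

(** * Borel sets and Haar measure *)

Section BorelMeasurability.
Context {R : realType} {G : topologicalGroupType}.

Lemma open_borel (A : set G) : open A -> measurable (A : set (borel G)).
Proof. by move=> oA; exact: sub_sigma_algebra. Qed.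

Lemma closed_borel (A : set G) : closed A -> measurable (A : set (borel G)).
Proof.
by move=> cA; rewrite -(setCK A); apply: measurableC; apply: open_borel; exact: closed_openC.
Qed.

Lemma compact_borel (A : set G) : hausdorff_space G -> compact A -> measurable (A : set (borel G)).
Proof. by move=> hG cA; apply: closed_borel; exact: compact_closed. Qed.

Lemma continuous_borel (f : G -> G) : continuous f ->
  measurable_fun [set: borel G] (f : borel G -> borel G).
Proof.
move=> fc; apply: (@measurability _ _ (borel G) (borel G) setT f (@open G) erefl).
move=> _ [A oA <-].
rewrite setTI; apply: open_borel; move/continuousP: fc; exact.
Qed.

Lemma continuous_borelR (f : G -> R) : continuous f ->
  measurable_fun [set: borel G] (f : borel G -> R).
Proof.
move=> fc; apply: (measurability _ (RGenOpens.measurableE R)).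
move=> _ [_ [a [b ->] <-]]; rewrite setTI; apply: open_borel.
by move/continuousP: fc; apply; exact: interval_open.
Qed.

Lemma borel_lmul (x : G) : measurable_fun [set: borel G] (fun y => (x * y)%g : borel G).
Proof. by apply: continuous_borel; exact: lmul_continuous. Qed.

Lemma borel_inv : measurable_fun [set: borel G] (fun y => (y^-1)%g : borel G).
Proof. by apply: continuous_borel; exact: invg_cont. Qed.

Lemma measurable_lmul (x : G) (A : set G) : measurable (A : set (borel G)) ->
  measurable ([set (x * y)%g | y in A] : set (borel G)).
Proof. by move=> mA; rewrite lmul_imageE -[X in measurable X]setTI; exact: borel_lmul. Qed.

Lemma measurable_invS (A : set G) : measurable (A : set (borel G)) ->
  measurable (invS A : set (borel G)).
Proof. by move=> mA; rewrite invSE -[X in measurable X]setTI; exact: borel_inv. Qed.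

End BorelMeasurability.

(** * Tonelli and Fubini for sigma-finite measures *)

Section Tonelli.
Local Open Scope ereal_scope.

(** Turns the proposition that [m] is sigma-finite into the structure expected by the Fubini
    theorems. *)
Lemma sigma_finite_measureE d (T : measurableType d) (R : realType)
  (m : {measure set T -> \bar R}) : sigma_finite setT m ->
  exists n : {sigma_finite_measure set T -> \bar R}, m = n.
Proof.
move=> s.
pose H1 := isSFinite.Build _ _ _ _ (sfinite_measure_sigma_finite s).
pose H2 := isSigmaFinite.Build _ _ _ _ s.
exists (HB.pack_for (SigmaFiniteMeasure.type T R) (Measure.sort m) H1 H2).
exact: eq_measure.
Qed.

Lemma tonelli d1 d2 (T1 : measurableType d1) (T2 : measurableType d2) (R : realType)
  (m1 : {measure set T1 -> \bar R}) (m2 : {measure set T2 -> \bar R})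
  (f : T1 * T2 -> \bar R) :
  sigma_finite setT m1 -> sigma_finite setT m2 ->
  measurable_fun [set: T1 * T2] f -> (forall x, 0 <= f x) ->
  \int[m1]_x \int[m2]_y f (x, y) = \int[m2]_y \int[m1]_x f (x, y).
Proof.
move=> s1 s2 mf f0.
have [n1 ->] := sigma_finite_measureE s1.
have [n2 ->] := sigma_finite_measureE s2.
exact: (@fubini_tonelli _ _ _ _ _ n1 n2 f mf f0).
Qed.

Lemma measurable_tonelli1 d1 d2 (T1 : measurableType d1) (T2 : measurableType d2) (R : realType)
  (m2 : {measure set T2 -> \bar R}) (f : T1 * T2 -> \bar R) :
  sigma_finite setT m2 -> measurable_fun [set: T1 * T2] f -> (forall x, 0 <= f x) ->
  measurable_fun setT (fun x => \int[m2]_y f (x, y)).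
Proof.
move=> s2 mf f0.
have [n2 ->] := sigma_finite_measureE s2.
exact: (@measurable_fun_fubini_tonelli_F _ _ _ _ _ n2 f mf f0).
Qed.

Lemma fubini_R d1 d2 (T1 : measurableType d1) (T2 : measurableType d2) (R : realType)
  (m1 : {measure set T1 -> \bar R}) (m2 : {measure set T2 -> \bar R})
  (f : T1 * T2 -> \bar R) :
  sigma_finite setT m1 -> sigma_finite setT m2 ->
  measurable_fun [set: T1 * T2] f -> \int[m1]_x \int[m2]_y `|f (x, y)| < +oo ->
  \int[m1]_x \int[m2]_y f (x, y) = \int[m2]_y \int[m1]_x f (x, y).
Proof.
move=> s1 s2 mf; have [n1 ->] := sigma_finite_measureE s1.
have [n2 ->] := sigma_finite_measureE s2 => f0.
apply: (@Fubini _ _ _ _ _ n1 n2 f); rewrite -/(product_measure1 n1 n2).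
by have [_ ->] := (@integrable12ltyP _ _ _ _ _ n1 n2 f mf).
Qed.

End Tonelli.

(** * Haar measure *)

Section Haar.
Context {R : realType} {G : topologicalGroupType}.
Hypothesis hG : hausdorff_space G.
Variable mu : {measure set (borel G) -> \bar R}.
Hypothesis haar : left_haar_measure mu.
Variable U : set G.
Hypothesis U_nbhd : generating_nbhd U.

Local Notation "\meas A" := (measurable (A : set (borel G))) (at level 10).

Lemma haar_lmul (x : G) (A : set G) : \meas A -> mu [set (x * y)%g | y in A] = mu A.
Proof. by move=> mA; case: haar => + _ _ _ _; apply. Qed.

Lemma haar_compact (A : set G) : compact A -> (mu A < +oo)%E.
Proof. by case: haar => _ + _ _ _; apply. Qed.

Lemma haar_sigma_finite : sigma_finite setT mu.
Proof.
have [F [cF FT]] := sigma_compact U_nbhd.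
exists F; first by rewrite predeqE => x; split=> // _; have [n] := FT x; exists n.
by move=> n; split; [exact: compact_borel|exact: haar_compact].
Qed.

Local Open Scope ereal_scope.

Lemma integral_lmul (x : G) (f : G -> \bar R) :
  measurable_fun [set: borel G] (f : borel G -> \bar R) -> (forall y, 0 <= f y) ->
  \int[mu]_y f (x * y)%g = \int[mu]_y f y.
Proof.
move=> mf f0; have mx := @borel_lmul G x.
have := @ge0_integral_pushforward _ _ _ _ R _ mx mu setT f measurableT mf (fun y _ => f0 y).
rewrite preimage_setT => <-.
apply: eq_measure_integral => A mA _; change (mu ((fun y => x * y)%g @^-1` A) = mu A).
by rewrite -[RHS](haar_lmul x^-1%g) // lmul_imageE invgK.
Qed.

Lemma integral_lmul_in (x : G) (A : set G) (f : G -> \bar R) : \meas A ->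
  measurable_fun [set: borel G] (f : borel G -> \bar R) -> (forall y, 0 <= f y) ->
  \int[mu]_(y in A) f (x * y)%g = \int[mu]_(y in [set (x * y)%g | y in A]) f y.
Proof.
move=> mA mf f0; have mx := @borel_lmul G x.
have mA' := measurable_lmul x mA.
have mfA : measurable_fun ([set (x * y)%g | y in A] : set (borel G)) f by exact: measurable_funTS.
have := @ge0_integral_pushforward _ _ _ _ R _ mx mu _ f mA' mfA (fun y _ => f0 y).
have -> : (fun y => x * y)%g @^-1` [set (x * y)%g | y in A] = A.
  by rewrite lmul_imageE; apply/seteqP; split=> y /=; rewrite mulKg.
move=> <-; apply: eq_measure_integral => B mB _; change (mu ((fun y => x * y)%g @^-1` B) = mu B).
by rewrite -[RHS](haar_lmul x^-1%g) // lmul_imageE invgK.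
Qed.

(** Translates of a null open set would cover every compact set by finitely many null sets, and the
    group is sigma-compact. *)
Lemma haar_open_pos (V : set G) : open V -> V 1%g -> 0 < mu V.
Proof.
move=> oV V1; rewrite lt_neqAle measure_ge0 andbT eq_sym; apply/eqP => V0.
have null C : compact C -> mu.-negligible (C : set (borel G)).
  move=> cC; apply: (compact_local (Q := fun A => mu.-negligible (A : set (borel G)))) cC _.
  - exact: negligible_set0.
  - by move=> A B; exact: negligibleU.
  - by move=> A B AB; apply: negligibleS; exact: AB.
  - move=> x _; exists [set (x * y)%g | y in V].
      by apply: nbhs_lmul; exact: open_nbhs_nbhs.
    apply/negligibleP; first by apply: measurable_lmul; exact: open_borel.
    by rewrite -V0; exact: haar_lmul (open_borel oV).
have [F [cF FT]] := sigma_compact U_nbhd.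
have : mu.-negligible (\bigcup_n F n : set (borel G)).
  by apply: negligible_bigcup => n; exact: null.
have -> : \bigcup_n F n = setT by rewrite predeqE => x; split=> // _; have [n] := FT x; exists n.
move/negligibleP => /(_ measurableT); case: haar => _ _ /eqP muT _ _; exact: muT.
Qed.

End Haar.

(** * Bump functions *)

Section CompactSupport.
Context {R : realType} {G : topologicalGroupType}.
Implicit Types (f : G -> R) (K L : set G).

Lemma compactly_supported_uniform_continuity f K (e : R) : continuous f -> compact K ->
  (forall x, ~ K x -> f x = 0) -> 0 < e ->
  exists2 V : set G, nbhs (1%g : G) V & forall v y, V v -> `|f (v * y)%g - f y| < e.
Proof.
move=> fc cK f0 e0.
pose Q (A : set G) := exists2 V : set G, nbhs (1%g : G) V &
  forall v y, V v -> A y -> `|f (v * y)%g - f y| < e.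
have [V V1 hV] : Q K.
  apply: (compact_local (Q := Q)) cK _.
  - by exists setT => //; exact: filterT.
  - move=> A B [V V1 hA] [W W1 hB]; exists (V `&` W); first exact: filterI.
    by move=> v y [Vv Wv] [/hA|/hB]; apply.
  - by move=> A B AB [V V1 hV]; exists V => // v y Vv /AB; exact: hV.
  - move=> x _; have e20 : 0 < e / 2 by rewrite divr_gt0.
    have fx : nbhs x [set y | `|f x - f y| < e / 2].
      by have /cvgrPdist_lt := fc x; apply.
    have := @mulg_continuous G (1%g, x); rewrite /continuous_at /= mul1g.
    move=> /(_ _ fx) [[V N] /= [V1 xN] VN].
    exists (N `&` [set y | `|f x - f y| < e / 2]); first exact: filterI.
    exists V => // v y Vv [Ny hy]; have /= hv := VN (v, y) (conj Vv Ny).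
    rewrite (_ : _ - _ = (f x - f y) - (f x - f (v * y)%g)); last by ring.
    by rewrite (le_lt_trans (ler_normB _ _)) // [e]splitr ltrD.
(* Symmetry handles the case of [y] outside [K] with [v y] in [K]: the local estimate is then
   applied to [v^-1] at the point [v y]. *)
exists (V `&` [set v | V v^-1%g]); first by apply: filterI => //; exact: nbhs_inv.
move=> v y [Vv Vvi]; have [Ky|nKy] := pselect (K y); first exact: hV.
have [Kvy|nKvy] := pselect (K (v * y)%g); last by rewrite !f0 // subrr normr0.
by have := hV _ _ Vvi Kvy; rewrite mulKg distrC.
Qed.

Hypothesis hG : hausdorff_space G.
Hypothesis lcG : locally_compact [set: G].

Variable U : set G.
Hypothesis U_nbhd : generating_nbhd U.

Lemma open_in_compact (x : G) : exists V K : set G,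
  [/\ open V, V x, compact K & V `<=` K].
Proof.
have [oU U1 _ _ _] := U_nbhd.
exists [set (x * u)%g | u in U], [set (x * u)%g | u in closure U]; split.
- exact: open_lmul.
- by exists 1%g; rewrite ?mulg1.
- by apply: compact_lmul; exact: compact_closure_gen U_nbhd.
- by move=> _ [u Uu <-]; exists u => //; exact: subset_closure.
Qed.

(** Asking for positivity on [L] instead of the value [1] makes the property stable under sums, so
    functions obtained locally from complete regularity can be added up. *)
Lemma bump L (V : set G) : compact L -> open V -> L `<=` V ->
  exists f, [/\ continuous f, forall x, 0 <= f x, forall x, L x -> 0 < f x,
    forall x, ~ V x -> f x = 0 &
    exists2 K, compact K & forall x, ~ K x -> f x = 0].
Proof.
move=> cL oV LV.
pose Q (A : set G) := exists f, [/\ continuous f, forall x, 0 <= f x, forall x, A x -> 0 < f x,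
    forall x, ~ V x -> f x = 0 & exists2 K, compact K & forall x, ~ K x -> f x = 0].
apply: (compact_local (Q := Q)) cL _.
- exists (fun=> 0); split=> //; first exact: cst_continuous.
  by exists set0 => //; exact: compact0.
- move=> A B [f [fc f0 fA fV [K cK fK]]] [g [gc g0 gB gV [K' cK' gK]]].
  exists (fun x => f x + g x); split.
  + by move=> x; apply: cvgD; [exact: fc|exact: gc].
  + by move=> x; rewrite addr_ge0.
  + by move=> x [/fA|/gB] h; [exact: ltr_pwDl|exact: ltr_wpDl].
  + by move=> x nV; rewrite fV // gV // addr0.
  + exists (K `|` K'); first exact: compactU.
    by move=> x /not_orP[nK nK']; rewrite fK // gK // addr0.
- move=> A B AB [f [fc f0 fB fV fK]]; exists f; split=> // x /AB; exact: fB.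
- move=> x Lx; have [W [K [oW Wx cK WK]]] := open_in_compact x.
  have cl : closed (~` (V `&` W)) by apply: open_closedC; exact: openI.
  have nx : ~ (~` (V `&` W)) x by apply; split=> //; exact: LV.
  have /(@uniform_separatorP _ R) [f [fc f01 fx f1]] :=
    @locally_compact_completely_regular G R lcG hG x _ cl nx.
  have fle y : f y <= 1.
    by have := f01 (f y); rewrite /= in_itv /= => /(_ (ex_intro2 _ _ y I erefl))/andP[].
  exists [set y | f y < 1].
    have := fc x [set r : R | r < 1]; apply.
    have -> : f x = 0 by apply: fx; exists x.
    by apply: open_nbhs_nbhs; split; [exact: open_lt|exact: ltr01].
  exists (fun y => 1 - f y); split.
  + by move=> y; apply: cvgB; [exact: cvg_cst|exact: fc].
  + by move=> y; rewrite subr_ge0.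
  + by move=> y /=; rewrite subr_gt0.
  + by move=> y nV; rewrite (f1 (f y)) ?subrr //; exists y => // -[].
  + exists K => // y nK; rewrite (f1 (f y)) ?subrr //; exists y => // -[_ /WK].
    exact: nK.
Qed.

End CompactSupport.

Section RationalLevels.
Context {R : realType}.

Definition qenum (n : nat) : R := ratr (odflt 0 (unpickle n)).

(** A function is the supremum of the rationals below its values, so it can be rebuilt after each
    rational level set has been changed separately. Where the changed sets have an infinite
    supremum, [fine] gives the default value [0]; in the application this happens only on a null
    set. *)
Definition level_sup (T : Type) (A : nat -> set T) (x : T) : R :=
  fine (esups (fun n => if x \in A n then (qenum n)%:E else -oo%E) 0%N).

Lemma measurable_level_sup d (T : measurableType d) (A : nat -> set T) :
  (forall n, measurable (A n)) -> measurable_fun [set: T] (level_sup A).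
Proof.
move=> mA; apply: (measurableT_comp (fine_measurable measurableT)).
apply: measurable_fun_esups => n; apply: measurable_fun_ifT => //.
apply: (measurable_fun_bool true); rewrite setTI.
by rewrite (_ : _ @^-1` _ = A n) //; apply/seteqP; split=> x; [exact: set_mem|exact: mem_set].
Qed.

Lemma level_supE (T : Type) (A : nat -> set T) (f : T -> R) x :
  (forall n, A n x <-> qenum n < f x) -> level_sup A x = f x.
Proof.
move=> hA; rewrite /level_sup (_ : esups _ _ = (f x)%:E) //.
apply/le_anti/andP; split.
  apply: ge_ereal_sup => _ [n _ <-]; case: ifPn => [|_]; last exact: leNye.
  by rewrite inE => /hA h; rewrite lee_fin ltW.
apply/lee_subgt0Pr => e e0.
have [q] : exists q : rat, ratr q \in `]f x - e, f x[ by apply: rat_in_itvoo; rewrite ltrBlDr ltrDl.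
rewrite in_itv /= => /andP[q1 q2].
have qE : qenum (pickle q) = ratr q by rewrite /qenum pickleK.
apply: (@le_trans _ _ (qenum (pickle q))%:E); first by rewrite qE -EFinB lee_fin ltW.
apply: ereal_sup_ubound; exists (pickle q) => //.
by rewrite mem_set //; apply/hA; rewrite qE.
Qed.

End RationalLevels.

Section RealFubini.
Context d1 d2 {T1 : measurableType d1} {T2 : measurableType d2} {R : realType}.
Variables (m1 : {measure set T1 -> \bar R}) (m2 : {measure set T2 -> \bar R}).
Hypothesis s1 : sigma_finite setT m1.
Hypothesis s2 : sigma_finite setT m2.

Lemma measurable_Rintegral (f : T1 * T2 -> R) : measurable_fun [set: T1 * T2] f ->
  measurable_fun [set: T1] (fun x => \int[m2]_y f (x, y)).
Proof.
move=> mf; have /measurable_EFinP mF := mf.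
apply: (measurableT_comp (fine_measurable measurableT)).
under eq_fun do rewrite integralE.
apply: emeasurable_funB.
  have := @measurable_tonelli1 _ _ _ _ _ m2 _ s2 (measurable_funepos mF) (funepos_ge0 _).
  by apply: eq_measurable_fun => g _; apply: eq_integral => h _; rewrite !funeposE.
have := @measurable_tonelli1 _ _ _ _ _ m2 _ s2 (measurable_funeneg mF) (funeneg_ge0 _).
by apply: eq_measurable_fun => g _; apply: eq_integral => h _; rewrite !funenegE.
Qed.

(** The real-valued integral takes a default value where the extended one is infinite; integrability
    of every section makes the two agree before Fubini is applied. *)
Lemma fubini_Rintegral (f : T1 * T2 -> R) : measurable_fun [set: T1 * T2] f ->
  (forall x, m2.-integrable setT (fun y => (f (x, y))%:E)) ->
  (forall y, m1.-integrable setT (fun x => (f (x, y))%:E)) ->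
  (\int[m1]_x \int[m2]_y `|f (x, y)|%:E < +oo)%E ->
  \int[m1]_x \int[m2]_y f (x, y) = \int[m2]_y \int[m1]_x f (x, y).
Proof.
move=> mf i1 i2 fin; have /measurable_EFinP mF := mf.
have e1 x : (\int[m2]_y f (x, y))%:E = (\int[m2]_y (f (x, y))%:E)%E.
  by rewrite fineK // integrable_fin_num.
have e2 y : (\int[m1]_x f (x, y))%:E = (\int[m1]_x (f (x, y))%:E)%E.
  by rewrite fineK // integrable_fin_num.
have := fubini_R s1 s2 mF fin.
rewrite {1 3}/Rintegral => e; congr fine.
under eq_integral do rewrite e1.
under [RHS]eq_integral do rewrite e2.
exact: e.
Qed.

End RealFubini.

Lemma lin_comb_le (R : realFieldType) (k A B M : R) : k * A <= M -> k * B <= M ->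
  k * (2 * B + 2 * A) <= 4 * M.
Proof. by move=> hA hB; rewrite mulrDr !(mulrCA k); lra. Qed.

(** The third hypothesis places [X / n] in a Stolz domain with vertex [1]. The bound follows from
    [n (1 - z) = (n - z X) + z (X - n)] together with [n - |X| <= |n - z X|], valid as [|z| < 1]. *)
Lemma stolz_bound (R : realType) (n C : R) (X z : R[i]) : 0 <= n -> 0 <= C ->
  nrm (X - n%:C%C) <= C * (n - nrm X) -> nrm z < 1 ->
  n * nrm (1 - z) <= (1 + C) * nrm (n%:C%C - z * X).
Proof.
move=> n0 C0 hX z1; have nE : nrm (n%:C%C : R[i]) = n by rewrite nrmC ger0_norm.
have h1 : n * nrm (1 - z) <= nrm (n%:C%C - z * X) + nrm (X - n%:C%C).
  rewrite -{1}nE -nrmM (_ : n%:C%C * (1 - z) = (n%:C%C - z * X) + z * (X - n%:C%C)); last by ring.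
  apply: le_trans (nrmD _ _) _; rewrite lerD2l nrmM ler_piMl ?nrm_ge0 //; exact: ltW.
have h2 : n - nrm X <= nrm (n%:C%C - z * X).
  have := ler_nrmB (n%:C%C) (z * X); rewrite nE nrmM => /(le_trans (ler_norm _)).
  apply: le_trans; rewrite lerD2l lerN2 ler_piMl ?nrm_ge0 //; exact: ltW.
apply: le_trans h1 _; rewrite mulrDl mul1r lerD2l; apply: le_trans hX _.
exact: ler_wpM2l.
Qed.

Lemma Re_mulCD (R : realType) (w Y : R[i]) (n : R) :
  complex.Re (w * (n%:C%C + Y)) = complex.Re w * n + complex.Re (w * Y).
Proof. by case: w Y => [? ?] [? ?] /=; ring. Qed.

(** * Convolution by a centered density *)

Section CenteredConvolution.
Context {R : realType} {G : topologicalGroupType}.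
Hypothesis hG : hausdorff_space G.
Hypothesis lcG : locally_compact [set: G].
Variable mu : {measure set (borel G) -> \bar R}.
Hypothesis haar : left_haar_measure mu.
Variable U : set G.
Hypothesis U_nbhd : generating_nbhd U.

Let sf := haar_sigma_finite hG haar U_nbhd.

Notation borelC := (@Defs.measurableC R G).
Notation borel_fun u := (measurable_fun [set: borel G] (u : borel G -> R)).
Notation summable_fun u := (mu.-integrable [set: borel G] (fun y : borel G => (u y)%:E)).

(** * Borel sets with measurable pullback under left division *)

Section NiceSets.

Definition ldiv (p : borel G * borel G) : borel G := (p.1^-1 * p.2)%g.

(* [ldiv] need not be measurable for the product of the Borel sigma-algebras
   when [G] is not second countable; Fubini is applied after modifying
   functions on null sets so that this holds for their level sets. *)
Definition nice (A : set G) :=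
  measurable (A : set (borel G)) /\ measurable (ldiv @^-1` A).

Lemma niceC A : nice A -> nice (~` A).
Proof. by move=> [mA mA']; split; exact: measurableC. Qed.

Lemma nice_bigcup (F : nat -> set G) : (forall n, nice (F n)) -> nice (\bigcup_n F n).
Proof.
move=> nF; split; first by apply: bigcupT_measurable => n; have [] := nF n.
by rewrite preimage_bigcup; apply: bigcupT_measurable => n; have [] := nF n.
Qed.

(** By uniform continuity [f (h^-1 g)] differs by less than [e] from [f (x^-1 g)] for [h] near [x],
    and the latter depends on [g] alone. Near each [x] one measurable rectangle therefore separates
    the level [2 e] from the level [0]. *)
Let positive_rect (f : G -> R) K (C : set G) e : continuous f -> compact K ->
  (forall x, ~ K x -> f x = 0) -> compact C -> 0 < e ->
  exists S : set (borel G * borel G), [/\ measurable S,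
    S `<=` ldiv @^-1` [set x | 0 < f x] &
    forall h g, C h -> 2 * e < f (h^-1 * g)%g -> S (h, g)].
Proof.
move=> fc cK fK cC e0; have [V V1 hV] := compactly_supported_uniform_continuity fc cK fK e0.
pose Q (A : set G) := exists S : set (borel G * borel G), [/\ measurable S,
    S `<=` ldiv @^-1` [set x | 0 < f x] &
    forall h g, A h -> 2 * e < f (h^-1 * g)%g -> S (h, g)].
apply: (compact_local (Q := Q)) cC _.
- by exists set0; split=> //; exact: measurable0.
- move=> A B [S [mS S0 hS]] [S' [mS' S0' hS']]; exists (S `|` S'); split.
  + exact: measurableU.
  + by move=> p [/S0|/S0'].
  + by move=> h g [Ah|Bh] hg; [left; exact: hS|right; exact: hS'].
- by move=> A B AB [S [mS S0 hS]]; exists S; split=> // h g /AB; exact: hS.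
- move=> x _; have [V' [oV' V'1] V'V] : exists2 B, open_nbhs (1%g : G) B & B `<=` V.
    by move: V1; rewrite nbhsE.
  pose W : set G := (fun h : G => h^-1 * x)%g @^-1` V'.
  have oW : open W.
    apply: open_comp => // y _; apply: (@continuous_comp _ _ _ (fun h : G => h^-1)%g (fun h : G => h * x)%g).
      exact: invg_cont.
    exact: rmul_continuous.
  exists W; first by apply: open_nbhs_nbhs; split=> //; rewrite /W /= mulVg.
  pose P : set G := (fun g : G => f (x^-1 * g)%g) @^-1` [set r | e < r].
  have oP : open P.
    apply: open_comp; last exact: open_gt.
    by move=> y _; apply: (@continuous_comp _ _ _ (fun h : G => x^-1 * h)%g f);
      [exact: lmul_continuous|exact: fc].
  have fd h g : W h -> `|f (h^-1 * g)%g - f (x^-1 * g)%g| < e.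
    by move=> Wh; have := hV _ (x^-1 * g)%g (V'V _ Wh); rewrite mulgA mulgK.
  exists (W `*` P); split.
  + by apply: measurableX; exact: open_borel.
  + move=> [h g] [/= Wh Pg]; have := fd h g Wh; rewrite /ldiv /=.
    by rewrite ltr_norml => /andP[+ _]; move: Pg; rewrite /P /=; lra.
  + move=> h g Wh hg; split=> //=; have := fd h g Wh; rewrite /P /=.
    by rewrite ltr_norml => /andP[_]; lra.
Qed.

Lemma nice_pos (f : G -> R) K : continuous f -> compact K ->
  (forall x, ~ K x -> f x = 0) -> nice [set x | 0 < f x].
Proof.
move=> fc cK fK; split.
  by apply: open_borel; apply: (@open_comp _ _ f [set r : R | 0 < r]) => //; exact: open_gt.
have [F [cF FT]] := sigma_compact U_nbhd.
have e0 m : 0 < m.+1%:R^-1 :> R by rewrite invr_gt0.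
have /choice [S hS] (nm : nat * nat) := positive_rect fc cK fK (cF nm.1) (e0 nm.2).
have -> : ldiv @^-1` [set x | 0 < f x] = \bigcup_n \bigcup_m S (n, m).
  apply/seteqP; split=> [[h g] /= fhg|p [n _ [m _ Sp]]]; last first.
    by have [_ + _] := hS (n, m); apply.
  have [n Fh] := FT h; exists n => //.
  pose m := Num.truncn (2 / f (h^-1 * g)%g); exists m => //.
  have [_ _ +] := hS (n, m); apply => //=.
  rewrite ltr_pdivrMr // mulrC -ltr_pdivrMr //.
  by rewrite -natr1; have := truncnS_gt (2 / f (h^-1 * g)%g); rewrite -natr1.
apply: bigcupT_measurable => n; apply: bigcupT_measurable => m.
by have [] := hS (n, m).
Qed.

Definition pos (f : G -> R) : set G := [set x | 0 < f x].

Definition symdiff (A B : set G) : set G := (A `\` B) `|` (B `\` A).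

Definition almost_nice (A : set G) :=
  exists2 A', nice A' & mu.-negligible (symdiff A A' : set (borel G)).

Lemma almost_niceC A : almost_nice A -> almost_nice (~` A).
Proof.
move=> [A' nA' h]; exists (~` A'); first exact: niceC.
apply: negligibleS h => x; rewrite /symdiff => -[[nAx /contrapT A'x]|[nA'x /contrapT Ax]].
  by right.
by left.
Qed.

Lemma almost_nice_bigcup (F : nat -> set G) :
  (forall n, almost_nice (F n)) -> almost_nice (\bigcup_n F n).
Proof.
move=> /(_ _)/cid2 nF; pose F' n := s2val (nF n).
exists (\bigcup_n F' n); first by apply: nice_bigcup => n; exact: (s2valP (nF n)).
have h : mu.-negligible (\bigcup_n symdiff (F n) (F' n) : set (borel G)).
  by apply: negligible_bigcup => n; exact: (s2valP' (nF n)).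
apply: negligibleS h => x [[[n _ Fx] nF']|[[n _ Fx] nF']]; exists n => //.
  by left; split=> // F'x; apply: nF'; exists n.
by right; split=> // F'x; apply: nF'; exists n.
Qed.

(** Inner regularity supplies compact subsets of nearly full measure, and bump functions enlarge
    them to nice open subsets of [V]; countably many of these exhaust [V] up to a null set. *)
Lemma almost_nice_open_finite (V : set G) : open V -> (mu (V : set (borel G)) < +oo)%E ->
  almost_nice V.
Proof.
move=> oV Vfin.
have Vnum : mu V \is a fin_num by rewrite ge0_fin_numE.
have inner n : exists f : G -> R, [/\ nice (pos f),
    pos f `<=` V & (mu V <= mu (pos f : set (borel G)) + n.+1%:R^-1%:E)%E].
  have e0 : 0 < n.+1%:R^-1 :> R by rewrite invr_gt0.
  have [L [cL LV] hL] : exists2 L : set G, compact L /\ L `<=` V & (mu V <= mu L + n.+1%:R^-1%:E)%E.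
    case: haar => _ _ _ _ /(_ V oV) inn.
    have supnum : ereal_sup [set mu A | A in [set A : set G | compact A /\ A `<=` V]] \is a fin_num.
      by rewrite -inn.
    have [_ [L [cL LV] <-] h] := ub_ereal_sup_adherent e0 supnum.
    by exists L => //; rewrite inn -leeBlDr // ltW.
  have [f [fc f0 fL fV [K cK fK]]] := bump (R := R) hG lcG U_nbhd cL oV LV.
  have nf := nice_pos fc cK fK.
  exists f; split=> //.
    by rewrite /pos => x /= fx; apply: contrapT => nV; move: fx; rewrite fV // ltxx.
  rewrite (le_trans hL) // leeD2r // le_measure ?inE //; last by case: nf.
  exact: compact_borel.
have /choice [f hf] := inner.
pose V' : set G := \bigcup_n pos (f n).
have nV' : nice V' by apply: nice_bigcup => n; case: (hf n).
have V'V : V' `<=` V by move=> x [n _]; case: (hf n) => _ + _; apply.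
exists V' => //.
have mV : measurable (V : set (borel G)) by exact: open_borel.
have mV' : measurable (V' : set (borel G)) by case: nV'.
have -> : symdiff V V' = V `\` V'.
  by rewrite /symdiff (_ : V' `\` V = set0) ?setU0 //; apply/seteqP; split=> x //= -[/V'V].
apply/negligibleP; first exact: measurableD.
apply/eqP; rewrite -measure_le0; apply/lee_addgt0Pr => e e0; rewrite add0e.
rewrite measureD // (setIidr V'V).
have [n ne] : exists n : nat, n.+1%:R^-1 <= e.
  exists (Num.truncn e^-1); rewrite invf_ple ?posrE //.
  exact: ltW (truncnS_gt _).
have [nn nV hn] := hf n.
rewrite leeBlDr; last first.
  by rewrite ge0_fin_numE // (le_lt_trans _ Vfin) // le_measure ?inE.
rewrite addeC (le_trans hn) // leeD//.
rewrite le_measure ?inE //; first by case: nn.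
by move=> x fx; exists n.
Qed.

Lemma exhaustion : exists P K : nat -> set G, [/\ forall n, open (P n),
  forall n, compact (K n), forall n, P n `<=` K n & forall x, exists n, P n x].
Proof.
have [F [cF FT]] := sigma_compact U_nbhd; have [oU U1 _ _ _] := U_nbhd.
exists (fun n => mulS (F n) U), (fun n => mulS (F n) (closure U)); split.
- by move=> n; exact: open_mulSl.
- by move=> n; apply: compact_mulS => //; exact: compact_closure_gen U_nbhd.
- by move=> n _ [x Fx [y Uy <-]]; exists x => //; exists y => //; exact: subset_closure.
- by move=> x; have [n Fx] := FT x; exists n, x => //; exists 1%g; rewrite ?mulg1.
Qed.

(** Almost nice sets are closed under complements and countable unions, so open sets suffice; these
    are first cut into pieces of finite measure. *)
Lemma almost_nice_measurable (A : set G) : measurable (A : set (borel G)) -> almost_nice A.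
Proof.
move=> mA; apply: (smallest_sub (X := almost_nice : set (set G)) _ _ mA).
  split=> [|B|F]; last exact: almost_nice_bigcup.
    exists set0; first by split; [|rewrite preimage_set0]; exact: measurable0.
    by rewrite /symdiff !setD0 setU0; exact: negligible_set0.
  by rewrite setTD; exact: almost_niceC.
move=> V oV; have [P [K [oP cK PK PT]]] := exhaustion.
have -> : V = \bigcup_n (V `&` P n).
  by apply/seteqP; split=> [x Vx|x [n _ []] //]; have [n Pn] := PT x; exists n.
apply: almost_nice_bigcup => n; apply: almost_nice_open_finite; first exact: openI.
apply: (le_lt_trans _ (haar_compact haar (cK n))).
rewrite le_measure ?inE //; [|exact: compact_borel|by move=> x [_ /PK]].
by apply: open_borel; exact: openI.
Qed.

End NiceSets.

(** * Modification on null sets, and inversion *)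

Section Modification.

Definition nice_fun (f : G -> R) :=
  measurable_fun [set: borel G] (f : borel G -> R) /\
  measurable_fun [set: borel G * borel G] (fun p => f (ldiv p) : R).

Definition null (Z : set G) := measurable (Z : set (borel G)) /\ mu (Z : set (borel G)) = 0%E.

(** Each rational level set is replaced by a nice one; countably many replacements alter the
    function only on a null set. *)
Lemma nice_modification (f : G -> R) : measurable_fun [set: borel G] (f : borel G -> R) ->
  exists2 f', nice_fun f' & exists2 Z, null Z & forall x, ~ Z x -> f x = f' x.
Proof.
move=> mf; pose A n : set G := [set x | qenum n < f x].
have mA n : measurable (A n : set (borel G)).
  have := mf measurableT `]qenum n, +oo[%classic (measurable_itv _); rewrite setTI.
  by congr (measurable _); apply/seteqP; split=> x; rewrite /A /= in_itv /= andbT.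
have /(_ _)/cid2 nA n := almost_nice_measurable (mA n).
pose A' n := s2val (nA n).
have nA' n : nice (A' n) by exact: (s2valP (nA n)).
have hA' n : mu.-negligible (symdiff (A n) (A' n) : set (borel G)) by exact: (s2valP' (nA n)).
exists (level_sup A').
  split; first by apply: measurable_level_sup => n; case: (nA' n).
  have := @measurable_level_sup R _ (borel G * borel G)%type (fun n => ldiv @^-1` A' n).
  by apply=> n; case: (nA' n).
have [Z [mZ Z0 hZ]] : mu.-negligible (\bigcup_n symdiff (A n) (A' n) : set (borel G)).
  exact: negligible_bigcup.
exists Z; first by split.
move=> x nZ; rewrite (@level_supE _ _ _ f) // => n; split=> [A'x|Ax].
  by apply: contrapT => nAx; apply: nZ; apply: hZ; exists n => //; right.
by apply: contrapT => nAx; apply: nZ; apply: hZ; exists n => //; left.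
Qed.

Local Open Scope ereal_scope.

Definition nice_efun (F : G -> \bar R) :=
  measurable_fun [set: borel G] (F : borel G -> \bar R) /\
  measurable_fun [set: borel G * borel G] (fun p => F (ldiv p) : \bar R).

Lemma nice_efun_indic (A : set G) : nice A -> nice_efun (fun x => (\1_A x)%:E).
Proof.
move=> [mA mA']; split; apply/measurable_EFinP; first exact: measurable_indic.
exact: (@measurable_indic _ _ _ _ (ldiv @^-1` A)).
Qed.

Lemma borel_ldivl (x : G) :
  measurable_fun [set: borel G] (fun h : borel G => (h^-1 * x)%g : borel G).
Proof.
apply: continuous_borel => y.
apply: (@continuous_comp _ _ _ (fun h : G => h^-1)%g (fun h : G => h * x)%g).
  exact: invg_cont.
exact: rmul_continuous.
Qed.

Lemma measurable_inv_arg (F : G -> \bar R) x :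
  measurable_fun [set: borel G] (F : borel G -> \bar R) ->
  measurable_fun [set: borel G] (fun h : borel G => F (h^-1 * x)%g : \bar R).
Proof. by move=> mF; exact: (measurableT_comp mF (borel_ldivl x)). Qed.

Lemma measurable_lmul_arg (F : G -> \bar R) x :
  measurable_fun [set: borel G] (F : borel G -> \bar R) ->
  measurable_fun [set: borel G] (fun h : borel G => F (x * h)%g : \bar R).
Proof.
by move=> mF; exact: (measurableT_comp mF (borel_lmul x)).
Qed.

Lemma integral_in_indic d (T : measurableType d) (m : {measure set T -> \bar R})
  (A : set T) (f : T -> \bar R) :
  \int[m]_(x in A) f x = \int[m]_x (f x * (\1_A x)%:E).
Proof.
rewrite integral_mkcond; apply: eq_integral => x _.
rewrite patchE indicE; case: ifPn => _; by rewrite ?mule1 ?mule0.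
Qed.

(* A substitute for the modular function in the proof of [null_inv]. *)
Lemma inversion_bound (A C : set G) (F : G -> \bar R) : compact A -> compact C ->
  nice_efun F -> (forall x, 0 <= F x) ->
  mu A * \int[mu]_(h in C) F h^-1%g <= mu (mulS A C) * \int[mu]_x F x.
Proof.
move=> cA cC [mF mF'] F0; have cAC := compact_mulS cA cC.
have mA : measurable (A : set (borel G)) by exact: compact_borel.
have mC : measurable (C : set (borel G)) by exact: compact_borel.
have mAC : measurable (mulS A C : set (borel G)) by exact: compact_borel.
(* The double integral of [W] is computed in both orders. For fixed [x] in [A], substituting [x h]
   for [h] turns [F (h^-1 x)] into [F h^-1] and maps [C] into [mulS A C]; for fixed [h], left
   invariance leaves the integral of [F]. *)
pose W (p : borel G * borel G) := F (ldiv p) * (\1_(mulS A C) p.1)%:E * (\1_A p.2)%:E.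
have mW : measurable_fun setT W.
  apply: emeasurable_funM; first apply: emeasurable_funM => //.
    by apply/measurable_EFinP; exact: (measurableT_comp (measurable_indic mAC) measurable_fst).
  by apply/measurable_EFinP; exact: (measurableT_comp (measurable_indic mA) measurable_snd).
have W0 p : 0 <= W p by rewrite !mule_ge0 // lee_fin.
have mWswap : measurable_fun setT (fun p : borel G * borel G => W (p.2, p.1)).
  have msw : measurable_fun [set: borel G * borel G] (fun p => (p.2, p.1) : borel G * borel G).
    by apply: measurable_fun_pair; [exact: measurable_snd|exact: measurable_fst].
  exact: (measurableT_comp mW msw).
have W0' h x : 0 <= F (h^-1 * x)%g * (\1_(mulS A C) h)%:E by rewrite mule_ge0 // lee_fin.
have mix x := measurable_inv_arg x mF.
have mWx x : measurable_fun [set: borel G] (fun h : borel G => F (h^-1 * x)%g * (\1_(mulS A C) h)%:E).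
  by apply: emeasurable_funM => //; apply/measurable_EFinP; exact: measurable_indic.
apply: (@le_trans _ _ (\int[mu]_x \int[mu]_h W (h, x))).
  rewrite muleC -integral_cst // integral_in_indic; apply: ge0_le_integral => //.
  - by move=> x _; rewrite mule_ge0 ?lee_fin ?integral_ge0.
  - by apply: emeasurable_funM => //; apply/measurable_EFinP; exact: measurable_indic.
  - exact: (measurable_tonelli1 sf mWswap).
  move=> x _; have -> : \int[mu]_h W (h, x) =
      (\1_A x)%:E * \int[mu]_h (F (h^-1 * x)%g * (\1_(mulS A C) h)%:E).
    rewrite -ge0_integralZl ?lee_fin //.
    by apply: eq_integral => h _; rewrite muleC.
  rewrite muleC indicE; case: (boolP (x \in A)) => [|_]; last by rewrite !mul0e.
  rewrite inE => Ax; rewrite !mul1e -integral_in_indic.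
  have -> : \int[mu]_(h in C) F h^-1%g = \int[mu]_(h in C) F ((x * h)^-1 * x)%g.
    by apply: eq_integral => h _; rewrite invgM mulgVK.
  rewrite (@integral_lmul_in _ _ _ haar x C (fun h => F (h^-1 * x)%g)) //.
  apply: ge0_subset_integral => //; first exact: measurable_lmul.
    exact: measurable_funTS.
  by move=> _ [c Cc <-]; exists x => //; exists c.
rewrite (tonelli sf sf mWswap) //=.
apply: (@le_trans _ _ (\int[mu]_h ((\int[mu]_x F x) * (\1_(mulS A C) h)%:E))).
  apply: ge0_le_integral => //.
  - by move=> h _; apply: integral_ge0.
  - exact: (measurable_tonelli1 sf mW).
  - by apply: emeasurable_funM => //; apply/measurable_EFinP; exact: measurable_indic.
  move=> h _; rewrite /W /=.
  rewrite -(integral_lmul haar h^-1%g mF F0) -ge0_integralZr ?lee_fin //; last first.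
    exact: (measurable_lmul_arg h^-1%g mF).
  apply: ge0_le_integral => //.
  - by move=> x _; exact: W0.
  - apply: emeasurable_funM; last by apply/measurable_EFinP; exact: measurable_indic.
    by apply: emeasurable_funM => //; exact: (measurable_lmul_arg h^-1%g mF).
  - by apply: emeasurable_funM => //; exact: (measurable_lmul_arg h^-1%g mF).
  move=> x _; rewrite [\1_A x]indicE.
  by case: (x \in A); rewrite ?mule1 // mule0; exact: W0'.
by rewrite -integral_in_indic integral_cst // muleC.
Qed.

(** Outer regularity puts [Z] into an open [V] of small measure, and [inversion_bound] limits the
    inverse of [V] within a compact set. As that bound needs a nice integrand, the inverse of [V] is
    approached by compact sets [L], and a bump function around [invS L] inside [V] supplies the
    integrand. *)
Lemma null_inv (Z : set G) : null Z -> null (invS Z).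
Proof.
move=> [mZ Z0]; have mZi := measurable_invS mZ; split=> //.
have [P [K [oP cK PK PT]]] := exhaustion.
suff null_n n : mu (P n `&` invS Z : set (borel G)) = 0.
  apply/(negligibleP mu mZi).
  have -> : invS Z = \bigcup_n (P n `&` invS Z).
    by apply/seteqP; split=> [x Zx|x [n _ []] //]; have [n Pn] := PT x; exists n.
  apply: negligible_bigcup => n; apply/negligibleP; last exact: null_n.
  by apply: measurableI => //; exact: open_borel.
pose A := closure U; have cA : compact A by exact: compact_closure_gen U_nbhd.
have [oU U1 _ _ _] := U_nbhd.
have mA : measurable (A : set (borel G)) by exact: compact_borel.
have Apos : 0 < mu A.
  apply: (lt_le_trans (haar_open_pos haar U_nbhd oU U1)).
  by rewrite le_measure ?inE //; [exact: open_borel|exact: subset_closure].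
have Afin : mu A < +oo by exact: (haar_compact haar cA).
have ACfin : mu (mulS A (K n)) < +oo by apply: (haar_compact haar); exact: compact_mulS.
pose c := (fine (mu (mulS A (K n))) / fine (mu A))%R.
have step (V : set G) : open V -> Z `<=` V ->
    mu (P n `&` invS Z : set (borel G)) <= c%:E * mu (V : set (borel G)).
  move=> oV ZV; have oPV : open (P n `&` invS V).
    by apply: openI => //; rewrite invSE; apply: open_comp => // x _; exact: invg_cont.
  apply: (@le_trans _ _ (mu (P n `&` invS V : set (borel G)))).
    rewrite le_measure ?inE //; [|exact: open_borel|].
      by apply: measurableI => //; exact: open_borel.
    by move=> x [Px [z /ZV Vz zx]]; split=> //; exists z.
  case: haar => _ _ _ _ /(_ _ oPV) ->; apply: ge_ereal_sup => _ [L [cL LPV] <-].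
  have LV : invS L `<=` V by move=> _ [x /LPV[_ [v Vv <-]] <-]; rewrite invgK.
  have [f [fc f0 fL fV [K' cK' fK']]] := bump (R := R) hG lcG U_nbhd (compact_invS cL) oV LV.
  have nf := nice_pos fc cK' fK'.
  have fV' : pos f `<=` V.
    by rewrite /pos => x /= fx; apply: contrapT => nV; move: fx; rewrite fV // ltxx.
  have mL : measurable (L : set (borel G)) by exact: compact_borel.
  have mf : measurable (pos f : set (borel G)) by case: nf.
  have ib : mu A * mu (L : set (borel G)) <= mu (mulS A (K n)) * mu (V : set (borel G)).
    have i0 x : 0 <= (\1_(pos f) x)%:E :> \bar R by rewrite lee_fin.
    have := inversion_bound cA (cK n) (nice_efun_indic nf) i0.
    have -> : \int[mu]_x (\1_(pos f) x)%:E = mu (pos f : set (borel G)).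
      by rewrite integral_indic ?setIT.
    move=> h.
    apply: (@le_trans _ _ (mu (mulS A (K n)) * mu (pos f : set (borel G)))); last first.
      by rewrite lee_pmul // le_measure ?inE //; exact: open_borel.
    apply: le_trans h; rewrite lee_pmul //.
    have mKn : measurable (K n : set (borel G)) by exact: compact_borel.
    rewrite -[X in mu X](_ : L `&` K n = L); last first.
      by apply/setIidPl => x /LPV[/PK].
    rewrite -integral_indic //; apply: ge0_le_integral => //.
    - by apply/measurable_EFinP; apply: measurable_funTS; exact: measurable_indic.
    - apply: measurable_funTS; have [mi _] := nice_efun_indic nf.
      exact: (measurableT_comp mi borel_inv).
    move=> x _; rewrite lee_fin !indicE; case: (boolP (x \in L)) => //=.
    rewrite inE => Lx; rewrite mem_set //; apply: fL; by exists x.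
  have aE : mu A = (fine (mu A))%:E by rewrite fineK // ge0_fin_numE.
  have kE : mu (mulS A (K n)) = (fine (mu (mulS A (K n))))%:E by rewrite fineK // ge0_fin_numE.
  have a0 : (0 < fine (mu A))%R by rewrite fine_gt0 // Apos.
  rewrite /c mulrC EFinM -muleA -(lee_pmul2l (x := (fine (mu A))%:E)) //.
  by rewrite muleA -EFinM divff ?gt_eqF // mul1e -aE -kE.
have c0 : (0 <= c)%R by rewrite divr_ge0 ?fine_ge0.
apply/eqP; rewrite -measure_le0; apply/lee_addgt0Pr => e e0; rewrite add0e.
have c1 : (0 < c + 1)%R by rewrite ltr_wpDl.
have e1 : (0 < e / (c + 1))%R by rewrite divr_gt0.
have [_ _ _ /(_ Z mZ) oreg _] := haar.
have infnum : ereal_inf [set mu V | V in [set V : set G | open V /\ Z `<=` V]] \is a fin_num.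
  by rewrite -oreg Z0.
have [_ [V [oV ZV] <-]] := lb_ereal_inf_adherent e1 infnum.
rewrite -oreg Z0 add0e => Ve.
apply: (le_trans (step V oV ZV)); apply: (@le_trans _ _ (c%:E * (e / (c + 1))%:E)).
  by rewrite lee_pmul // ?lee_fin // ltW.
rewrite -EFinM lee_fin mulrA ler_pdivrMr // mulrC ler_pM2l // lerDl.
by [].
Qed.

End Modification.

Section Translations.

Lemma borel_fun_lmul (u : G -> R) x : borel_fun u -> borel_fun (fun y => u (x * y)%g).
Proof. by move=> mu'; exact: (measurableT_comp mu' (borel_lmul x)). Qed.

Lemma borel_fun_ldiv (u : G -> R) x : borel_fun u -> borel_fun (fun h => u (h^-1 * x)%g).
Proof.
by move=> mu'; exact: (measurableT_comp mu' (borel_ldivl x)).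
Qed.

Lemma integrable_lmul (u : G -> R) x : summable_fun u -> summable_fun (fun y => u (x * y)%g).
Proof.
move=> /integrableP[mu' fin]; apply/integrableP; split.
  apply/measurable_EFinP; apply: borel_fun_lmul; exact/measurable_EFinP.
rewrite (@integral_lmul _ _ _ haar x (fun y => `|(u y)%:E|)%E) //.
exact: (measurableT_comp (@abse_measurable _ setT) mu').
Qed.

Lemma Rintegral_lmul (u : G -> R) x : borel_fun u ->
  \int[mu]_y u (x * y)%g = \int[mu]_y u y.
Proof.
move=> mu'; have m : measurable_fun [set: borel G] (fun y : borel G => (u y)%:E) by exact/measurable_EFinP.
rewrite /Rintegral; congr fine; rewrite integralE [RHS]integralE; congr (_ - _)%E.
  rewrite -[RHS](integral_lmul haar x (measurable_funepos m) (funepos_ge0 _)).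
  by apply: eq_integral => y _; rewrite !funeposE.
rewrite -[RHS](integral_lmul haar x (measurable_funeneg m) (funeneg_ge0 _)).
by apply: eq_integral => y _; rewrite !funenegE.
Qed.

Lemma nice_fun_norm (f : G -> R) : nice_fun f -> nice_fun (fun x => `|f x|).
Proof.
by move=> [m1 m2]; split; [exact: (measurableT_comp _ m1)|exact: (measurableT_comp _ m2)].
Qed.

Lemma null_ldiv Z g : null Z -> null [set h | Z (h^-1 * g)%g].
Proof.
move=> nZ; have [mZi Zi0] := null_inv nZ.
have -> : [set h | Z (h^-1 * g)%g] = [set (g * y)%g | y in invS Z].
  rewrite lmul_imageE invSE; apply/seteqP; split=> h /=; by rewrite invgM invgK.
by split; [exact: measurable_lmul|rewrite haar_lmul].
Qed.

Lemma null_ldivl Z h : null Z -> null [set x | Z (h^-1 * x)%g].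
Proof.
move=> [mZ Z0]; have -> : [set x | Z (h^-1 * x)%g] = [set (h * y)%g | y in Z].
  by rewrite lmul_imageE.
by split; [exact: measurable_lmul|rewrite haar_lmul].
Qed.

Lemma ae_null (P : G -> Prop) Z : null Z -> (forall x, ~ Z x -> P x) ->
  {ae mu, forall x, P x}.
Proof.
move=> [mZ Z0] h; exists Z; split=> // x /= nP; apply: contrapT => nZ.
by apply: nP; exact: h.
Qed.

Local Open Scope ereal_scope.

(** Finiteness at every [g], not merely almost every one: the integral runs over inverses, and
    [inversion_bound] dominates it by the integral of [w]. The convolution is thus a genuine
    function at each point. *)
Lemma local_summable (C : set G) (w : G -> R) g : compact C -> borel_fun w ->
  (forall x, 0 <= w x)%R -> \int[mu]_x (w x)%:E < +oo ->
  \int[mu]_(h in C) (w (h^-1 * g)%g)%:E < +oo.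
Proof.
move=> cC mw w0 wfin.
have [w' nw' [Z nZ hZ]] := nice_modification mw.
have [m1 m2] := nice_fun_norm nw'.
pose F x := `|w' x|%:E.
have nF : nice_efun F by split; exact/measurable_EFinP.
have F0 x : 0 <= F x by rewrite lee_fin.
have wF x : ~ Z x -> (w x)%:E = F x by move=> nx; rewrite /F -hZ // ger0_norm.
have Ffin : \int[mu]_x F x < +oo.
  rewrite -(@ge0_ae_eq_integral _ _ _ mu setT (fun x => (w x)%:E) F) //.
  - exact/measurable_EFinP.
  - by case: nF.
  - by move=> x _; rewrite lee_fin.
  - by apply: ae_null nZ _ => x nx _; exact: wF.
have mC : measurable (C : set (borel G)) by exact: compact_borel.
have cC' : compact [set (g^-1 * y)%g | y in C] by exact: compact_lmul.
have mC' : measurable ([set (g^-1 * y)%g | y in C] : set (borel G)) by exact: compact_borel.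
have -> : \int[mu]_(h in C) (w (h^-1 * g)%g)%:E = \int[mu]_(h in C) F (h^-1 * g)%g.
  apply: ge0_ae_eq_integral => //.
  - apply: measurable_funTS; apply/measurable_EFinP; exact: borel_fun_ldiv.
  - by apply: measurable_funTS; apply: measurable_inv_arg; case: nF.
  - by move=> x _; rewrite lee_fin.
  - by apply: ae_null (null_ldiv g nZ) _ => h nh _; exact: wF.
have -> : \int[mu]_(h in C) F (h^-1 * g)%g =
    \int[mu]_(h in [set (g^-1 * y)%g | y in C]) F h^-1%g.
  have := @integral_lmul_in _ _ _ haar g [set (g^-1 * y)%g | y in C] (fun h => F (h^-1 * g)%g) mC'.
  have -> : [set (g * y)%g | y in [set (g^-1 * y)%g | y in C]] = C.
    by rewrite !lmul_imageE; apply/seteqP; split=> y /=; rewrite invgK mulVKg.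
  move=> <- //; last by apply: measurable_inv_arg; case: nF.
  by apply: eq_integral => h _; rewrite invgM mulgVK.
pose A := closure U; have cA : compact A by exact: compact_closure_gen U_nbhd.
have [oU U1 _ _ _] := U_nbhd.
have Apos : 0 < mu A.
  apply: (lt_le_trans (haar_open_pos haar U_nbhd oU U1)).
  by rewrite le_measure ?inE //; [exact: open_borel|exact: compact_borel|exact: subset_closure].
have := inversion_bound cA cC' nF F0.
set I := \int[mu]_(h in _) _; move=> h.
rewrite ltNge leye_eq; apply/negP => /eqP Iy; move: h.
rewrite Iy gt0_muley // leye_eq => /eqP h.
have ACfin : mu (mulS A [set (g^-1 * y)%g | y in C]) < +oo.
  by apply: (haar_compact haar); exact: compact_mulS.
have : mu (mulS A [set (g^-1 * y)%g | y in C]) * \int[mu]_x F x < +oo.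
  by rewrite lte_mul_pinfty // ?ge0_fin_numE.
by rewrite h.
Qed.

End Translations.

Variable K : G -> R.
Hypothesis K_density : probability_density mu K.
Hypothesis K_supp : compactly_supported K.
Hypothesis K_bounded : bounded_fun K.

Notation T := (conv_op mu K).

Let mK : borel_fun K. Proof. by case: K_density. Qed.
Let K0 g : 0 <= K g. Proof. by case: K_density. Qed.

(** * Pointwise convergence of the convolution *)

Section ConvolutionOperator.

Definition weight (w : G -> R) :=
  [/\ borel_fun w, forall x, 0 <= w x & (\int[mu]_x (w x)%:E < +oo)%E].

(** Contains L^p for all [p >= 1] at once, through [|u| <= 1 + |u|^p]. Since [K] is bounded with
    compact support, [local_summable] makes its convolution with a tame function converge at every
    point. *)
Definition tame (u : G -> R) :=
  borel_fun u /\ exists2 w, weight w & forall x, `|u x| <= 1 + w x.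

Definition TK (u : G -> R) g : R := \int[mu]_h (K h * u (h^-1 * g)%g).

Lemma weight_summable w : weight w -> summable_fun w.
Proof.
move=> [mw w0 wfin]; apply/integrableP; split; first exact/measurable_EFinP.
by under eq_integral => x _ do rewrite gee0_abs ?lee_fin //.
Qed.

Lemma K_summable : summable_fun K.
Proof.
apply: weight_summable; split=> //.
by case: K_density => _ _ ->; rewrite ltry.
Qed.

Lemma K_integral : \int[mu]_g K g = 1.
Proof. by rewrite /Rintegral; case: K_density => _ _ ->. Qed.

Lemma K_supportE g : ~ closure [set g | K g != 0] g -> K g = 0.
Proof.
move=> nc; apply/eqP; apply: contrapT => /negP Kg; apply: nc.
exact: subset_closure.
Qed.

Lemma K_ub : exists2 b, 0 <= b & forall g, K g <= b.
Proof.
have [M [_ hM]] := K_bounded.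
exists (`|M| + 1) => [|g]; first by rewrite addr_ge0.
have := hM (`|M| + 1); rewrite (le_lt_trans (ler_norm M)) ?ltrDl //.
by move=> /(_ isT g I); apply: le_trans; exact: ler_norm.
Qed.

Lemma tame_summable u g : tame u -> summable_fun (fun h => K h * u (h^-1 * g)%g).
Proof.
move=> [mu' [w [mw w0 wfin] uw]]; have [b b0 hb] := K_ub.
pose C := closure [set g | K g != 0].
have mC : measurable (C : set (borel G)) by exact: compact_borel.
have mul' := borel_fun_ldiv g mu'; have mwl := borel_fun_ldiv g mw.
apply/integrableP; split; first by apply/measurable_EFinP; exact: measurable_funM.
have mb : measurable_fun [set: borel G] (fun h : borel G => (b * (1 + w (h^-1 * g)%g))%:E).
  by apply/measurable_EFinP; apply: measurable_funM => //; exact: measurable_funD.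
apply: (@le_lt_trans _ _ (\int[mu]_(h in C) (b * (1 + w (h^-1 * g)%g))%:E)%E).
  rewrite [leRHS]integral_in_indic; apply: ge0_le_integral => //.
  - apply: (measurableT_comp (@abse_measurable _ setT)).
    by apply/measurable_EFinP; exact: measurable_funM.
  - by apply: emeasurable_funM => //; apply/measurable_EFinP; exact: measurable_indic.
  move=> h _; rewrite -EFinM abse_EFin lee_fin indicE normrM.
  have [hC|hC] := boolP (h \in C).
    by rewrite mulr1 ler_pM // ger0_norm.
  rewrite K_supportE ?normr0 ?mul0r ?mulr0 //.
  by move=> Ch; move: hC; rewrite mem_set.
have -> : (\int[mu]_(h in C) (b * (1 + w (h^-1 * g)%g))%:E =
    \int[mu]_(h in C) (b%:E + b%:E * (w (h^-1 * g)%g)%:E))%E.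
  by apply: eq_integral => h _; rewrite mulrDr mulr1.
have mbw : measurable_fun (C : set (borel G)) (fun h : borel G => (w (h^-1 * g)%g)%:E).
  by apply: measurable_funTS; exact/measurable_EFinP.
have w0g h : (0 <= (w (h^-1 * g)%g)%:E)%E by rewrite lee_fin.
have bw0 h : (0 <= b%:E * (w (h^-1 * g)%g)%:E)%E by rewrite mule_ge0 ?lee_fin.
have mbw' : measurable_fun (C : set (borel G)) (fun h : borel G => (b%:E * (w (h^-1 * g)%g)%:E)%E).
  exact: emeasurable_funM.
rewrite ge0_integralD //.
rewrite integral_cst // ge0_integralZl ?lee_fin //.
rewrite lte_add_pinfty // lte_mul_pinfty ?lee_fin //.
  exact: (haar_compact haar).
exact: (local_summable g K_supp mw w0 wfin).
Qed.

(** Equality holds at every point because [h |-> h^-1 g] pulls null sets back to null sets, which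
    rests on [null_inv]. *)
Lemma TK_ae (u u' : G -> R) Z : borel_fun u -> borel_fun u' -> null Z ->
  (forall x, ~ Z x -> u x = u' x) -> TK u = TK u'.
Proof.
move=> mu1 mu2 nZ e; apply/funext => g; rewrite /TK /Rintegral; congr fine.
apply: ae_eq_integral => //.
- by apply/measurable_EFinP; apply: measurable_funM => //; exact: borel_fun_ldiv.
- by apply/measurable_EFinP; apply: measurable_funM => //; exact: borel_fun_ldiv.
- by apply: ae_null (null_ldiv g nZ) _ => h nh _; rewrite e.
Qed.

Lemma measurable_kernel (u : G -> R) : nice_fun u ->
  measurable_fun [set: borel G * borel G] (fun p => K p.2 * u (p.2^-1 * p.1)%g : R).
Proof.
move=> [_ m2]; apply: measurable_funM; first exact: (measurableT_comp mK measurable_snd).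
have msw : measurable_fun [set: borel G * borel G] (fun p => (p.2, p.1) : borel G * borel G).
  by apply: measurable_fun_pair; [exact: measurable_snd|exact: measurable_fst].
exact: (measurableT_comp m2 msw).
Qed.

Lemma TK_borel u : borel_fun u -> borel_fun (TK u).
Proof.
move=> mu'; have [u' nu' [Z nZ hZ]] := nice_modification mu'.
rewrite (TK_ae mu' nu'.1 nZ hZ).
have mP := measurable_kernel nu'; move/measurable_EFinP in mP.
apply: (measurableT_comp (fine_measurable measurableT)).
under eq_fun do rewrite integralE.
apply: emeasurable_funB.
  have := @measurable_tonelli1 _ _ _ _ _ mu _ sf (measurable_funepos mP) (funepos_ge0 _).
  apply: eq_measurable_fun => g _; apply: eq_integral => h _; by rewrite !funeposE.
have := @measurable_tonelli1 _ _ _ _ _ mu _ sf (measurable_funeneg mP) (funeneg_ge0 _).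
apply: eq_measurable_fun => g _; apply: eq_integral => h _; by rewrite !funenegE.
Qed.

Lemma K_tonelli (w : G -> R) : borel_fun w -> (forall x, 0 <= w x) ->
  measurable_fun [set: borel G] (fun g : borel G => \int[mu]_h (K h * w (h^-1 * g)%g)%:E)%E /\
  (\int[mu]_g \int[mu]_h (K h * w (h^-1 * g)%g)%:E = \int[mu]_x (w x)%:E)%E.
Proof.
move=> mw w0; have [w' nw' [Z nZ hZ]] := nice_modification mw.
have nw := nice_fun_norm nw'; pose v x := `|w' x|.
have v0 x : 0 <= v x by rewrite /v.
have wv x : ~ Z x -> w x = v x by move=> nx; rewrite /v -hZ // ger0_norm.
have mP := measurable_kernel nw; move/measurable_EFinP in mP.
have mv : borel_fun v by case: nw.
have e g : (\int[mu]_h (K h * w (h^-1 * g)%g)%:E = \int[mu]_h (K h * v (h^-1 * g)%g)%:E)%E.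
  apply: ge0_ae_eq_integral => //.
  - by apply/measurable_EFinP; apply: measurable_funM => //; exact: borel_fun_ldiv.
  - by apply/measurable_EFinP; apply: measurable_funM => //; exact: borel_fun_ldiv.
  - by move=> h _; rewrite lee_fin mulr_ge0.
  - by move=> h _; rewrite lee_fin mulr_ge0.
  - by apply: ae_null (null_ldiv g nZ) _ => h nh _; rewrite wv.
have P0 (p : borel G * borel G) : (0 <= (K p.2 * v (p.2^-1 * p.1)%g)%:E)%E.
  by rewrite lee_fin mulr_ge0.
split.
  under eq_fun do rewrite e.
  exact: (measurable_tonelli1 sf mP P0).
under eq_integral do rewrite e.
rewrite (tonelli sf sf mP P0) /=.
have -> : (\int[mu]_x (w x)%:E = \int[mu]_x (v x)%:E)%E.
  apply: ge0_ae_eq_integral => //; [exact/measurable_EFinP|exact/measurable_EFinP| | |].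
  - by move=> x _; rewrite lee_fin.
  - by move=> x _; rewrite lee_fin.
  - by apply: ae_null nZ _ => x nx _; rewrite wv.
have ih h : (\int[mu]_g (K h * v (h^-1 * g)%g)%:E = (K h)%:E * \int[mu]_x (v x)%:E)%E.
  under eq_integral do rewrite EFinM.
  rewrite ge0_integralZl ?lee_fin //.
  - congr (_ * _)%E; apply: (integral_lmul haar h^-1%g (f := fun x => (v x)%:E)).
      exact/measurable_EFinP.
    by move=> x; rewrite lee_fin.
  - by apply/measurable_EFinP; exact: borel_fun_lmul.
  - by move=> x _; rewrite lee_fin.
have -> : (\int[mu]_h \int[mu]_g (K h * v (h^-1 * g)%g)%:E = \int[mu]_h ((K h)%:E * \int[mu]_x (v x)%:E))%E.
  by apply: eq_integral => h _; rewrite ih.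
rewrite ge0_integralZr ?integral_ge0 //.
- by case: K_density => _ _ ->; rewrite mul1e.
- exact/measurable_EFinP.
- by move=> h _; rewrite lee_fin.
- by move=> h _; rewrite lee_fin.
Qed.

End ConvolutionOperator.

Let K_sum : summable_fun K := K_summable.

(** * Pairings of translates *)

Section Pairing.

Lemma Re_le_nrm (z : R[i]) : `|complex.Re z| <= nrm z.
Proof.
rewrite -(@ler_pXn2r _ 2%N) ?nnegrE ?nrm_ge0 // sqr_nrm real_normK ?num_real //.
by rewrite lerDl sqr_ge0.
Qed.

Lemma Im_le_nrm (z : R[i]) : `|complex.Im z| <= nrm z.
Proof.
rewrite -(@ler_pXn2r _ 2%N) ?nnegrE ?nrm_ge0 // sqr_nrm real_normK ?num_real //.
by rewrite lerDr sqr_ge0.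
Qed.

Lemma borel_nrm (f : G -> R[i]) : borelC f -> borel_fun (fun x => nrm (f x)).
Proof.
move=> [mr mi].
have -> : (fun x => nrm (f x)) =
    (fun x => Num.sqrt (complex.Re (f x) ^+ 2 + complex.Im (f x) ^+ 2)).
  by apply/funext => x; case: (f x).
apply: measurableT_comp; first by apply: continuous_measurable_fun; exact: sqrt_continuous.
by apply: measurable_funD; exact: measurable_funX.
Qed.

Lemma borelC_lmul (f : G -> R[i]) g : borelC f -> borelC (fun x => f (g * x)%g).
Proof. by move=> [mr mi]; split; [exact: (borel_fun_lmul _ mr)|exact: (borel_fun_lmul _ mi)]. Qed.

Lemma borel_dot (f k : G -> R[i]) : borelC f -> borelC k -> borel_fun (fun x => dot (f x) (k x)).
Proof. by move=> [fr fi] [kr ki]; apply: measurable_funD; exact: measurable_funM. Qed.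

Lemma dominated_summable (w u : G -> R) : weight w -> borel_fun u ->
  (forall x, `|u x| <= w x) -> summable_fun u.
Proof.
move=> wt mu' uw; apply: (le_integrable measurableT _ _ (weight_summable wt)).
  exact/measurable_EFinP.
move=> x _; rewrite !abse_EFin lee_fin (le_trans (uw x)) //.
exact: ler_norm.
Qed.

Lemma summableZl c (u : G -> R) : summable_fun u -> summable_fun (fun x => c * u x).
Proof. by move=> iu; under eq_fun do rewrite EFinM; exact: integrableZl. Qed.

Lemma summableZr c (u : G -> R) : summable_fun u -> summable_fun (fun x => u x * c).
Proof. by move=> iu; under eq_fun do rewrite mulrC; exact: summableZl. Qed.

Lemma summableD (u v : G -> R) : summable_fun u -> summable_fun v ->
  summable_fun (fun x => u x + v x).
Proof. by move=> iu iv; under eq_fun do rewrite EFinD; exact: integrableD. Qed.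

Lemma summableB (u v : G -> R) : summable_fun u -> summable_fun v ->
  summable_fun (fun x => u x - v x).
Proof. by move=> iu iv; under eq_fun do rewrite EFinB; exact: integrableB. Qed.

Lemma ae_summable (u v : G -> R) Z : summable_fun u -> borel_fun v -> null Z ->
  (forall x, ~ Z x -> u x = v x) -> summable_fun v.
Proof.
move=> /integrableP[mu' fu] mv nZ e; apply/integrableP; split; first exact/measurable_EFinP.
apply: le_lt_trans fu; rewrite le_eqVlt; apply/orP; left; apply/eqP.
apply: ae_eq_integral => //.
- by apply: measurableT_comp => //; exact/measurable_EFinP.
- exact: measurableT_comp.
- by apply: ae_null nZ _ => x nx _; rewrite /= e.
Qed.

Lemma weightD w1 w2 : weight w1 -> weight w2 -> weight (fun x => w1 x + w2 x).
Proof.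
move=> [m1 p1 f1] [m2 p2 f2]; split; [exact: measurable_funD|by move=> x; rewrite addr_ge0|].
under eq_integral do rewrite EFinD.
rewrite ge0_integralD //; [exact: lte_add_pinfty|..];
  by [exact/measurable_EFinP|move=> x _; rewrite lee_fin].
Qed.

Lemma weightZ c w : 0 <= c -> weight w -> weight (fun x => c * w x).
Proof.
move=> c0 [m p f]; split; [exact: measurable_funM|by move=> x; rewrite mulr_ge0|].
under eq_integral do rewrite EFinM.
rewrite ge0_integralZl //; [by rewrite lte_mul_pinfty ?lee_fin|..];
  by [exact/measurable_EFinP|move=> x _; rewrite lee_fin].
Qed.

Lemma weight_lmul w g : weight w -> weight (fun x => w (g * x)%g).
Proof.
move=> [m p f]; split; [exact: borel_fun_lmul|by []|].
rewrite (integral_lmul haar g (f := fun x => (w x)%:E)) //.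
exact/measurable_EFinP.
Qed.

Lemma weight_le w u : weight w -> borel_fun u -> (forall x, 0 <= u x <= w x) -> weight u.
Proof.
move=> [m p f] mu' uw; split=> // [x|]; first by case/andP: (uw x).
apply: le_lt_trans f; apply: ge0_le_integral => //.
- by move=> x _; rewrite lee_fin; case/andP: (uw x).
- exact/measurable_EFinP.
- exact/measurable_EFinP.
- by move=> x _; rewrite lee_fin; case/andP: (uw x).
Qed.

Lemma Rintegral_lmul_weight w g : weight w -> \int[mu]_x w (g * x)%g = \int[mu]_x w x.
Proof. by move=> [m p f]; rewrite Rintegral_lmul. Qed.

Lemma conv_opE (f : G -> R[i]) : conv_op mu K f =
  (fun g => Complex (TK (fun x => complex.Re (f x)) g) (TK (fun x => complex.Im (f x)) g)).
Proof.
apply/funext => g; rewrite /conv_op /conv /integralC; congr Complex.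
  by apply: eq_Rintegral => h _ /=; case: (f _) => a b /=; rewrite mul0r subr0.
by apply: eq_Rintegral => h _ /=; case: (f _) => a b /=; rewrite mul0r addr0.
Qed.

Definition tameC (f : G -> R[i]) :=
  borelC f /\ exists2 w, weight w & forall x, nrm (f x) <= 1 + w x.

Lemma tame_Re f : tameC f -> tame (fun x => complex.Re (f x)).
Proof.
move=> [[m1 m2] [w ww wf]]; split=> //; exists w => // x.
exact: le_trans (Re_le_nrm _) (wf x).
Qed.

Lemma tame_Im f : tameC f -> tame (fun x => complex.Im (f x)).
Proof.
move=> [[m1 m2] [w ww wf]]; split=> //; exists w => // x.
exact: le_trans (Im_le_nrm _) (wf x).
Qed.

(** The bound separates the variables, so [w1 (h^-1 x) + w2 x] dominates the pairing of every
    translate and has an integral independent of [h]. For conjugate exponents it is Young's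
    inequality. *)
Definition paired (f k : G -> R[i]) := [/\ tameC f, borelC k &
  exists w1 w2, [/\ weight w1, weight w2 &
    forall x y, nrm (f x) * nrm (k y) <= w1 x + w2 y]].

Definition pairing (f k : G -> R[i]) (h : G) : R := \int[mu]_x dot (f (h^-1 * x)%g) (k x).

Lemma pairing_summable f k h : paired f k -> summable_fun (fun x => dot (f (h^-1 * x)%g) (k x)).
Proof.
move=> [[mf _] mk [w1 [w2 [ww1 ww2 fk]]]].
apply: (dominated_summable (weightD (weight_lmul h^-1%g ww1) ww2)).
  by apply: borel_dot => //; exact: borelC_lmul.
by move=> x; exact: le_trans (dot_le _ _) (fk _ _).
Qed.

Lemma pairing_bound f k : paired f k -> exists2 B, 0 <= B & forall h,
  `|pairing f k h| <= B /\ (\int[mu]_x `|dot (f (h^-1 * x)%g) (k x)|%:E <= B%:E)%E.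
Proof.
move=> pfk; have [[mf _] mk [w1 [w2 [ww1 ww2 fk]]]] := pfk.
exists (\int[mu]_x w1 x + \int[mu]_x w2 x).
  by case: ww1 ww2 => _ p1 _ [_ p2 _]; rewrite addr_ge0 // Rintegral_ge0.
move=> h; have ps := pairing_summable h pfk.
have b : \int[mu]_x `|dot (f (h^-1 * x)%g) (k x)| <= \int[mu]_x w1 x + \int[mu]_x w2 x.
  rewrite -(Rintegral_lmul_weight h^-1%g ww1) -RintegralD //; last 2 first.
  - exact: weight_summable (weight_lmul _ ww1).
  - exact: weight_summable ww2.
  apply: le_Rintegral => //.
  - exact: integrable_norm ps.
  - exact: weight_summable (weightD (weight_lmul h^-1%g ww1) ww2).
  - by move=> x _; exact: le_trans (dot_le _ _) (fk _ _).
split; first exact: le_trans (le_normr_Rintegral measurableT ps) b.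
rewrite -lee_fin in b; apply: le_trans b; rewrite le_eqVlt fineK ?eqxx //.
apply: integrable_fin_num => //; exact: integrable_norm ps.
Qed.

Lemma complex_modification f : borelC f -> exists f', [/\ nice_fun (fun x => complex.Re (f' x)),
  nice_fun (fun x => complex.Im (f' x)) & exists2 Z, null Z & forall x, ~ Z x -> f x = f' x].
Proof.
move=> [mr mi]; have [r nr [Z nZ hZ]] := nice_modification mr.
have [i ni [Y nY hY]] := nice_modification mi.
exists (fun x => Complex (r x) (i x)); split=> //; exists (Z `|` Y).
  case: nZ nY => mZ Z0 [mY Y0]; split; first exact: measurableU.
  have h : (mu (Z : set (borel G)) + mu (Y : set (borel G)) = 0)%E by rewrite Z0 Y0 adde0.
  apply/eqP; rewrite eq_le measure_ge0 andbT; apply: le_trans (measureU2 mu mZ mY) _.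
  by rewrite le_eqVlt; apply/orP; left; apply/eqP.
move=> x /not_orP[nz ny]; rewrite -(hZ x nz) -(hY x ny); by case: (f x).
Qed.

Lemma pairing_modification f f' k Z : borelC f -> borelC f' -> borelC k -> null Z ->
  (forall x, ~ Z x -> f x = f' x) -> pairing f k = pairing f' k.
Proof.
move=> mf mf' mk nZ e; apply/funext => h; congr fine; apply: ae_eq_integral => //.
- by apply/measurable_EFinP; apply: borel_dot => //; exact: borelC_lmul.
- by apply/measurable_EFinP; apply: borel_dot => //; exact: borelC_lmul.
- by apply: ae_null (null_ldivl h nZ) _ => x nx _; rewrite e.
Qed.

Lemma measurable_pairing_kernel (f k : G -> R[i]) : nice_fun (fun x => complex.Re (f x)) ->
  nice_fun (fun x => complex.Im (f x)) -> borelC k ->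
  measurable_fun [set: borel G * borel G] (fun p => dot (f (p.1^-1 * p.2)%g) (k p.2) : R).
Proof.
move=> [_ m1] [_ m2] [kr ki]; apply: measurable_funD; apply: measurable_funM.
- exact: m1.
- exact: (measurableT_comp kr measurable_snd).
- exact: m2.
- exact: (measurableT_comp ki measurable_snd).
Qed.

Lemma pairing_borel f k : paired f k -> borel_fun (pairing f k).
Proof.
move=> [[mf _] mk _]; have [f' [nr ni [Z nZ hZ]]] := complex_modification mf.
have mf' : borelC f' by split; [case: nr|case: ni].
rewrite (pairing_modification mf mf' mk nZ hZ).
exact: (measurable_Rintegral sf (measurable_pairing_kernel nr ni mk)).
Qed.

Lemma K_weighted_summable (phi : G -> R) B : borel_fun phi -> (forall g, `|phi g| <= B) ->
  summable_fun (fun h => K h * phi h).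
Proof.
move=> mphi hB; have B0 : 0 <= B by exact: le_trans (hB 1%g).
have wK : weight (fun h => B * K h).
  apply: weightZ => //; split=> //; case: K_density => _ _ ->; exact: ltry.
apply: (dominated_summable wK); first exact: measurable_funM.
by move=> x; rewrite normrM mulrC (ger0_norm (K0 _)) ler_wpM2r.
Qed.

Lemma dot_kernelE f v x h : K h * dot (f (h^-1 * x)%g) v =
  K h * complex.Re (f (h^-1 * x)%g) * complex.Re v + K h * complex.Im (f (h^-1 * x)%g) * complex.Im v.
Proof. by rewrite /dot mulrDr !mulrA. Qed.

Lemma tame_kernel_summable u x : tame u -> summable_fun (fun h => K h * u (h^-1 * x)%g).
Proof. exact: (tame_summable). Qed.

Lemma conv_dot_summable f x v : tameC f ->
  summable_fun (fun h => K h * dot (f (h^-1 * x)%g) v).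
Proof.
move=> tf; under eq_fun do rewrite dot_kernelE EFinD.
have sr := tame_kernel_summable x (tame_Re tf); have si := tame_kernel_summable x (tame_Im tf).
by apply: integrableD => //; exact: summableZr.
Qed.

Lemma conv_dot f x v : tameC f ->
  dot (conv_op mu K f x) v = \int[mu]_h (K h * dot (f (h^-1 * x)%g) v).
Proof.
move=> tf; under eq_Rintegral do rewrite dot_kernelE.
have sr := tame_kernel_summable x (tame_Re tf); have si := tame_kernel_summable x (tame_Im tf).
rewrite RintegralD //; last 2 first.
- exact: summableZr.
- exact: summableZr.
by rewrite RintegralZr // RintegralZr // (conv_opE f).
Qed.

(** Fubini for [K h] times the translated pairing. Joint measurability is available only for the
    nice modification [f'] of [f]; each section is unchanged up to a null set, in [h] for fixed [x]
    and in [x] for fixed [h]. *)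
Lemma pairing_conv f k : paired f k ->
  \int[mu]_x dot (conv_op mu K f x) (k x) = \int[mu]_h (K h * pairing f k h).
Proof.
move=> pfk; have [tf mk _] := pfk; have mf := tf.1.
have [B B0 hB] := pairing_bound pfk.
have [f' [nr ni [Z nZ hZ]]] := complex_modification mf.
have mf' : borelC f' by split; [case: nr|case: ni].
have pE := pairing_modification mf mf' mk nZ hZ.
have mker := measurable_pairing_kernel nr ni mk.
pose k1 (p : borel G * borel G) := K p.1 * dot (f' (p.1^-1 * p.2)%g) (k p.2).
have mk1 : measurable_fun [set: borel G * borel G] (k1 : _ -> R).
  by apply: measurable_funM => //; exact: (measurableT_comp mK measurable_fst).
have sumx x := conv_dot_summable x (k x) tf.
have dotTE x := conv_dot x (k x) tf.
have nh x := null_ldiv x nZ.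
have mfx x : borel_fun (fun h => K h * dot (f (h^-1 * x)%g) (k x)).
  by have /measurable_int/measurable_EFinP := sumx x.
have mfx' x : borel_fun (fun h => k1 (h, x)).
  exact: (measurableT_comp mk1 (measurable_pair2 x)).
have sumx' x : summable_fun (fun h => k1 (h, x)).
  by apply: (ae_summable (sumx x) _ (nh x)) => // h e; rewrite /k1 /= hZ.
have e1 x : dot (conv_op mu K f x) (k x) = \int[mu]_h k1 (h, x).
  rewrite dotTE; congr fine; apply: ae_eq_integral => //.
  - exact/measurable_EFinP.
  - exact/measurable_EFinP.
  - by apply: ae_null (nh x) _ => h e _; rewrite /k1 /= hZ.
have nx h := null_ldivl h nZ.
have mdf' h : borel_fun (fun x => dot (f' (h^-1 * x)%g) (k x)).
  by apply: borel_dot => //; exact: borelC_lmul.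
have mdf h : borel_fun (fun x => dot (f (h^-1 * x)%g) (k x)).
  by apply: borel_dot => //; exact: borelC_lmul.
have sumh h : summable_fun (fun x => dot (f' (h^-1 * x)%g) (k x)).
  by apply: (ae_summable (pairing_summable h pfk) _ (nx h)) => // x e; rewrite hZ.
have nrmE h : (\int[mu]_x `|k1 (h, x)|%:E <= (B * K h)%:E)%E.
  have -> : (\int[mu]_x `|k1 (h, x)|%:E =
      (K h)%:E * \int[mu]_x `|dot (f' (h^-1 * x)%g) (k x)|%:E)%E.
    rewrite -ge0_integralZl ?lee_fin //.
    - by apply: eq_integral => x _; rewrite /k1 normrM ger0_norm.
    - by apply/measurable_EFinP; exact: measurableT_comp (mdf' h).
  rewrite mulrC EFinM lee_wpmul2l ?lee_fin //.
  apply: le_trans (hB h).2; rewrite le_eqVlt; apply/orP; left; apply/eqP.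
  apply: ae_eq_integral => //.
  - by apply/measurable_EFinP; exact: measurableT_comp (mdf' h).
  - by apply/measurable_EFinP; exact: measurableT_comp (mdf h).
  - by apply: ae_null (nx h) _ => x e _; rewrite /= hZ.
transitivity (\int[mu]_x \int[mu]_h k1 (h, x)).
  by apply: eq_Rintegral => x _; exact: e1.
rewrite -(fubini_Rintegral sf sf mk1) //.
- apply: eq_Rintegral => h _; rewrite pE.
  exact: (RintegralZl (K h) measurableT (sumh h)).
- by move=> h; exact: (summableZl (K h) (sumh h)).
- apply: (@le_lt_trans _ _ (\int[mu]_h (B * K h)%:E)%E).
    apply: ge0_le_integral => //.
    + by move=> h _; apply: integral_ge0 => x _; rewrite lee_fin.
    + apply: (measurable_tonelli1 sf (f := fun p => `|k1 p|%:E)) => //.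
      by apply/measurable_EFinP; exact: measurableT_comp mk1.
    + by apply/measurable_EFinP; exact: measurable_funM.
  have [_ _ //] : weight (fun h => B * K h).
  by apply: weightZ => //; split=> //; case: K_density => _ _ ->; exact: ltry.
Qed.

End Pairing.

(** * L^p norms and contractivity of the convolution *)

Section LebesgueSpace.

Definition powint (p : R) (f : G -> R[i]) : R := \int[mu]_x nrm (f x) `^ p.
Definition Np (p : R) (f : G -> R[i]) : R := powint p f `^ p^-1.

Lemma borel_powR p (u : G -> R) : borel_fun u -> borel_fun (fun x => u x `^ p).
Proof. by move=> mu'; apply: (measurableT_comp (measurable_powR p)). Qed.

Lemma borel_nrm_powR p f : borelC f -> borel_fun (fun x => nrm (f x) `^ p).
Proof. by move=> mf; apply: borel_powR; exact: borel_nrm. Qed.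

Lemma powint_ge0 p f : 0 <= powint p f.
Proof. by apply: Rintegral_ge0 => x _; exact: powR_ge0. Qed.

Lemma Np_ge0 p f : 0 <= Np p f.
Proof. exact: powR_ge0. Qed.

Lemma LpP p f : 0 < p -> Lp mu p f <-> borelC f /\ weight (fun x => nrm (f x) `^ p).
Proof.
move=> p0; rewrite /Lp /= /normLp unlock /=.
have e : (\int[mu]_x (`| ((EFin \o (@Normc.normc R \o f)) x) |%E `^ p)%E =
    \int[mu]_x (nrm (f x) `^ p)%:E)%E.
  by apply: eq_integral => x _ /=; rewrite ger0_norm ?nrm_ge0.
split=> -[mf h]; (split; first exact: mf).
  split; [exact: borel_nrm_powR|by move=> x; exact: powR_ge0|].
  rewrite e in h; apply: lty_poweRy h; by rewrite invr_neq0 // gt_eqF.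
by case: h => _ _ h; rewrite e poweR_lty.
Qed.

Lemma normLpE p f : 0 < p -> Lp mu p f -> normLp mu p f = (Np p f)%:E.
Proof.
move=> p0 /(LpP f p0)[mf w]; rewrite /normLp unlock /= /Np -poweR_EFin; congr (_ `^ _)%E.
rewrite fineK; last exact: integrable_fin_num (weight_summable w).
by apply: eq_integral => x _ /=; rewrite ger0_norm ?nrm_ge0.
Qed.

Lemma Lp_tameC p f : 1 <= p -> Lp mu p f -> tameC f.
Proof.
move=> p1 /(LpP f (lt_le_trans ltr01 p1))[mf w]; split=> //; exists (fun x => nrm (f x) `^ p) => // x.
have [h|h] := leP 1 (nrm (f x)); last by rewrite (le_trans (ltW h)) // lerDl powR_ge0.
by rewrite (le_trans (le1r_powR h p1)) // lerDr.
Qed.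

Lemma Lp_paired p q f k : 1 <= p -> 0 < q -> p^-1 + q^-1 = 1 -> Lp mu p f -> Lp mu q k ->
  paired f k.
Proof.
move=> p1 q0 pq Lf Lk; have p0 := lt_le_trans ltr01 p1.
have [mk wk] := (LpP k q0).1 Lk; have [mf wf] := (LpP f p0).1 Lf.
split; [exact: Lp_tameC Lf|by []|].
exists (fun x => p^-1 * nrm (f x) `^ p), (fun x => q^-1 * nrm (k x) `^ q); split.
- by apply: weightZ wf; rewrite invr_ge0 ltW.
- by apply: weightZ wk; rewrite invr_ge0 ltW.
- move=> x y; rewrite mulrC [q^-1 * _]mulrC.
  have := conjugate_powR (nrm_ge0 (k y)) (nrm_ge0 (f x)) q0 p0.
  by rewrite addrC => /(_ pq); rewrite addrC [p^-1 * _]mulrC.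
Qed.

Lemma powR_addle (x y p : R) : 0 <= x -> 0 <= y -> 0 <= p ->
  (x + y) `^ p <= 2 `^ p * (x `^ p + y `^ p).
Proof.
move=> x0 y0 p0; wlog xy : x y x0 y0 / x <= y.
  by move=> h; have [/h|/ltW/h] := leP x y; [exact|rewrite addrC [_ + y `^ _]addrC; exact].
apply: (@le_trans _ _ ((2 * y) `^ p)).
  by apply: ge0_ler_powR => //; rewrite ?nnegrE; lra.
by rewrite powRM // ler_wpM2l ?powR_ge0 // lerDr powR_ge0.
Qed.

Lemma borelCD f g : borelC f -> borelC g -> borelC (f \+ g).
Proof.
move=> [fr fi] [gr gi]; split.
  rewrite (_ : (fun _ => _) = (fun x => complex.Re (f x) + complex.Re (g x))).
    exact: measurable_funD.
  by apply/funext => x /=; case: (f x) (g x) => ? ? [].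
rewrite (_ : (fun _ => _) = (fun x => complex.Im (f x) + complex.Im (g x))).
  exact: measurable_funD.
by apply/funext => x /=; case: (f x) (g x) => ? ? [].
Qed.

Lemma borelCM f g : borelC f -> borelC g -> borelC (f \* g).
Proof.
move=> [fr fi] [gr gi]; split.
  rewrite (_ : (fun _ => _) = (fun x => complex.Re (f x) * complex.Re (g x) -
      complex.Im (f x) * complex.Im (g x))).
    by apply: measurable_funB; exact: measurable_funM.
  by apply/funext => x /=; case: (f x) (g x) => ? ? [].
rewrite (_ : (fun _ => _) = (fun x => complex.Re (f x) * complex.Im (g x) +
    complex.Im (f x) * complex.Re (g x))).
  by apply: measurable_funD; exact: measurable_funM.
by apply/funext => x /=; case: (f x) (g x) => ? ? [].
Qed.

Lemma borelC_real (u : G -> R) : borel_fun u -> borelC (fun x => (u x)%:C%C).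
Proof. by move=> mu'; split=> //; exact: measurable_cst. Qed.

Lemma borelC_cst (a : R[i]) : borelC (fun=> a).
Proof. by split; exact: measurable_cst. Qed.

Lemma borelC_psi s f : borelC f -> borelC (fun x => psi s (f x)).
Proof.
move=> mf; apply: (@borelCM (fun x => (nrm (f x) `^ (s - 1))%:C%C) f) => //.
by apply: borelC_real; exact: borel_nrm_powR.
Qed.

Lemma Lp_psi p s f : 0 < p -> 0 < s -> Lp mu p f -> Lp mu (p / s) (fun x => psi s (f x)).
Proof.
move=> p0 s0 /(LpP f p0)[mf w]; apply/LpP; first exact: divr_gt0.
split; first exact: borelC_psi.
rewrite (_ : (fun x => _) = (fun x => nrm (f x) `^ p)) //; apply/funext => x.
by rewrite nrm_psi // -powRrM mulrC divfK ?gt_eqF.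
Qed.

Lemma LpD p f g : 0 < p -> Lp mu p f -> Lp mu p g -> Lp mu p (f \+ g).
Proof.
move=> p0 /(LpP f p0)[mf wf] /(LpP g p0)[mg wg]; apply/(LpP _ p0).
have m := borelCD mf mg; split; first exact: m.
apply: (weight_le (weightZ (powR_ge0 2 p) (weightD wf wg))).
  exact: borel_nrm_powR.
move=> x; rewrite powR_ge0 /=; apply: le_trans (powR_addle _ _ (ltW p0)); rewrite ?nrm_ge0 //.
by apply: ge0_ler_powR; rewrite ?nnegrE ?addr_ge0 ?nrm_ge0 ?nrmD // ltW.
Qed.

Lemma LpZ p a f : 0 < p -> Lp mu p f -> Lp mu p (fun x => a * f x).
Proof.
move=> p0 /(LpP f p0)[mf wf]; apply/(LpP _ p0); split.
  exact: (borelCM (borelC_cst a) mf).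
rewrite (_ : (fun x => _) = (fun x => nrm a `^ p * nrm (f x) `^ p)).
  by apply: weightZ => //; exact: powR_ge0.
by apply/funext => x; rewrite nrmM powRM ?nrm_ge0.
Qed.

Lemma powintZ p a f : 0 < p -> Lp mu p f -> powint p (fun x => a * f x) = nrm a `^ p * powint p f.
Proof.
move=> p0 /(LpP f p0)[mf wf]; rewrite /powint -RintegralZl //; last exact: weight_summable wf.
by apply: eq_Rintegral => x _; rewrite nrmM powRM ?nrm_ge0.
Qed.

Lemma NpZ p a f : 0 < p -> Lp mu p f -> Np p (fun x => a * f x) = nrm a * Np p f.
Proof.
move=> p0 Lf; rewrite /Np powintZ // powRM ?powR_ge0 ?powint_ge0 //.
by rewrite -powRrM mulfV ?gt_eqF // powRr1 // nrm_ge0.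
Qed.

Lemma NpD p f g : 1 <= p -> Lp mu p f -> Lp mu p g -> Np p (f \+ g) <= Np p f + Np p g.
Proof.
move=> p1 Lf Lg; have p0 := lt_le_trans ltr01 p1; have Lfg := LpD p0 Lf Lg.
have [mf wf] := (LpP f p0).1 Lf; have [mg wg] := (LpP g p0).1 Lg.
suff : (normLp mu p (f \+ g)%R <= normLp mu p f + normLp mu p g)%E.
  by rewrite (normLpE p0 Lfg) (normLpE p0 Lf) (normLpE p0 Lg) -EFinD lee_fin.
have mnf := borel_nrm mf; have mng := borel_nrm mg.
have := @minkowski_EFin _ _ _ mu _ _ p mnf mng p1.
apply: le_trans; rewrite /normLp unlock /=.
apply: gt0_ler_poweR; first by rewrite invr_ge0 ltW.
- by rewrite in_itv /= leey andbT integral_ge0 // => x _; rewrite poweR_ge0.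
- by rewrite in_itv /= leey andbT integral_ge0 // => x _; rewrite poweR_ge0.
apply: ge0_le_integral => //.
- rewrite (_ : (fun x => _) = (fun x => (nrm ((f \+ g)%R x) `^ p)%:E)).
    by apply/measurable_EFinP; exact: borel_nrm_powR (borelCD mf mg).
  by apply/funext => x /=; rewrite ger0_norm ?nrm_ge0.
- rewrite (_ : (fun x => _) = (fun x => ((nrm (f x) + nrm (g x))%R `^ p)%:E)).
    by apply/measurable_EFinP; apply: borel_powR; exact: measurable_funD.
  by apply/funext => x /=; rewrite ger0_norm ?addr_ge0 ?nrm_ge0.
- move=> x _ /=; rewrite lee_fin !ger0_norm ?addr_ge0 ?nrm_ge0 //.
  by apply: ge0_ler_powR; rewrite ?nnegrE ?addr_ge0 ?nrm_ge0 ?nrmD // ltW.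
Qed.

Lemma borelC_conv f : borelC f -> borelC (conv_op mu K f).
Proof.
move=> [mr mi]; rewrite conv_opE; split.
  exact: (TK_borel mr).
exact: (TK_borel mi).
Qed.

(* With [a] the value of [conv_op mu K f] at [g], Young's inequality gives
   [|a|^p = Re (a conj J(a)) = int K(h) Re (f(h^-1 g) conj J(a)) dh
    <= 1/p int K(h) |f(h^-1 g)|^p dh + (1 - 1/p) |a|^p]. *)
Lemma conv_jensen p f g : 1 < p -> Lp mu p f ->
  ((nrm (conv_op mu K f g) `^ p)%:E <= \int[mu]_h (K h * nrm (f (h^-1 * g)%g) `^ p)%:E)%E.
Proof.
move=> p1 Lf; have p0 := lt_trans ltr01 p1; have [mf [mw w0 wf]] := (LpP f p0).1 Lf.
have tf := Lp_tameC (ltW p1) Lf.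
have mi : borel_fun (fun h => K h * nrm (f (h^-1 * g)%g) `^ p).
  by apply: measurable_funM => //; exact: (borel_fun_ldiv g mw).
have i0 h : 0 <= K h * nrm (f (h^-1 * g)%g) `^ p by rewrite mulr_ge0 ?powR_ge0.
have [fin|] := ltP (\int[mu]_h (K h * nrm (f (h^-1 * g)%g) `^ p)%:E)%E +oo%E; last first.
  by rewrite leye_eq => /eqP ->; exact: leey.
have wi : weight (fun h => K h * nrm (f (h^-1 * g)%g) `^ p) by split.
have si := weight_summable wi.
rewrite -(fineK (integrable_fin_num measurableT si)) lee_fin.
set a := conv_op mu K f g; set I := fine _.
have q1 : p^-1 < 1 by rewrite invf_lt1.
have h1 : nrm a `^ p = dot a (psi (p - 1) a).
  have p10 : 0 < p - 1 by rewrite subr_gt0.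
  rewrite /psi dotZr dotE -(mulr_powRB1 (nrm_ge0 a) p0) -(mulr_powRB1 (nrm_ge0 a) p10).
  by rewrite expr2 mulrA mulrC.
have h2 : dot a (psi (p - 1) a) <= p^-1 * I + (1 - p^-1) * nrm a `^ p.
  have -> : p^-1 * I + (1 - p^-1) * nrm a `^ p = \int[mu]_h
      (p^-1 * (K h * nrm (f (h^-1 * g)%g) `^ p) + K h * ((1 - p^-1) * nrm a `^ p)).
    rewrite RintegralD //; [|exact: summableZl|exact: summableZr].
    by rewrite RintegralZl // RintegralZr // K_integral mul1r.
  rewrite (conv_dot g _ tf).
  apply: le_Rintegral => //.
  - exact: (conv_dot_summable g _ tf).
  - by apply: summableD; [exact: summableZl|apply: summableZr; exact: K_sum].
  move=> h _; rewrite mulrCA -mulrDr ler_wpM2l //.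
  apply: le_trans (ler_norm _) _; apply: le_trans (dot_le _ _) _.
  rewrite nrm_psi ?subr_gt0 //.
  have q0 : 0 < p / (p - 1) by rewrite divr_gt0 ?subr_gt0.
  have := conjugate_powR (nrm_ge0 (f (h^-1 * g)%g)) (powR_ge0 (nrm a) (p - 1)) p0 q0.
  have -> : p^-1 + (p / (p - 1))^-1 = 1 by rewrite invf_div; field; rewrite gt_eqF.
  rewrite -powRrM mulrC [(p - 1) * _]mulrC divfK ?gt_eqF ?subr_gt0 // => /(_ erefl).
  rewrite mulrC [X in _ <= X + _]mulrC [nrm a `^ p / _]mulrC.
  by rewrite (_ : (p / (p - 1))^-1 = 1 - p^-1) // invf_div; field; rewrite gt_eqF.
move: h2; rewrite -h1; move: (nrm a `^ p) => t.
rewrite mulrBl mul1r => h; have : p^-1 * t <= p^-1 * I by lra.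
by rewrite ler_pM2l // invr_gt0.
Qed.

Lemma Lp_conv p f : 1 < p -> Lp mu p f -> Lp mu p (conv_op mu K f) /\
  powint p (conv_op mu K f) <= powint p f.
Proof.
move=> p1 Lf; have p0 := lt_trans ltr01 p1; have [mf ww] := (LpP f p0).1 Lf.
have [mw w0 wf] := ww; have mT := borelC_conv mf; have mTp := borel_nrm_powR p mT.
have [mI eI] := K_tonelli mw w0.
have le : (\int[mu]_x (nrm (conv_op mu K f x) `^ p)%:E <= \int[mu]_x (nrm (f x) `^ p)%:E)%E.
  rewrite -eI; apply: ge0_le_integral => //.
  - by move=> x _; rewrite lee_fin powR_ge0.
  - exact/measurable_EFinP.
  - by move=> x _; exact: conv_jensen.
have wT : weight (fun x => nrm (conv_op mu K f x) `^ p).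
  by split; [exact: mTp|move=> x; exact: powR_ge0|exact: le_lt_trans wf].
split; first exact/LpP.
apply: fine_le => //; [exact: integrable_fin_num (weight_summable wT)|].
exact: integrable_fin_num (weight_summable ww).
Qed.

Lemma Np_conv p f : 1 < p -> Lp mu p f -> Np p (conv_op mu K f) <= Np p f.
Proof.
move=> p1 Lf; have p0 := lt_trans ltr01 p1; apply: ge0_ler_powR.
- by rewrite invr_ge0 ltW.
- by rewrite nnegrE powint_ge0.
- by rewrite nnegrE powint_ge0.
- exact: (Lp_conv p1 Lf).2.
Qed.

Lemma TK_linear a b u v : tame u -> tame v ->
  TK (fun x => a * u x + b * v x) = (fun g => a * TK u g + b * TK v g).
Proof.
move=> tu tv; apply/funext => g.
have su := tame_kernel_summable g tu.
have sv := tame_kernel_summable g tv.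
rewrite /TK -!RintegralZl // -RintegralD //; try exact: summableZl.
by apply: eq_Rintegral => h _; ring.
Qed.

Lemma conv_opD f g : tameC f -> tameC g ->
  conv_op mu K (f \+ g) = conv_op mu K f \+ conv_op mu K g.
Proof.
move=> tf tg; rewrite !conv_opE; apply/funext => x /=.
have := TK_linear 1 1 (tame_Re tf) (tame_Re tg).
have := TK_linear 1 1 (tame_Im tf) (tame_Im tg).
under eq_fun do rewrite !mul1r; move=> ei.
under eq_fun do rewrite !mul1r; move=> er.
congr Complex.
  transitivity (TK (fun x => complex.Re (f x) + complex.Re (g x)) x).
    by congr TK; apply/funext => y; case: (f y) (g y) => ? ? [].
  by rewrite er /= !mul1r.
transitivity (TK (fun x => complex.Im (f x) + complex.Im (g x)) x).
  by congr TK; apply/funext => y; case: (f y) (g y) => ? ? [].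
by rewrite ei /= !mul1r.
Qed.

Lemma conv_opZ a f : tameC f ->
  conv_op mu K (fun x => a * f x) = (fun x => a * conv_op mu K f x).
Proof.
move=> tf; rewrite !conv_opE; apply/funext => x /=; case: a => s t.
have er := TK_linear s (- t) (tame_Re tf) (tame_Im tf).
have ei := TK_linear s t (tame_Im tf) (tame_Re tf).
have -> : (fun x => complex.Re (Complex s t * f x)) =
    (fun x => s * complex.Re (f x) + - t * complex.Im (f x)).
  by apply/funext => y; case: (f y) => ? ? /=; rewrite mulNr.
have -> : (fun x => complex.Im (Complex s t * f x)) =
    (fun x => s * complex.Im (f x) + t * complex.Re (f x)).
  by apply/funext => y; case: (f y).
by rewrite er ei /= mulNr.
Qed.

End LebesgueSpace.

Variable D : splitting R G.
Hypothesis K_centered : centered mu D K.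

(** * Averages of increments against the density *)

Section MeanDefect.

Lemma continuous_summable (l : G -> R) : continuous l -> summable_fun (fun g => K g * l g).
Proof.
move=> lc; have [b hb] := continuous_bounded lc K_supp.
have wK : weight (fun h => `|b| * K h).
  by apply: weightZ => //; split=> //; case: K_density => _ _ ->; exact: ltry.
apply: (dominated_summable wK) => [|x].
  by apply: measurable_funM => //; exact: continuous_borelR.
have [Cx|nCx] := pselect (closure [set g | K g != 0] x).
  rewrite normrM mulrC (ger0_norm (K0 _)) ler_wpM2r //.
  exact: le_trans (hb x Cx) (ler_norm _).
by rewrite (K_supportE nCx) mul0r normr0 mulr0.
Qed.

Lemma Rintegral_sum (I : Type) (r : seq I) (u : I -> G -> R) :
  (forall i, summable_fun (u i)) ->
  summable_fun (fun x => \sum_(i <- r) u i x) /\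
  \int[mu]_x (\sum_(i <- r) u i x) = \sum_(i <- r) \int[mu]_x u i x.
Proof.
move=> su; elim: r => [|i r [s IH]].
  split.
    by under eq_fun do rewrite big_nil; exact: integrable0.
  by under eq_Rintegral do rewrite big_nil; rewrite big_nil Rintegral_cst // mul0r.
split.
  by under eq_fun do rewrite big_cons; exact: summableD.
transitivity (\int[mu]_x (u i x + \sum_(j <- r) u j x)).
  by apply: eq_Rintegral => x _; rewrite big_cons.
by rewrite big_cons -IH; exact: (RintegralD measurableT (su i) s).
Qed.

Lemma mean_lin a b : \int[mu]_g (K g * lin (D := D) a b g) = 0.
Proof.
case: K_centered => c1 c2.
have s1 i : summable_fun (fun g => a i * (K g * rcoord (D := D) i g)).
  by apply: summableZl; apply: continuous_summable; exact: rcoord_continuous.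
have s2 j : summable_fun (fun g => b j * (K g * (zcoord (D := D) j g)%:~R)).
  by apply: summableZl; apply: continuous_summable; exact: zcoordR_continuous.
have [t1 e1] := Rintegral_sum (index_enum 'I_(split_q D)) s1.
have [t2 e2] := Rintegral_sum (index_enum 'I_(split_r D)) s2.
transitivity (\int[mu]_g (\sum_i a i * (K g * rcoord (D := D) i g) +
    \sum_j b j * (K g * (zcoord (D := D) j g)%:~R))).
  apply: eq_Rintegral => g _; rewrite /lin mulrDr !mulr_sumr.
  by congr (_ + _); apply: eq_bigr => i _; rewrite mulrCA.
rewrite RintegralD // e1 e2 !big1 ?addr0 // => i _; rewrite RintegralZl //.
- by rewrite /zcoord c2 mulr0.
- by apply: continuous_summable; exact: zcoordR_continuous.
- by rewrite /rcoord c1 mulr0.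
- by apply: continuous_summable; exact: rcoord_continuous.
Qed.

Lemma quasi_additive_mean (Phi : (G -> R) -> R -> Prop) : quasi_additive Phi ->
  (forall phi d, Phi phi d -> borel_fun phi /\ exists B, forall g, `|phi g| <= B) ->
  exists2 c, 0 <= c & forall phi d, Phi phi d -> `|\int[mu]_g (K g * phi g)| <= c * d.
Proof.
move=> qa mP; have lc : exists2 U : set G, open U /\ U 1%g & compact (closure U).
  by case: U_nbhd => oU U1 cU _ _; exists U => //; exact: compact_closure_gen.
have [c c0 hc] := quasi_additive_near_lin D lc qa K_supp.
exists c => // phi d Pd; have [a [b hab]] := hc _ _ Pd; have [mphi [B hB]] := mP _ _ Pd.
have sphi := K_weighted_summable mphi hB.
have slin : summable_fun (fun g => K g * lin (D := D) a b g).
  by apply: continuous_summable; exact: lin_continuous.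
have -> : \int[mu]_g (K g * phi g) = \int[mu]_g (K g * phi g - K g * lin (D := D) a b g).
  by rewrite RintegralB // mean_lin subr0.
apply: le_trans (le_normr_Rintegral measurableT (summableB sphi slin)) _.
rewrite -[c * d]mul1r -K_integral -RintegralZr //.
apply: le_Rintegral => //.
- exact: integrable_norm (summableB sphi slin).
- exact: summableZr.
- move=> g _; rewrite -mulrBr normrM (ger0_norm (K0 g)).
  have [Cg|nCg] := pselect (closure [set g | K g != 0] g).
    by rewrite ler_wpM2l // hab.
  by rewrite (K_supportE nCg) !mul0r.
Qed.

Definition increment (f k : G -> R[i]) h := pairing f k h - pairing f k 1%g.

Lemma pairing1 f k : pairing f k 1%g = \int[mu]_x dot (f x) (k x).
Proof. by apply: eq_Rintegral => x _; rewrite invg1 mul1g. Qed.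

Lemma increment_borel f k : paired f k ->
  borel_fun (increment f k) /\ exists B, forall g, `|increment f k g| <= B.
Proof.
move=> pfk; split.
  by apply: measurable_funB; [exact: pairing_borel|exact: measurable_cst].
have [B B0 hB] := pairing_bound pfk; exists (B + B) => g.
by apply: le_trans (ler_normB _ _) _; apply: lerD; [case: (hB g)|case: (hB 1%g)].
Qed.

Lemma mean_increment f k : paired f k ->
  \int[mu]_h (K h * increment f k h) =
  \int[mu]_x dot (conv_op mu K f x) (k x) - \int[mu]_x dot (f x) (k x).
Proof.
move=> pfk; have [B B0 hB] := pairing_bound pfk.
have sp := K_weighted_summable (pairing_borel pfk) (fun g => (hB g).1).
rewrite pairing_conv // -pairing1 -[X in _ = _ - X]mul1r -K_integral.
rewrite -RintegralZr // -RintegralB //; last exact: summableZr.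
by apply: eq_Rintegral => h _; rewrite mulrBr.
Qed.

Lemma pairingM f k g h : paired f k ->
  pairing f k (g * h)%g = \int[mu]_x dot (f (h^-1 * x)%g) (k (g * x)%g) /\
  summable_fun (fun x => dot (f (h^-1 * x)%g) (k (g * x)%g)).
Proof.
move=> pfk; have [[mf _] mk _] := pfk.
have e x : dot (f (h^-1 * x)%g) (k (g * x)%g) =
    (fun y => dot (f ((g * h)^-1 * y)%g) (k y)) (g * x)%g.
  by rewrite /= invgM -mulgA mulKg.
split.
  have ml : borel_fun (fun y => dot (f ((g * h)^-1 * y)%g) (k y)).
    by apply: borel_dot => //; exact: borelC_lmul.
  rewrite /pairing -(Rintegral_lmul g ml).
  by apply: eq_Rintegral => x _; rewrite e.
under eq_fun do rewrite e.
exact: (integrable_lmul g (pairing_summable (g * h)%g pfk)).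
Qed.

(** Left invariance moves the translation by [g] onto the second function; the four resulting terms
    are the expansion of a product of two differences, so the defect is of second order. *)
Lemma increment_defect f k g h : paired f k ->
  increment f k (g * h)%g - increment f k g - increment f k h =
  \int[mu]_x dot (f (h^-1 * x)%g - f x) (k (g * x)%g - k x) /\
  summable_fun (fun x => dot (f (h^-1 * x)%g - f x) (k (g * x)%g - k x)).
Proof.
move=> pfk; have [e1 s1] := pairingM g h pfk.
have [e2] := pairingM g 1%g pfk; have [e3] := pairingM 1%g h pfk.
have [e4] := pairingM 1%g 1%g pfk; rewrite !mulg1 mul1g in e2 e3 e4 *.
have eq x : dot (f (h^-1 * x)%g - f x) (k (g * x)%g - k x) =
    dot (f (h^-1 * x)%g) (k (g * x)%g) - dot (f (1^-1 * x)%g) (k (g * x)%g)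
    - (dot (f (h^-1 * x)%g) (k (1 * x)%g) - dot (f (1^-1 * x)%g) (k (1 * x)%g)).
  by rewrite invg1 !mul1g dotBl !dotBr; ring.
move=> s4 s3 s2; split; last first.
  by under eq_fun do rewrite eq; apply: summableB; exact: summableB.
under eq_Rintegral do rewrite eq.
rewrite RintegralB //; [|exact: summableB|exact: summableB].
by rewrite !RintegralB // /increment e1 e2 e3 e4; ring.
Qed.

End MeanDefect.

(** * Square distances of translates *)

Section SquareFunctions.

Lemma hoelder_dot p q u k : 1 <= p -> 0 < q -> p^-1 + q^-1 = 1 -> Lp mu p u -> Lp mu q k ->
  summable_fun (fun x => dot (u x) (k x)) /\
  `|\int[mu]_x dot (u x) (k x)| <= Np p u * Np q k.
Proof.
move=> p1 q0 pq Lu Lk; have p0 := lt_le_trans ltr01 p1.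
have [mu' wu] := (LpP u p0).1 Lu; have [mk wk] := (LpP k q0).1 Lk.
have puk := Lp_paired p1 q0 pq Lu Lk.
have s : summable_fun (fun x => dot (u x) (k x)).
  have := pairing_summable 1%g puk.
  by under eq_fun do rewrite invg1 mul1g.
split=> //; have := @hoelder _ _ _ mu _ _ p q (borel_nrm mu') (borel_nrm mk) p0 q0 pq.
have -> : ('N[mu]_p%:E[EFin \o (fun x => nrm (u x))] = (Np p u)%:E)%E by exact: normLpE.
have -> : ('N[mu]_q%:E[EFin \o (fun x => nrm (k x))] = (Np q k)%:E)%E by exact: normLpE.
rewrite Lnorm1 -EFinM => h; rewrite -lee_fin; apply: le_trans h.
rewrite EFin_normr_Rintegral //; apply: le_trans (le_abse_integral _ _ _) _ => //.
  by case/integrableP: s.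
apply: ge0_le_integral => //.
- by apply: measurableT_comp => //; case/integrableP: s.
- apply/measurable_EFinP; apply: measurableT_comp => //.
  by apply: measurable_funM; exact: borel_nrm.
- move=> x _ /=; rewrite lee_fin [leRHS]ger0_norm ?mulr_ge0 ?nrm_ge0 //.
  exact: dot_le.
Qed.

Definition L2 (F : G -> R[i]) := borelC F /\ weight (fun x => nrm (F x) ^+ 2).

Lemma L2P F : Lp mu 2 F <-> L2 F.
Proof.
have e : (fun x => nrm (F x) `^ 2) = (fun x => nrm (F x) ^+ 2).
  by apply/funext => x; rewrite powR_mulrn ?nrm_ge0.
by rewrite (LpP F (ltr0n _ 2)) /L2 e.
Qed.

Lemma borelCB f g : borelC f -> borelC g -> borelC (fun x => f x - g x).
Proof.
move=> mf mg; have := borelCD mf (borelCM (borelC_cst (-1)) mg).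
by rewrite (_ : _ \+ _ = (fun x => f x - g x)) //; apply/funext => x /=; rewrite mulN1r.
Qed.

Lemma weight_sqr_dist F k : L2 F -> L2 k -> weight (fun x => nrm (F x - k x) ^+ 2).
Proof.
move=> [mF wF] [mk wk].
apply: (weight_le (weightD (weightZ (ler0n _ 2) wF) (weightZ (ler0n _ 2) wk))).
  by apply: measurable_funX; apply: borel_nrm; exact: borelCB.
move=> x; rewrite sqr_ge0 /=.
by have := sqr_nrm_dist (F x) 0 (k x); rewrite subr0 add0r nrmN.
Qed.

Lemma L2_lmul F g : L2 F -> L2 (fun x => F (g * x)%g).
Proof. by move=> [mF wF]; split; [exact: borelC_lmul|exact: (weight_lmul g wF)]. Qed.

Lemma L2_unit z F : nrm z = 1 -> L2 F -> L2 (fun x => z * F x).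
Proof.
move=> z1 [mF wF]; split; first exact: (borelCM (borelC_cst z) mF).
by under eq_fun do rewrite nrmM z1 mul1r.
Qed.

Definition sqdist (z : R[i]) (F : G -> R[i]) h := \int[mu]_x nrm (z * F (h^-1 * x)%g - F x) ^+ 2.

Lemma sqdist_weight z F h : nrm z = 1 -> L2 F ->
  weight (fun x => nrm (z * F (h^-1 * x)%g - F x) ^+ 2).
Proof. by move=> z1 LF; apply: weight_sqr_dist => //; apply: L2_unit => //; exact: L2_lmul. Qed.

Lemma sqdist_ge0 z F h : 0 <= sqdist z F h.
Proof. by apply: Rintegral_ge0 => x _; exact: sqr_ge0. Qed.

Lemma L2_paired F k : L2 F -> L2 k -> paired F k.
Proof.
move=> /L2P LF /L2P Lk; apply: (@Lp_paired 2 2) => //; first by rewrite ler1n.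
by field.
Qed.

(** Expanding the square reduces measurability and boundedness in [h] to those of [pairing]. *)
Lemma sqdistE z F h : nrm z = 1 -> L2 F ->
  sqdist z F h = 2 * \int[mu]_x nrm (F x) ^+ 2 - 2 * pairing (fun x => z * F x) F h.
Proof.
move=> z1 LF; have [mF wF] := LF; have [_ wl] := L2_lmul h^-1%g LF.
have sp := pairing_summable h (L2_paired (L2_unit z1 LF) LF).
have s1 := weight_summable wl; have s2 := weight_summable wF.
transitivity (\int[mu]_x (nrm (F (h^-1 * x)%g) ^+ 2 + nrm (F x) ^+ 2 -
    2 * dot (z * F (h^-1 * x)%g) (F x))).
  by apply: eq_Rintegral => x _; rewrite sqr_nrmB nrmM z1 mul1r.
rewrite RintegralB //; [|exact: summableD|exact: summableZl].
rewrite RintegralD // RintegralZl // (Rintegral_lmul_weight h^-1%g wF).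
by rewrite /pairing; ring.
Qed.

(* Subtracting from [z L_gh F - F] the left translate by [g] of [z L_h F - F]
   leaves [L_g F - F], whatever the unimodular [z]. *)
Lemma sqdist_split z F g h : nrm z = 1 -> L2 F ->
  sqdist 1 F g <= 2 * sqdist z F (g * h)%g + 2 * sqdist z F h.
Proof.
move=> z1 LF.
have w1 := sqdist_weight (g * h)%g z1 LF; have w2 := weight_lmul g^-1%g (sqdist_weight h z1 LF).
have w0 := sqdist_weight g nrm1 LF.
rewrite /sqdist -(Rintegral_lmul_weight g^-1%g (sqdist_weight h z1 LF)).
rewrite -RintegralZl //; last exact: weight_summable w1.
rewrite -RintegralZl //; last exact: weight_summable w2.
rewrite -RintegralD //; [|exact: weight_summable (weightZ (ler0n _ 2) w1)|
  exact: weight_summable (weightZ (ler0n _ 2) w2)].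
apply: le_Rintegral => //; [exact: weight_summable w0| |].
  by apply: summableD; apply: summableZl; [exact: weight_summable w1|exact: weight_summable w2].
move=> x _; rewrite mul1r mulgA -invgM.
have := sqr_nrm_dist (F x) (z * F ((g * h)^-1 * x)%g) (F (g^-1 * x)%g).
by rewrite nrmB [nrm (F x - z * _)]nrmB.
Qed.

Lemma sqdistV F g : L2 F -> sqdist 1 F g^-1%g = sqdist 1 F g.
Proof.
move=> LF; rewrite /sqdist -(Rintegral_lmul_weight g (sqdist_weight g nrm1 LF)).
by apply: eq_Rintegral => x _; rewrite invgK mulKg !mul1r nrmB.
Qed.

Lemma sqdistM F g h : L2 F -> sqdist 1 F (g * h)%g <= 2 * sqdist 1 F g + 2 * sqdist 1 F h.
Proof.
move=> LF; have := sqdist_split (g * h)%g h^-1%g nrm1 LF.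
by rewrite mulgK (sqdistV h LF).
Qed.

End SquareFunctions.

Variable W : set G.
Hypothesis W_nbhd : generating_nbhd W.
Hypothesis K_inf : 0 < inf [set K g | g in W].

(** * Control of translates by the moment *)

Section SectorEstimates.

Let kappa := inf [set K g | g in W].

Lemma kappa_le g : W g -> kappa <= K g.
Proof.
move=> Wg; apply: ge_inf; last by exists g.
by exists 0 => _ [x _ <-].
Qed.

Lemma sqdist_borel z F : nrm z = 1 -> L2 F ->
  borel_fun (sqdist z F) /\ exists B, forall h, `|sqdist z F h| <= B.
Proof.
move=> z1 LF; have p := L2_paired (L2_unit z1 LF) LF.
have e : sqdist z F = (fun h => 2 * \int[mu]_x nrm (F x) ^+ 2 - 2 * pairing (fun x => z * F x) F h).
  by apply/funext => h; exact: sqdistE.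
rewrite e; split.
  by apply: measurable_funB => //; apply: measurable_funM => //; exact: pairing_borel.
have [B B0 hB] := pairing_bound p.
exists (`|2 * \int[mu]_x nrm (F x) ^+ 2| + 2 * B) => h.
apply: le_trans (ler_normB _ _) _; rewrite lerD2l normrM ger0_norm // ler_wpM2l //.
exact: (hB h).1.
Qed.

(** The quantity Q(F), with its unimodular factor [z] made explicit. *)
Definition moment z F := \int[mu]_h (K h * sqdist z F h).

Lemma moment_summable z F : nrm z = 1 -> L2 F -> summable_fun (fun h => K h * sqdist z F h).
Proof.
move=> z1 LF; have [m [B hB]] := sqdist_borel z1 LF.
exact: (K_weighted_summable m hB).
Qed.

Lemma moment_ge0 z F : 0 <= moment z F.
Proof. by apply: Rintegral_ge0 => h _; rewrite mulr_ge0 // sqdist_ge0. Qed.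

Lemma moment_ge z F chi : nrm z = 1 -> L2 F -> borel_fun chi -> (forall h, 0 <= chi h) ->
  (forall h, kappa * chi h <= K h) ->
  summable_fun (fun h => chi h * sqdist z F h) /\
  kappa * \int[mu]_h (chi h * sqdist z F h) <= moment z F.
Proof.
move=> z1 LF mchi chi0 chiK; have [mq _] := sqdist_borel z1 LF.
have k0 : 0 < kappa by [].
have sm := moment_summable z1 LF.
have le h : kappa * (chi h * sqdist z F h) <= K h * sqdist z F h.
  by rewrite mulrA ler_wpM2r ?sqdist_ge0.
have mo : weight (fun h => kappa^-1 * (K h * sqdist z F h)).
  apply: weightZ; first by rewrite invr_ge0 ltW.
  split; first by apply: measurable_funM.
    by move=> x; rewrite mulr_ge0 ?sqdist_ge0.
  have /integrableP[_] := sm; apply: le_lt_trans; apply: ge0_le_integral => //.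
  - by move=> x _; rewrite lee_fin mulr_ge0 ?sqdist_ge0.
  - by apply/measurable_EFinP; exact: measurable_funM.
  - by apply: measurableT_comp => //; apply/measurable_EFinP; exact: measurable_funM.
  - by move=> x _; rewrite lee_fin ler_norm.
have s1 : summable_fun (fun h => chi h * sqdist z F h).
  apply: (dominated_summable mo); first exact: measurable_funM.
  move=> x; rewrite ger0_norm ?mulr_ge0 ?sqdist_ge0 // -(ler_pM2l k0).
  by rewrite [leRHS]mulrA mulfV ?gt_eqF // mul1r.
split=> //; rewrite -(RintegralZl kappa measurableT s1).
exact: (le_Rintegral measurableT (summableZl kappa s1) sm (fun h _ => le h)).
Qed.

(** [sqdist_split] for [v] and [w] is averaged over [w] with weight [chi]. The averages at [w] and
    at [v w] are each at most [moment z F / kappa], since [chi] and its translate by [v] lie below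
    [K / kappa]; the factor [4] is [2 + 2]. *)
Lemma sqdist_le_moment z F chi v : nrm z = 1 -> L2 F -> weight chi -> 0 < \int[mu]_h chi h ->
  (forall h, kappa * chi h <= K h) -> (forall h, kappa * chi (v^-1 * h)%g <= K h) ->
  sqdist 1 F v <= 4 / (\int[mu]_h chi h * kappa) * moment z F.
Proof.
move=> z1 LF wchi; have [mchi chi0 _] := wchi; have sV := weight_summable wchi.
move iV : (\int[mu]_h chi h) => m m0 c1 c2; have k0 : 0 < kappa by [].
have [s1 b1] := moment_ge z1 LF mchi chi0 c1.
have mchi2 : borel_fun (fun h => chi (v^-1 * h)%g) by exact: borel_fun_lmul.
have [s2 b2] := moment_ge z1 LF mchi2 (fun h => chi0 _) c2.
have [mq _] := sqdist_borel z1 LF.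
have e2 : \int[mu]_w (chi w * sqdist z F (v * w)%g) =
    \int[mu]_h (chi (v^-1 * h)%g * sqdist z F h).
  rewrite -(Rintegral_lmul v (u := fun h => chi (v^-1 * h)%g * sqdist z F h)).
    by apply: eq_Rintegral => w _; rewrite mulKg.
  exact: measurable_funM.
have s3 : summable_fun (fun w => chi w * sqdist z F (v * w)%g).
  by have := integrable_lmul v s2; under eq_fun do rewrite mulKg.
have key : m * sqdist 1 F v <= 2 * \int[mu]_w (chi w * sqdist z F (v * w)%g) +
    2 * \int[mu]_w (chi w * sqdist z F w).
  have -> : m * sqdist 1 F v = \int[mu]_w (chi w * sqdist 1 F v).
    by rewrite -iV; apply/esym; exact: (RintegralZr _ measurableT sV).
  have t1 := summableZl 2 s3; have t2 := summableZl 2 s1.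
  have e := etrans (RintegralD measurableT t1 t2)
    (f_equal2 +%R (RintegralZl 2 measurableT s3) (RintegralZl 2 measurableT s1)).
  rewrite -e; apply: (le_Rintegral measurableT (summableZr _ sV) (summableD t1 t2)).
  move=> w _; have := ler_wpM2l (chi0 w) (sqdist_split v w z1 LF).
  by rewrite mulrDr (mulrCA _ 2) (mulrCA _ 2).
rewrite e2 in key; rewrite -(ler_pM2l m0); apply: le_trans key _.
rewrite -(ler_pM2l k0).
have -> : kappa * (m * (4 / (m * kappa) * moment z F)) = 4 * moment z F.
  by field; rewrite !gt_eqF.
exact: lin_comb_le.
Qed.

Lemma open_in_W_finite V : V `<=` W -> open V -> V 1%g -> (mu (V : set (borel G)) < +oo)%E /\ 0 < fine (mu (V : set (borel G))).
Proof.
move=> VW oV V1; suff h : (mu (V : set (borel G)) < +oo)%E.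
  by split=> //; apply: fine_gt0; rewrite (haar_open_pos haar W_nbhd oV V1).
apply: (@le_lt_trans _ _ (mu (closure W : set (borel G)))).
  apply: le_measure; rewrite ?inE; [exact: open_borel|apply: compact_borel => //; exact: compact_closure_gen|].
  by apply: subset_trans VW _; exact: subset_closure.
by apply: (haar_compact haar); exact: compact_closure_gen.
Qed.

Lemma indic_weight (V : set G) : measurable (V : set (borel G)) -> (mu V < +oo)%E ->
  weight (\1_V : G -> R) /\ \int[mu]_w \1_V w = fine (mu (V : set (borel G))).
Proof.
move=> mV fV; have e : (\int[mu]_w (\1_V w)%:E = mu (V : set (borel G)))%E.
  by have := integral_indic mu measurableT mV; rewrite setIT.
split; last by congr fine; exact: e.
split; [exact: measurable_indic|by move=> x; rewrite indicE ler0n|].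
by rewrite e.
Qed.

Definition controlled (A : set G) := exists2 c, 0 <= c & forall z F, nrm z = 1 -> L2 F ->
  forall v, A v -> sqdist 1 F v <= c * moment z F.

(** The weight is the indicator of a [V] so small that both [V] and [u V V] lie in [W]: then [V] and
    its translate by any [v] in [u V] stay where [K >= kappa]. *)
Lemma controlled_near u : W u -> exists2 A : set G, nbhs u A & controlled A.
Proof.
case: W_nbhd => oW W1 _ _ _ Wu.
have n1 : nbhs (1%g : G) (W `&` [set y | W (u * y)%g]).
  apply: filterI; first exact: open_nbhs_nbhs.
  by apply: nbhs_lmulV; exact: open_nbhs_nbhs.
have [V [oV V1 VV]] := nbhs1_square n1.
have VW : V `<=` W by move=> v Vv; have [] := VV v; first by exists v => //; exists 1%g; rewrite ?mulg1.
exists [set (u * y)%g | y in V]; first by apply: nbhs_lmul; exact: open_nbhs_nbhs.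
have [mfin m0] := open_in_W_finite VW oV V1.
have [wV iV] := indic_weight (open_borel oV) mfin.
have chiK (A : set G) h : A `<=` W -> kappa * \1_A h <= K h.
  move=> AW; rewrite indicE; have [/set_mem/AW Wh|_] := boolP (h \in A); last by rewrite mulr0.
  by rewrite mulr1; exact: kappa_le.
exists (4 / (fine (mu (V : set (borel G))) * kappa)).
  by rewrite divr_ge0 // mulr_ge0 // ltW.
move=> z F z1 LF _ [y Vy <-]; set v := (u * y)%g; rewrite -iV.
apply: (sqdist_le_moment z1 LF wV); first by rewrite iV.
  by move=> h; exact: chiK.
move=> h; have -> : \1_V (v^-1 * h)%g = \1_[set (v * w)%g | w in V] h :> R.
  rewrite !indicE; congr (_ %:R); congr nat_of_bool; apply/idP/idP; rewrite !inE.
    by move=> Vh; exists (v^-1 * h)%g; rewrite // mulVKg.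
  by move=> [w Vw <-]; rewrite mulKg.
apply: chiK => _ [w Vw <-]; rewrite /v -mulgA.
by have [] := VV (y * w)%g; first by exists y => //; exists w.
Qed.

(** Points with a controlled neighbourhood form a subgroup, by [sqdistM] and [sqdistV], and this
    subgroup contains the generating set [W]. *)
Lemma controlled_nbhs (u : G) : exists2 A : set G, nbhs u A & controlled A.
Proof.
have [_ _ _ _ gW] := W_nbhd.
apply: (generated_ind (H := fun u : G => exists2 A : set G, nbhs u A & controlled A) gW); last first.
  by move=> v; exact: controlled_near.
split.
- by apply: controlled_near; case: W_nbhd.
- move=> g h [A Ag [a a0 hA]] [B Bh [b b0 hB]].
  exists [set w | A (w * h^-1)%g].
    have := @rmul_continuous _ h^-1%g (g * h)%g A; rewrite mulgK; exact.
  exists (2 * a + 2 * b); first by rewrite addr_ge0 // mulr_ge0.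
  move=> z F z1 LF w Aw; rewrite -(mulgVK h w).
  apply: le_trans (sqdistM _ _ LF) _.
  have -> m : (2 * a + 2 * b) * m = 2 * (a * m) + 2 * (b * m) by ring.
  apply: lerD; rewrite ler_wpM2l //; first exact: hA.
  by apply: hB => //; exact: nbhs_singleton.
- move=> g [A Ag [a a0 hA]]; exists [set w | A w^-1%g].
    have := @invg_cont _ g^-1%g A; rewrite invgK; exact.
  by exists a => // z F z1 LF w Aw; rewrite -sqdistV //; exact: hA.
Qed.

Lemma controlled_compact C : compact C -> controlled C.
Proof.
move=> cC; apply: (compact_local (Q := controlled)) cC _.
- by exists 0.
- move=> A B [a a0 hA] [b b0 hB]; exists (a + b); first exact: addr_ge0.
  move=> z F z1 LF v [Av|Bv]; rewrite mulrDl.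
    by apply: le_trans (hA _ _ z1 LF v Av) _; rewrite lerDl mulr_ge0 // moment_ge0.
  by apply: le_trans (hB _ _ z1 LF v Bv) _; rewrite lerDr mulr_ge0 // moment_ge0.
- by move=> A B AB [b b0 hB]; exists b => // z F z1 LF v /AB; exact: hB.
- by move=> x _; exact: controlled_nbhs.
Qed.

End SectorEstimates.

(** * The form of the operator on L^p *)

Section FormBounds.

Lemma increment_small f k C : paired f k ->
  exists b, forall x, C x -> `|increment f k x| <= b.
Proof. by move=> /increment_borel[_ [B hB]]; exists B. Qed.

Section Exponent.
Variable p : R.
Hypothesis p1 : 1 < p.

Let p0 : 0 < p. Proof. exact: lt_trans p1. Qed.

Definition dual_map (f : G -> R[i]) x := psi (p - 1) (f x).
Definition root_map (f : G -> R[i]) x := psi (p / 2) (f x).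

Lemma dual_exponent : 0 < p / (p - 1) /\ p^-1 + (p / (p - 1))^-1 = 1.
Proof.
split; first by rewrite divr_gt0 ?subr_gt0.
by rewrite invf_div; field; rewrite gt_eqF.
Qed.

Lemma Lp_dual_map f : Lp mu p f -> Lp mu (p / (p - 1)) (dual_map f).
Proof. by move=> Lf; apply: Lp_psi; rewrite ?subr_gt0. Qed.

Lemma L2_root_map f : Lp mu p f -> L2 (root_map f).
Proof.
move=> Lf; apply/L2P; have := Lp_psi p0 (divr_gt0 p0 (ltr0n _ 2)) Lf.
by rewrite (_ : p / (p / 2) = 2) //; field; rewrite gt_eqF.
Qed.

Lemma paired_dual_mapZ z f : Lp mu p f -> paired (fun x => z * f x) (dual_map f).
Proof.
move=> Lf; have [q0 pq] := dual_exponent.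
exact: (Lp_paired (ltW p1) q0 pq (LpZ z p0 Lf) (Lp_dual_map Lf)).
Qed.

Let s := 2 / p.

Let s0 : 0 < s. Proof. exact: divr_gt0. Qed.
Let s2 : s < 2. Proof. by rewrite ltr_pdivrMr // ltr_pMr. Qed.

Lemma root_map_psi f x : f x = psi s (root_map f x).
Proof.
rewrite /root_map psi_psi ?divr_gt0 // (_ : s * (p / 2) = 1) ?psi1 //.
by rewrite /s; field; rewrite gt_eqF.
Qed.

Lemma dual_map_psi f x : dual_map f x = psi (2 - s) (root_map f x).
Proof.
rewrite /root_map /dual_map psi_psi ?divr_gt0 ?subr_gt0 //; congr psi.
by rewrite /s; field; rewrite gt_eqF.
Qed.

Lemma sqr_root_map f x : nrm (root_map f x) ^+ 2 = nrm (f x) `^ p.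
Proof.
rewrite /root_map nrm_psi ?divr_gt0 // -powR_mulrn ?powR_ge0 // -powRrM.
by rewrite divfK.
Qed.

(** The two phases are independent: [z] rotates the form, so that a bound on real parts gives one on
    moduli, while [w] twists the moment and is fixed later from the value of the form. *)
Definition form_increments (phi : G -> R) (d : R) := exists f z w,
  [/\ Lp mu p f, nrm z = 1, nrm w = 1, d = moment w (root_map f) &
    phi = increment (fun x => z * f x) (dual_map f)].

Lemma quasi_additive_form_increments : quasi_additive form_increments.
Proof.
split.
- by move=> phi d [f [z [w [_ _ _ -> _]]]]; apply: moment_ge0.
- move=> phi d C [f [z [w [Lf _ _ _ ->]]]] _.
  exact: increment_small (paired_dual_mapZ z Lf).
(* The constant is [5] from [psi_cross_le] times two square distances, each at most [c] times the
   moment with any phase [w]. *)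
- move=> C cC; have [c c0 hc] := controlled_compact cC; exists (10 * c); first by rewrite mulr_ge0.
  move=> phi d [f [z [w [Lf z1 w1 -> ->]]]] g h Cg Ch.
  have [-> sdef] := increment_defect g h (paired_dual_mapZ z Lf).
  have LF := L2_root_map Lf; set F := root_map f in LF *.
  have w3 := sqdist_weight h nrm1 LF; have w4 := sqdist_weight g^-1%g nrm1 LF.
  apply: le_trans (le_normr_Rintegral measurableT sdef) _.
  apply: (@le_trans _ _ (5 * (sqdist 1 F h + sqdist 1 F g^-1%g))).
    rewrite -RintegralD //; [|exact: weight_summable w3|exact: weight_summable w4].
    have s34 := weight_summable (weightD w3 w4).
    rewrite -(RintegralZl 5 measurableT s34).
    apply: le_Rintegral => //; [exact: integrable_norm sdef|exact: summableZl|].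
    move=> x _ /=; apply: le_trans (dot_le _ _) _.
    rewrite -mulrBr nrmM z1 mul1r !mul1r invgK !(root_map_psi f) !dual_map_psi.
    exact: psi_cross_le.
  rewrite (sqdistV g LF).
  have := hc _ _ w1 LF g Cg; have := hc _ _ w1 LF h Ch.
  move: (sqdist _ _ _) (sqdist _ _ _) (moment _ _) => A B M; lra.
Qed.

Lemma form_bound : exists2 c, 0 <= c & forall f z w, Lp mu p f -> nrm z = 1 -> nrm w = 1 ->
  `|\int[mu]_x dot (z * (T f x - f x)) (dual_map f x)| <= c * moment w (root_map f).
Proof.
have [|c c0 hc] := quasi_additive_mean quasi_additive_form_increments.
  move=> phi d [f [z [w [Lf _ _ _ ->]]]]; exact: increment_borel (paired_dual_mapZ z Lf).
exists c => // f z w Lf z1 w1.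
have := hc _ _ (ex_intro _ f (ex_intro _ z (ex_intro _ w (And5 Lf z1 w1 erefl erefl)))).
have [q0 pq] := dual_exponent; have Ld := Lp_dual_map Lf.
rewrite mean_increment; last exact: paired_dual_mapZ.
rewrite -RintegralB //; last 2 first.
- have [LT _] := Lp_conv p1 (LpZ z p0 Lf).
  by have [] := hoelder_dot (ltW p1) q0 pq LT Ld.
- by have [] := hoelder_dot (ltW p1) q0 pq (LpZ z p0 Lf) Ld.
congr (_ <= _); congr `|_|; apply: eq_Rintegral => x _.
by rewrite (conv_opZ z (Lp_tameC (ltW p1) Lf)) mulrBr dotBl.
Qed.

(** This is [dot_psi_le] with [a = F x] and [b = w F (h^-1 x)], integrated in [x] and averaged over
    [h]. Both squares integrate to [powint p f] by left invariance, and their weights [s / 2] and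
    [(2 - s) / 2] add up to [1]. *)
Lemma form_coercive f w : Lp mu p f -> nrm w = 1 ->
  psi_mod s * moment w (root_map f) <=
  powint p f - \int[mu]_x dot (w * T f x) (dual_map f x).
Proof.
move=> Lf w1; have LF := L2_root_map Lf; have pw := paired_dual_mapZ w Lf.
have tf := Lp_tameC (ltW p1) Lf; have [B _ hB] := pairing_bound pw.
have sK := K_weighted_summable (pairing_borel pw) (fun g => (hB g).1).
have sm := moment_summable w1 LF.
have -> : \int[mu]_x dot (w * T f x) (dual_map f x) =
    \int[mu]_h (K h * pairing (fun x => w * f x) (dual_map f) h).
  rewrite -(pairing_conv pw).
  by rewrite (conv_opZ w tf).
have -> : powint p f = \int[mu]_h (K h * powint p f).
  by rewrite RintegralZr // K_integral mul1r.
rewrite -RintegralB //; last exact: summableZr.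
rewrite -(RintegralZl (psi_mod s) measurableT sm).
apply: le_Rintegral => //.
- exact: (summableZl _ sm).
- by apply: summableB => //; exact: summableZr.
move=> h _; rewrite mulrCA -mulrBr ler_wpM2l //.
have [mF wF] := LF.
have wFh := weight_lmul h^-1%g wF; have sd := sqdist_weight h w1 LF.
have sF := weight_summable wF; have sFh := weight_summable wFh.
have -> : powint p f = s / 2 * \int[mu]_x nrm (root_map f (h^-1 * x)%g) ^+ 2 +
    (2 - s) / 2 * \int[mu]_x nrm (root_map f x) ^+ 2.
  rewrite (Rintegral_lmul_weight h^-1%g wF) -mulrDl.
  rewrite (_ : s / 2 + (2 - s) / 2 = 1); last by field.
  by rewrite mul1r; apply: eq_Rintegral => x _; rewrite sqr_root_map.
have sp := pairing_summable h pw.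
have t1 := summableZl (s / 2) sFh; have t2 := summableZl ((2 - s) / 2) sF.
have e := etrans (RintegralD measurableT t1 t2)
  (f_equal2 +%R (RintegralZl (s / 2) measurableT sFh) (RintegralZl ((2 - s) / 2) measurableT sF)).
rewrite -e -(RintegralB measurableT (summableD t1 t2) sp).
have -> : psi_mod s * sqdist w (root_map f) h =
    \int[mu]_x (psi_mod s * nrm (w * root_map f (h^-1 * x)%g - root_map f x) ^+ 2).
  exact: (esym (RintegralZl (psi_mod s) measurableT (weight_summable sd))).
apply: (le_Rintegral measurableT (summableZl _ (weight_summable sd)) (summableB (summableD t1 t2) sp)).
move=> x _ /=; have := dot_psi_le (root_map f x) (w * root_map f (h^-1 * x)%g) s0 s2.
by rewrite nrmM w1 mul1r psiM // -root_map_psi -dual_map_psi.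
Qed.

End Exponent.

End FormBounds.

(** * The Dirichlet form bound *)

Section DirichletBound.

Let p2 : 0 < 2 :> R. Proof. exact: ltr0n. Qed.
Let p12 : 1 < 2 :> R. Proof. exact: ltr1n. Qed.
Let e22 : 2^-1 + 2^-1 = 1 :> R. Proof. by field. Qed.

Lemma Lp_lmul p f g : 0 < p -> Lp mu p f -> Lp mu p (fun x => f (g * x)%g).
Proof.
move=> p0 /(LpP f p0)[mf wf]; apply/(LpP _ p0); split; first exact: borelC_lmul.
exact: (weight_lmul g wf).
Qed.

Lemma Np_lmul p f g : 0 < p -> Lp mu p f -> Np p (fun x => f (g * x)%g) = Np p f.
Proof.
move=> p0 /(LpP f p0)[mf wf]; rewrite /Np /powint.
by rewrite (Rintegral_lmul_weight g wf).
Qed.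

Lemma LpB p f k : 0 < p -> Lp mu p f -> Lp mu p k -> Lp mu p (f \- k).
Proof.
move=> p0 Lf Lk; have := LpD p0 Lf (LpZ (-1) p0 Lk).
by rewrite (_ : _ \+ _ = f \- k) //; apply/funext => x /=; rewrite mulN1r.
Qed.

Lemma NpB p f k : 1 <= p -> Lp mu p f -> Lp mu p k -> Np p (f \- k) <= Np p f + Np p k.
Proof.
move=> p1 Lf Lk; have p0 := lt_le_trans ltr01 p1.
have := NpD p1 Lf (LpZ (-1) p0 Lk); rewrite NpZ // nrmN nrm1 mul1r.
by rewrite (_ : _ \+ _ = f \- k) //; apply/funext => x /=; rewrite mulN1r.
Qed.

Lemma Lp_partial p f g : 0 < p -> Lp mu p f -> Lp mu p (partial g f).
Proof. by move=> p0 Lf; apply: LpB => //; exact: Lp_lmul. Qed.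

Lemma Np_partialM p f g h : 1 <= p -> Lp mu p f ->
  Np p (partial (g * h)%g f) <= Np p (partial g f) + Np p (partial h f).
Proof.
move=> p1 Lf; have p0 := lt_le_trans ltr01 p1.
have Lg := Lp_partial g p0 Lf; have Lh := Lp_partial h p0 Lf.
rewrite addrC -(Np_lmul g^-1%g p0 Lh).
have := NpD p1 (Lp_lmul g^-1%g p0 Lh) Lg.
rewrite (_ : _ \+ _ = partial (g * h)%g f) //; apply/funext => x.
by rewrite /partial /Ltrans /= invgM mulgA subrKA.
Qed.

Definition rGamma p f := fine (Gamma mu U p f).

Lemma GammaE p f : 1 <= p -> Lp mu p f -> Gamma mu U p f = (rGamma p f)%:E /\
  forall u, U u -> Np p (partial u f) <= rGamma p f.
Proof.
move=> p1 Lf; have p0 := lt_le_trans ltr01 p1.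
have nE u : normLp mu p (partial u f) = (Np p (partial u f))%:E.
  exact: normLpE (Lp_partial u p0 Lf).
have U1 : U 1%g by case: U_nbhd.
have ub u : U u -> (normLp mu p (partial u f) <= Gamma mu U p f)%E.
  by move=> Uu; apply: ereal_sup_ubound; exists u.
have fin : Gamma mu U p f \is a fin_num.
  rewrite ge0_fin_numE; last by apply: le_trans (ub _ U1); rewrite nE lee_fin Np_ge0.
  apply: (@le_lt_trans _ _ (Np p f + Np p f)%:E); last exact: ltry.
  apply: ge_ereal_sup => _ [u _ <-]; rewrite nE lee_fin.
  apply: le_trans (NpB p1 (Lp_lmul u^-1%g p0 Lf) Lf) _.
  by rewrite (Np_lmul _ p0 Lf).
split; first by rewrite /rGamma fineK.
by move=> u /ub; rewrite nE -{1}(fineK fin) lee_fin.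
Qed.

Lemma rGamma_ge0 p f : 1 <= p -> Lp mu p f -> 0 <= rGamma p f.
Proof.
move=> p1 Lf; have [_ h] := GammaE p1 Lf.
by apply: le_trans (h 1%g _); [exact: Np_ge0|case: U_nbhd].
Qed.

Lemma Np_partial_powS p f n g : 1 <= p -> Lp mu p f -> powS U n g ->
  Np p (partial g f) <= n%:R * rGamma p f.
Proof.
move=> p1 Lf; have p0 := lt_le_trans ltr01 p1; have [_ hG1] := GammaE p1 Lf.
elim: n g => [g ->|n IH g [a Ua [b Ub <-]]].
  rewrite mul0r (_ : partial 1%g f = (fun x => 0 * f x)) ?NpZ // ?nrm0 ?mul0r //.
  by apply/funext => x; rewrite /partial /Ltrans /= invg1 mul1g subrr mul0r.
apply: le_trans (Np_partialM a b p1 Lf) _; rewrite -natr1 mulrDl mul1r.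
by apply: lerD; [exact: IH|exact: hG1].
Qed.

Definition gamma_increments (phi : G -> R) (d : R) := exists f k,
  [/\ Lp mu 2 f, Lp mu 2 k, d = rGamma 2 f * rGamma 2 k & phi = increment f k].

(** Cauchy-Schwarz separates the two differences in the defect. Elements of [C] are words of some
    bounded length [n] in [U], so each difference costs at most [n] times the corresponding
    [rGamma]. *)
Lemma quasi_additive_gamma_increments : quasi_additive gamma_increments.
Proof.
have pr f k : Lp mu 2 f -> Lp mu 2 k -> paired f k.
  by move=> Lf Lk; exact: (Lp_paired (ltW p12) p2 e22).
split.
- by move=> phi d [f [k [Lf Lk -> _]]]; rewrite mulr_ge0 // rGamma_ge0 // ltW.
- move=> phi d C [f [k [Lf Lk _ ->]]] _.
  exact: (increment_small C (pr _ _ Lf Lk)).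
- move=> C cC; have [n Cn] := compact_sub_powS U_nbhd cC.
  exists (n%:R * n%:R) => // phi d [f [k [Lf Lk -> ->]]] g h Cg Ch.
  have [-> _] := increment_defect g h (pr _ _ Lf Lk).
  have -> : \int[mu]_x dot (f (h^-1 * x)%g - f x) (k (g * x)%g - k x) =
      \int[mu]_x dot (partial h f x) (partial g^-1%g k x).
    by apply: eq_Rintegral => x _; rewrite /partial /Ltrans /= invgK.
  have [_ b] := hoelder_dot (ltW p12) p2 e22 (Lp_partial h p2 Lf) (Lp_partial g^-1%g p2 Lk).
  apply: le_trans b _; rewrite mulrACA; apply: ler_pM; rewrite ?Np_ge0 //.
    by apply: Np_partial_powS => //; [exact: ltW|exact: Cn].
  by apply: Np_partial_powS => //; [exact: ltW|apply: powS_inv => //; exact: Cn].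
Qed.

Lemma real_dirichlet_bound : exists2 c, 0 <= c & forall f k, Lp mu 2 f -> Lp mu 2 k ->
  `|\int[mu]_x dot (T f x - f x) (k x)| <= c * (rGamma 2 f * rGamma 2 k).
Proof.
have [|c c0 hc] := quasi_additive_mean
  quasi_additive_gamma_increments.
  move=> phi d [f [k [Lf Lk _ ->]]].
  exact: (increment_borel (Lp_paired (ltW p12) p2 e22 Lf Lk)).
exists c => // f k Lf Lk.
have := hc _ _ (ex_intro _ f (ex_intro _ k (And4 Lf Lk erefl erefl))).
have pr := Lp_paired (ltW p12) p2 e22 Lf Lk.
rewrite (mean_increment pr).
have [LT _] := Lp_conv p12 Lf.
have [s1 _] := hoelder_dot (ltW p12) p2 e22 LT Lk.
have [s2 _] := hoelder_dot (ltW p12) p2 e22 Lf Lk.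
rewrite -(RintegralB measurableT s1 s2).
by under eq_Rintegral do rewrite -dotBl.
Qed.

Lemma unimodular_phase (w : R[i]) : exists2 z : R[i], nrm z = 1 & z * w = (nrm w)%:C%C.
Proof.
have [->|w0] := eqVneq w 0; first by exists 1; rewrite ?nrm1 // mulr0 nrm0.
have n0 : nrm w != 0 by rewrite nrm_eq0.
exists ((nrm w)%:C%C / w); first by rewrite nrmM nrmV nrmC ger0_norm ?nrm_ge0 // mulfV.
by rewrite divfK.
Qed.

Lemma dot_Re (a b : R[i]) : dot a b = complex.Re (a * conjc b).
Proof. by case: a b => [? ?] [? ?]; rewrite /dot /= mulrN opprK. Qed.

Lemma Re_inner z f k : summable_fun (fun x => dot (f x) (k x)) ->
  summable_fun (fun x => dot ('i%C * f x) (k x)) ->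
  complex.Re (z * inner mu f k) = \int[mu]_x dot (z * f x) (k x).
Proof.
move=> s1 s2; case: z => a b; rewrite /inner /integralC /=.
have -> : \int[mu]_g complex.Re (f g * conjc (k g)) = \int[mu]_x dot (f x) (k x).
  by apply: eq_Rintegral => x _; rewrite dot_Re.
have -> : \int[mu]_g complex.Im (f g * conjc (k g)) = - \int[mu]_x dot ('i%C * f x) (k x).
  rewrite -mulN1r -(RintegralZl (-1) measurableT s2); apply: eq_Rintegral => x _.
  by case: (f x) (k x) => [? ?] [? ?]; rewrite /dot /=; ring.
rewrite mulrN opprK -(RintegralZl a measurableT s1) -(RintegralZl b measurableT s2).
have t1 := summableZl a s1; have t2 := summableZl b s2.
rewrite -(RintegralD measurableT t1 t2); apply: eq_Rintegral => x _.
by case: (f x) (k x) => [? ?] [? ?]; rewrite /dot /=; ring.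
Qed.

Lemma nrm_inner_le p q f k B : 1 <= p -> 0 < q -> p^-1 + q^-1 = 1 -> Lp mu p f -> Lp mu q k ->
  (forall z, nrm z = 1 -> \int[mu]_x dot (z * f x) (k x) <= B) -> nrm (inner mu f k) <= B.
Proof.
move=> p1 q0 pq Lf Lk hB; have p0 := lt_le_trans ltr01 p1.
have [s1 _] := hoelder_dot p1 q0 pq Lf Lk.
have [s2 _] := hoelder_dot p1 q0 pq (LpZ 'i%C p0 Lf) Lk.
have [z z1 zw] := unimodular_phase (inner mu f k).
by have := hB z z1; rewrite -(Re_inner z s1 s2) zw.
Qed.

Lemma rGammaZ p z f : 1 <= p -> nrm z = 1 -> Lp mu p f -> rGamma p (fun x => z * f x) = rGamma p f.
Proof.
move=> p1 z1 Lf; have p0 := lt_le_trans ltr01 p1.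
have e u : normLp mu p (partial u (fun x => z * f x)) = normLp mu p (partial u f).
  have Lu := Lp_partial u p0 Lf.
  have eu : partial u (fun x => z * f x) = (fun x => z * partial u f x).
    by apply/funext => x; rewrite /partial /Ltrans /= mulrBr.
  have Nu : Np p (fun x => z * partial u f x) = Np p (partial u f).
    by rewrite (NpZ z p0 Lu) z1 mul1r.
  have e1 := normLpE p0 (LpZ z p0 Lu); have e2 := normLpE p0 Lu.
  by rewrite eu e1 Nu -e2.
rewrite /rGamma /Gamma; congr fine; congr ereal_sup.
by apply/seteqP; split=> _ [u Uu <-]; exists u => //; exact: e.
Qed.

Theorem dirichlet_bound : exists2 c : R, 0 < c & forall f1 f2 : G -> R[i],
  Lp mu 2 f1 -> Lp mu 2 f2 ->
  ((Normc.normc (inner mu (f1 \- T f1) f2))%:E <=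
    c%:E * Gamma mu U 2 f1 * Gamma mu U 2 f2)%E.
Proof.
have [c c0 hc] := real_dirichlet_bound; exists (c + 1); first by rewrite ltr_wpDl.
move=> f1 f2 L1 L2'; have [-> _] := GammaE (ltW p12) L1; have [-> _] := GammaE (ltW p12) L2'.
rewrite -!EFinM lee_fin; have [LT _] := Lp_conv p12 L1.
have LB := LpB p2 L1 LT.
apply: (nrm_inner_le (ltW p12) p2 e22 LB L2') => z z1.
have zN : nrm (- z) = 1 by rewrite nrmN.
have := hc _ _ (LpZ (- z) p2 L1) L2'; rewrite (rGammaZ (ltW p12) zN L1).
rewrite (conv_opZ (- z) (Lp_tameC (ltW p12) L1)) => h.
have G1 := rGamma_ge0 (ltW p12) L1; have G2 := rGamma_ge0 (ltW p12) L2'.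
apply: (@le_trans _ _ (c * (rGamma 2 f1 * rGamma 2 f2))); last first.
  by rewrite -mulrA ler_wpM2r ?mulr_ge0 // lerDl.
apply: le_trans h; apply: le_trans (ler_norm _); rewrite le_eqVlt; apply/orP; left; apply/eqP.
by apply: eq_Rintegral => x _; congr dot; rewrite /=; ring.
Qed.

End DirichletBound.

(** * Analyticity on L^p *)

Section Analyticity.
Variable p : R.
Hypothesis p1 : 1 < p.

Let p0 : 0 < p. Proof. exact: lt_trans p1. Qed.
Let q0 := (dual_exponent p1).1.
Let pq := (dual_exponent p1).2.
Let LT f (Lf : Lp mu p f) := (Lp_conv p1 Lf).1.

Lemma dot_dual_map (w : R[i]) (f : G -> R[i]) x :
  dot (w * f x) (dual_map p f x) = complex.Re w * nrm (f x) `^ p.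
Proof.
have p10 : 0 < p - 1 by rewrite subr_gt0.
rewrite /dual_map /psi dotZr -(mulr_powRB1 (nrm_ge0 (f x)) p0) -(mulr_powRB1 (nrm_ge0 (f x)) p10).
have -> : dot (w * f x) (f x) = complex.Re w * nrm (f x) ^+ 2.
  rewrite sqr_nrm; case: w (f x) => [? ?] [? ?]; rewrite /dot /=; ring.
by rewrite expr2; ring.
Qed.

Lemma integral_dot_dual_map w f : Lp mu p f ->
  \int[mu]_x dot (w * f x) (dual_map p f x) = complex.Re w * powint p f.
Proof.
move=> /(LpP f p0)[mf wf].
have -> : \int[mu]_x dot (w * f x) (dual_map p f x) = \int[mu]_x (complex.Re w * nrm (f x) `^ p).
  by apply: eq_Rintegral => x _; exact: dot_dual_map.
exact: (RintegralZl _ measurableT (weight_summable wf)).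
Qed.

Let dual_summable f u : Lp mu p f -> Lp mu p u -> summable_fun (fun x => dot (u x) (dual_map p f x)).
Proof.
move=> Lf Lu.
by have [] := hoelder_dot (ltW p1) q0 pq Lu (Lp_dual_map p1 Lf).
Qed.

Lemma Re_inner_dual (w : R[i]) f u : Lp mu p f -> Lp mu p u ->
  complex.Re (w * inner mu u (dual_map p f)) = \int[mu]_x dot (w * u x) (dual_map p f x).
Proof.
move=> Lf Lu; apply: Re_inner; first exact: dual_summable.
exact: dual_summable Lf (LpZ 'i%C p0 Lu).
Qed.

Lemma resolvent_lower_bound : exists2 c, 0 < c & forall z f, nrm z < 1 -> Lp mu p f ->
  c * nrm (1 - z) * Np p f <= Np p (fun x => f x - z * T f x).
Proof.
have [c c0 hc] := form_bound p1.
have m0 : 0 < psi_mod (2 / p).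
  by apply: psi_mod_gt0; rewrite ?divr_gt0 // ltr_pdivrMr // ltr_pMr.
pose C := c / psi_mod (2 / p).
have C0 : 0 <= C by rewrite divr_ge0 // ltW.
have C1 : 0 < 1 + C by rewrite ltr_pwDl.
exists (1 + C)^-1; first by rewrite invr_gt0.
move=> z f z1 Lf; have LTf := LT Lf; have LB := LpB p0 LTf Lf.
have NE : Np p f = powint p f `^ p^-1 by [].
have intE w := integral_dot_dual_map w Lf; have n0 := powint_ge0 p f.
have co w := form_coercive p1 (w := w) Lf.
have PI : powint (p / (p - 1)) (dual_map p f) = powint p f.
  apply: eq_Rintegral => x _.
  by rewrite /dual_map nrm_psi ?subr_gt0 // -powRrM mulrC divfK ?gt_eqF ?subr_gt0.
move: (powint p f) NE intE n0 co PI => n NE intE n0 co PI.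
pose Y := inner mu (T f \- f) (dual_map p f).
(* This is the pairing of [T f] with [dual_map p f], written so that [X - n] is the quantity
   estimated by [form_bound]. *)
pose X := n%:C%C + Y.
have ReX w : complex.Re (w * X) = \int[mu]_x dot (w * T f x) (dual_map p f x).
  have s1 := dual_summable Lf (LpZ w p0 Lf); have s2 := dual_summable Lf (LpZ w p0 LB).
  have -> : complex.Re (w * X) = complex.Re w * n + complex.Re (w * Y).
    exact: Re_mulCD.
  rewrite (Re_inner_dual w Lf LB) -intE -(RintegralD measurableT s1 s2).
  by apply: eq_Rintegral => x _; rewrite -dotDl; congr dot; rewrite /=; ring.
(* For [w X = |X|], [form_coercive] bounds a multiple of [moment w] by [n - |X|], while [form_bound]
   bounds [|X - n|] by a multiple of the same moment. The free twist in [form_bound] is what allows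
   this choice of [w]. *)
have hX : nrm (X - n%:C%C) <= C * (n - nrm X).
  have [w w1 wX] := unimodular_phase X.
  have {}co := co w w1; rewrite -ReX wX /= in co.
  rewrite (_ : X - _ = Y); last by rewrite /X addrC addrA addNr add0r.
  apply: (@le_trans _ _ (c * moment w (root_map p f))).
    apply: (nrm_inner_le (ltW p1) q0 pq LB (Lp_dual_map p1 Lf)) => v v1.
    by apply: le_trans (ler_norm _) _; exact: hc.
  rewrite /C -mulrA ler_wpM2l // mulrC ler_pdivlMr // mulrC; exact: co.
have st := stolz_bound n0 C0 hX z1.
have LR : Lp mu p (fun x => f x - z * T f x) := LpB p0 Lf (LpZ z p0 LTf).
have up : nrm (n%:C%C - z * X) <= Np p (fun x => f x - z * T f x) * Np (p / (p - 1)) (dual_map p f).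
  have [v v1 vX] := unimodular_phase (n%:C%C - z * X).
  have -> : nrm (n%:C%C - z * X) = \int[mu]_x dot (v * (f x - z * T f x)) (dual_map p f x).
    have s1 := dual_summable Lf (LpZ v p0 Lf); have s2 := dual_summable Lf (LpZ (v * z) p0 LTf).
    transitivity (complex.Re v * n - complex.Re (v * z * X)).
      by rewrite -[LHS]/(complex.Re (nrm (n%:C%C - z * X))%:C%C) -vX -mulrA Re_mulCD
        mulrN; case: (v * (z * X)).
    rewrite ReX -intE -(RintegralB measurableT s1 s2).
    by apply: eq_Rintegral => x _; rewrite -dotBl; congr dot; ring.
  have [_ b] := hoelder_dot (ltW p1) q0 pq (LpZ v p0 LR) (Lp_dual_map p1 Lf).
  by apply: le_trans (ler_norm _) _; apply: le_trans b _; rewrite (NpZ v p0 LR) v1 mul1r.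
have Nq : Np (p / (p - 1)) (dual_map p f) = n `^ (p / (p - 1))^-1.
  by rewrite /Np PI.
have [n00|nn0] := eqVneq n 0.
  by rewrite NE n00 powR0 ?mulr0 ?Np_ge0 // invr_neq0 // gt_eqF.
have npos : 0 < n by rewrite lt_neqAle eq_sym nn0.
(* The duality map attains equality in Hoelder's inequality, so the factor [n^(1/q)] from [up] can
   be cancelled, leaving [Np p f]. *)
have nE : n = Np p f * n `^ (p / (p - 1))^-1.
  rewrite NE -powRD; last by rewrite pq nn0 implybT.
  by rewrite pq powRr1.
rewrite Nq in up; have P := powR_gt0 (p / (p - 1))^-1 npos.
rewrite -(ler_pM2r P) -(ler_pM2l C1); apply: le_trans (ler_wpM2l (ltW C1) up).
have e (a b d : R) : (1 + C) * ((1 + C)^-1 * a * b * d) = b * d * a by field; rewrite gt_eqF.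
by rewrite e -nE.
Qed.

Lemma analytic_conv_op : analytic mu p T.
Proof.
have [c c0 hc] := resolvent_lower_bound.
(* All functions form the module and [Lp] is the stable subset [E]; the norm axioms and the
   linearity of [T] are supplied on [E], so no passage to classes modulo null sets is made. *)
pose V : lmodType R[i] := (G -> R[i]^o) : lmodType R[i].
pose E : set V := Lp mu p; pose N : V -> R := Np p; pose S : V -> V := T.
have E0 : E 0.
  suff : Lp mu p (fun=> 0 : R[i]) by [].
  apply/(LpP _ p0); split; first exact: borelC_cst.
  split; [|by move=> x; rewrite powR_ge0|].
    exact: (borel_nrm_powR p (borelC_cst 0)).
  rewrite (eq_integral (fun=> 0%E)) ?integral0 ?ltry // => x _.
  by rewrite -[RHS](congr1 EFin (powR0 (lt0r_neq0 p0))); congr (_ `^ _)%:E; exact: nrm0.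
have ED u v : E u -> E v -> E (u + v) by move=> Eu Ev; exact: (LpD p0 Eu Ev).
have aE (a : R[i]) (u : V) : a *: u = (fun x => a * (u x : R[i])) by [].
have EZ a u : E u -> E (a *: u).
  by move=> Eu; rewrite aE; exact: (@LpZ p a u p0 Eu).
have ES u : E u -> E (S u) by move=> Eu; exact: LT Eu.
have SD u v : E u -> E v -> S (u + v) = S u + S v.
  by move=> Eu Ev; exact: (conv_opD (Lp_tameC (ltW p1) Eu) (Lp_tameC (ltW p1) Ev)).
have SZ a u : E u -> S (a *: u) = a *: S u.
  by move=> Eu; rewrite !aE; exact: (conv_opZ a (Lp_tameC (ltW p1) Eu)).
have N0 u : 0 <= N u by exact: Np_ge0.
have ND u v : E u -> E v -> N (u + v) <= N u + N v.
  by move=> Eu Ev; exact: (NpD (ltW p1) Eu Ev).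
have NZ a u : E u -> N (a *: u) = nrm a * N u by move=> Eu; rewrite aE; exact: (@NpZ p a u p0 Eu).
have NS u : E u -> N (S u) <= N u.
  by move=> Eu; exact: (Np_conv p1 Eu).
have lb z u : nrm z < 1 -> E u -> c * nrm (1 - z) * N u <= N (u - z *: S u).
  by move=> z1 Eu; rewrite aE; exact: (hc z u z1 Eu).
have [C C0 hC] := ritt E0 ED EZ ES SD SZ N0 ND NZ NS c0 lb.
exists C => // n n0; apply: ereal_inf_lbound; exists (C / n%:R) => //.
split; first by rewrite divr_ge0 // ltW.
have Ln m f : Lp mu p f -> Lp mu p (iter m T f).
  by move=> Lf; elim: m => //= m IH; exact: LT.
move=> f Lf; have LB : Lp mu p (iter n T f \- T (iter n T f)).
  by apply: LpB => //; [exact: Ln|exact: LT (Ln _ _ Lf)].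
split=> //; rewrite (normLpE p0 LB) (normLpE p0 Lf) -EFinM lee_fin.
exact: (hC n f n0 Lf).
Qed.

End Analyticity.

End CenteredConvolution.

Theorem theorem1p16 (R : realType) (G : topologicalGroupType)
  (G_hausdorff : hausdorff_space G)
  (G_locally_compact : locally_compact [set: G])
  (G_compactly_generated : compactly_generated G)
  (mu : {measure set (borel G) -> \bar R}) (mu_haar : left_haar_measure mu)
  (U : set G) (U_nbhd : generating_nbhd U)
  (D : splitting R G)
  (K : G -> R)
  (K_density : probability_density mu K)
  (K_centered : centered mu D K)
  (K_supp : compactly_supported K)
  (K_bounded : bounded_fun K)
  (K_inf : exists2 W : set G, generating_nbhd W & 0 < inf [set K g | g in W]) :
  let T := conv_op mu K in
  (exists2 c : R, 0 < c & forall f1 f2 : G -> R[i],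
     Lp mu 2 f1 -> Lp mu 2 f2 ->
     ((Normc.normc (inner mu (f1 \- T f1)%R f2))%:E <=
       c%:E * Gamma mu U 2 f1 * Gamma mu U 2 f2)%E) /\
  (forall p : R, 1 < p -> analytic mu p T).
Proof.
have [W W_nbhd W_inf] := K_inf; split.
  exact: (dirichlet_bound G_hausdorff G_locally_compact mu_haar U_nbhd K_density K_supp
    K_bounded K_centered).
move=> p p1; exact: (analytic_conv_op G_hausdorff G_locally_compact mu_haar U_nbhd K_density
  K_supp K_bounded K_centered W_nbhd W_inf p1).
Qed.
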